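(* Let $(X,\mathcal U,s)$ be in the standard setup, and let $(A,\alpha)\in\mathfrak{Br}_{\mathbb R^n}(X)$ have image $[\phi]=[\phi^{20},\phi^{11},\phi^{02}]\in\mathbb H^2_{\check\partial s}(\pi(\mathcal U),\mathcal S)$ under $\Xi_{\mathcal U,s}$, where the representative $\phi=(\phi^{20},\phi^{11},\phi^{02})$ is the one defined by local trivialisations $\Phi_\lambda$ of $A$ and unitary-valued maps $v_\lambda^m$, $v_{\lambda_0\lambda_1}$ as in the definition of $\Xi_{\mathcal U,s}$. Let $A_\phi$ be the associated algebra glued from induced algebras, with its translation action $\alpha'$ of $\mathbb R^n$. Then the image of $[A_\phi,\alpha']$ under $\Xi_{\mathcal U,s}$ equals $[\phi^{20},\phi^{11},\phi^{02}]$, and $(A,\alpha)$ is outer conjugate to $(A_\phi,\alpha')$.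
   Context: Standard setup. $(X,\mathcal U,s)$ is in the standard setup if: $\pi:X\to Z$ is a $C^\infty$ principal $\mathbb R^n/\mathbb Z^n$-bundle over a Riemannian manifold $Z$; $\mathcal U=\{U_\lambda\}_{\lambda\in\mathcal I}$ is a good open cover of $X$ (all nonempty finite intersections contractible) such that $\pi(\mathcal U)=\{\pi(U_\lambda)\}$ is a good open cover of $Z$; $C^\infty$ local sections $\sigma_\lambda:\pi(U_\lambda)\to U_\lambda$ are fixed; and $s$ is a Čech 1-cochain on $\pi(\mathcal U)$ with values in continuous $\mathbb R^n$-valued functions such that $s_{\lambda_0\lambda_1}(z)\cdot\sigma_{\lambda_1}(z)=\sigma_{\lambda_0}(z)$ on $\pi(U_{\lambda_0})\cap\pi(U_{\lambda_1})$ and $s_{\lambda\lambda}=0$. $\mathbb R^n$ acts on $X$ through $\mathbb R^n/\mathbb Z^n$. Then $\check\partial s$ is $\mathbb Z^n$-valued, $\check\partial s_{\lambda_0\lambda_1\lambda_2}=s_{\lambda_1\lambda_2}-s_{\lambda_0\lambda_2}+s_{\lambda_0\lambda_1}$. Equivariant Brauer group. $\mathcal K$ is the compacts on a separable infinite-dimensional Hilbert space $\mathcal H$; $U(\mathcal H)$ has the strong operator topology. A (separable, stable) continuous trace algebra with spectrum $X$ is a $C^*$-algebra $C_0(X)$-isomorphic to the $C_0$-sections of a locally trivial bundle over $X$ with fibre $\mathcal K$ and structure group $\operatorname{Aut}\mathcal K$. $\mathfrak{Br}_{\mathbb R^n}(X)$ is the collection of pairs $(A,\alpha)$, $A$ such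 an algebra, $\alpha$ an action of $\mathbb R^n$ with $\alpha_g(f\cdot a)=\tau_g(f)\cdot\alpha_g(a)$, $f\in C_b(X)$, $\tau_g(f)(x)=f(g^{-1}x)$. $(A,\alpha)$, $(B,\beta)$ are outer conjugate if there are a $C_0(X)$-isomorphism $\psi:A\to B$ and a strictly continuous $w:\mathbb R^n\to UM(A)$ (unitaries of the multiplier algebra) with $\psi^{-1}\beta_g\psi(a)=w_g\alpha_g(a)w_g^*$ and $w_{gh}=w_g\overline\alpha_g(w_h)$. $\operatorname{Br}_{\mathbb R^n}(X)$ is the set of outer conjugacy classes, a group under $[A,\alpha]\cdot[B,\beta]=[A\otimes_{C_0(X)}B,\alpha\otimes_X\beta]$. Dimensionally reduced cohomology with $\mathbb T$ coefficients. Write $\mathbb T=U(1)\cong\mathbb R/\mathbb Z$ additively for the moment. For an open cover $\mathcal W$ of $Z$ and $F\in\check Z^2(\mathcal W,\underline{\mathbb Z}^n)$, $C^k_F(\mathcal W,\mathcal S)$ consists of triples $(\phi^{k0},\phi^{(k-1)1},\phi^{(k-2)2})$ of Čech cochains (zero in negative degree) of degrees $k,k-1,k-2$ with values in continuous functions to $\mathbb T$, to $\hat{\mathbb Z}^n=\operatorname{Hom}(\mathbb Z^n,\mathbb T)$, and to $M_n^u(\mathbb T)$ (strictly upper triangular matrices), respectively. For $i<j$ put $C(F)_{\lambda_0\lambda_1\lambda_2\lambda_3}(z)_{ij}=F_{\lambda_0\lambda_1\lambda_2}(z)_iF_{\lambda_0\lambda_2\lambda_3}(z)_j-F_{\lambda_1\lambda_2\lambda_3}(z)_iF_{\lambda_0\lambda_1\lambda_3}(z)_j$,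 and $(\phi^{(k-1)1}\cup_1F)_{\lambda_0\dots\lambda_{k+1}}(z)=\phi^{(k-1)1}_{\lambda_0\dots\lambda_{k-1}}(F_{\lambda_{k-1}\lambda_k\lambda_{k+1}}(z),z)$, $(\phi^{(k-2)2}\cup_1F)_{\lambda_0\dots\lambda_k}(m,z)=\sum_{i<j}\big(F_{\lambda_{k-2}\lambda_{k-1}\lambda_k}(z)_im_j-m_iF_{\lambda_{k-2}\lambda_{k-1}\lambda_k}(z)_j\big)\phi^{(k-2)2}_{\lambda_0\dots\lambda_{k-2}}(z)_{ij}$, $(\phi^{(k-2)2}\cup_2C(F))_{\lambda_0\dots\lambda_{k+1}}(z)=\sum_{i<j}C(F)_{\lambda_{k-2}\lambda_{k-1}\lambda_k\lambda_{k+1}}(z)_{ij}\,\phi^{(k-2)2}_{\lambda_0\dots\lambda_{k-2}}(z)_{ij}$. The differential is $D_F(\phi^{k0},\phi^{(k-1)1},\phi^{(k-2)2})=(\check\partial\phi^{k0}+(-1)^{k+1}\phi^{(k-1)1}\cup_1F+(-1)^{k+1}\phi^{(k-2)2}\cup_2C(F),\ \check\partial\phi^{(k-1)1}+(-1)^k\phi^{(k-2)2}\cup_1F,\ \check\partial\phi^{(k-2)2})$, with cohomology $\mathbb H^k_F(\mathcal W,\mathcal S)$. Here $\mathcal W=\pi(\mathcal U)$, $F=\check\partial s$. The map $\Xi_{\mathcal U,s}:\operatorname{Br}_{\mathbb R^n}(X)\to\mathbb H^2_{\check\partial s}(\pi(\mathcal U),\mathcal S)$. Given $(A,\alpha)$,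 choose $C_0(U_\lambda)$-isomorphisms $\Phi_\lambda:A|_{U_\lambda}\to C_0(U_\lambda,\mathcal K)$; for $a\in A$ and $y\in U_\lambda$, $\Phi_\lambda(a)(y)$ denotes the induced value at $y$. For $x\in U_{\lambda_1}$, $g\in\mathbb R^n$ with $g^{-1}x\in U_{\lambda_0}$, and $T\in\mathcal K$ set $\beta^{\alpha,\Phi}_{(\lambda_0(g,x)\lambda_1)}(T)=\Phi_{\lambda_1}(\alpha_g(a))(x)$ for any $a\in A$ with $\Phi_{\lambda_0}(a)(g^{-1}x)=T$. With $e_i$ the standard generators of $\mathbb Z^n$, choose continuous $v^i_\lambda:U_\lambda\to U(\mathcal H)$ with $\Phi_\lambda\circ\alpha_{e_i}\circ\Phi_\lambda^{-1}=\operatorname{Ad}v^i_\lambda$, put $v^m_\lambda=(v^1_\lambda)^{m_1}\cdots(v^n_\lambda)^{m_n}$ for $m\in\mathbb Z^n$ and $v^m_\lambda(z):=v^m_\lambda(\sigma_\lambda(z))$ for $z\in\pi(U_\lambda)$; choose continuous $v_{\lambda_0\lambda_1}:\pi(U_{\lambda_0})\cap\pi(U_{\lambda_1})\to U(\mathcal H)$ with $\beta^{\alpha,\Phi}_{(\lambda_0(-s_{\lambda_0\lambda_1}(z),\sigma_{\lambda_1}(z))\lambda_1)}=\operatorname{Ad}v_{\lambda_0\lambda_1}(z)$. Define (multiplicatively in $U(1)$) $\phi^{02}_{\lambda}(z)_{ij}=v^{e_j}_\lambda(z)v^{e_i}_\lambda(z)v^{e_j}_\lambda(z)^*v^{e_i}_\lambda(z)^*$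 for $i<j$, $\phi^{11}_{\lambda_0\lambda_1}(m,z)=v^m_{\lambda_1}(z)v_{\lambda_0\lambda_1}(z)v^m_{\lambda_0}(z)^*v_{\lambda_0\lambda_1}(z)^*$, $\phi^{20}_{\lambda_0\lambda_1\lambda_2}(z)=v_{\lambda_1\lambda_2}(z)v_{\lambda_0\lambda_1}(z)v_{\lambda_0}^{-\check\partial s_{\lambda_0\lambda_1\lambda_2}(z)}(z)^*v_{\lambda_0\lambda_2}(z)^*$. This triple is a cocycle whose class depends only on $[A,\alpha]$, and $\Xi_{\mathcal U,s}[A,\alpha]=[\phi^{20},\phi^{11},\phi^{02}]$. The algebra $A_\phi$. The maps $m\mapsto v^m_\lambda(\cdot)$ define a locally inner action $\operatorname{Ad}v^\bullet_\lambda$ of $\mathbb Z^n$ on $C_0(\pi(U_\lambda),\mathcal K)$, with induced algebra $\operatorname{Ind}_{\mathbb Z^n}^{\mathbb R^n}(C_0(\pi(U_\lambda),\mathcal K),\operatorname{Ad}v^\bullet_\lambda)$ consisting of the continuous functions $\eta:\mathbb R^n\to C_0(\pi(U_\lambda),\mathcal K)$ with $\eta(t+m)=\operatorname{Ad}v_\lambda^{-m}(\eta(t))$ for $t\in\mathbb R^n$, $m\in\mathbb Z^n$. $A_\phi$ is the $C^*$-algebra (pointwise operations) of families $\xi=\{\xi_\lambda\}$ with $\xi_\lambda\in\operatorname{Ind}_{\mathbb Z^n}^{\mathbb R^n}(C_0(\pi(U_\lambda),\mathcal K),\operatorname{Ad}v^\bullet_\lambda)$ such that $\operatorname{Ad}v_{\lambda_0\lambda_1}(z)[\xi_{\lambda_0}(t)(z)]=\xi_{\lambda_1}(t+s_{\lambda_0\lambda_1}(z))(z)$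 for all $z\in\pi(U_{\lambda_0})\cap\pi(U_{\lambda_1})$, $t\in\mathbb R^n$. The action is $\alpha'_r(\xi)_\lambda(t)(z)=\xi_\lambda(t-r)(z)$, $r\in\mathbb R^n$. The spectrum of $A_\phi$ is identified with $X$ by letting $x=[t]\cdot\sigma_\lambda(z)$ correspond to the representation $\xi\mapsto\xi_\lambda(t)(z)$.
   Formalization: In the algebra A_φ the functions ξ_λ(t) are taken bounded and norm-continuous on π(U_λ), not in C_0(π(U_λ),K), and the norm function on X is required to vanish at infinity; the literal C_0 condition would force vanishing over boundaries of the π(U_λ). *)

(* Defs.v *)
From HB Require Import structures.
From mathcomp Require Import all_boot all_order all_algebra.
From mathcomp Require Import all_classical all_reals all_analysis.
From mathcomp Require Import complex.
Set Implicit Arguments.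
Unset Strict Implicit.
Unset Printing Implicit Defensive.
Import Order.TTheory GRing.Theory Num.Theory numFieldNormedType.Exports.
Local Open Scope classical_set_scope.
Local Open Scope ring_scope.

(* Objects are raw records (carrier and operations); their axioms are separate
   predicates (is_manifold, is_cstar, in_Br, ...).  A partially defined
   function is a total one whose values off its domain carry no meaning. *)

Definition capl (I T : Type) (W : I -> set T) (l : seq I) : set T :=
  foldr (fun i A => W i `&` A) setT l.

Section Topology.
Variable R : realType.

Definition contractible (T : topologicalType) (S : set T) : Prop :=
  exists2 x0 : T, S x0 &
  exists2 h : R * T -> T,
    {within `[0, 1]%classic `*` S, continuous h} &
    forall x, S x ->
      [/\ forall t : R, 0 <= t <= 1 -> S (h (t, x)),
          h (0, x) = x & h (1, x) = x0].

Definition good_open_cover (I : Type) (T : topologicalType) (W : I -> set T) :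
    Prop :=
  [/\ forall i, open (W i),
      \bigcup_i W i = setT &
      forall (i : I) (l : seq I),
        capl W (i :: l) !=set0 -> contractible (capl W (i :: l))].

(* Continuous functions vanishing at infinity on the open set U, extended by
   zero to the whole space. *)
Definition C0 (T : topologicalType) (U : set T) (f : T -> R[i]) : Prop :=
  [/\ {within U, continuous (f : T -> R[i]^o)},
      forall x, ~ U x -> f x = 0 &
      forall e : R[i], 0 < e -> compact (U `&` [set x | e <= `|f x|])].

Definition Cb (T : topologicalType) (f : T -> R[i]) : Prop :=
  continuous (f : T -> R[i]^o) /\ exists M : R[i], forall x, `|f x| <= M.

End Topology.

Section Smooth.
Variable R : realType.

Fixpoint Ck (d : nat) (k : nat) (U : set 'rV[R]_d) (f : 'rV[R]_d -> R) : Prop :=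
  {within U, continuous f} /\
  if k is k'.+1 then
    forall i : 'I_d,
      (forall x, U x -> derivable f x (delta_mx 0 i)) /\
      Ck k' U (fun x => 'D_(delta_mx 0 i) f x)
  else True.

Definition Cinfty (d m : nat) (U : set 'rV[R]_d) (f : 'rV[R]_d -> 'rV[R]_m) :=
  forall (k : nat) (j : 'I_m), Ck k U (fun x => f x 0 j).

Record chart (T : Type) (d : nat) := Chart {
  cdom : set T;
  cmap : T -> 'rV[R]_d;
  cinv : 'rV[R]_d -> T }.

Definition is_chart (T : topologicalType) d (c : chart T d) : Prop :=
  [/\ open (cdom c) /\ open (cmap c @` cdom c),
      {within cdom c, continuous (cmap c)},
      {within cmap c @` cdom c, continuous (cinv c)} &
      forall x, cdom c x -> cinv c (cmap c x) = x].

Record mfd (d : nat) := Mfd {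
  mpt :> topologicalType;
  atlas : set (chart mpt d) }.

Definition transition d (M : mfd d) (c c' : chart M d) : 'rV[R]_d -> 'rV[R]_d :=
  cmap c' \o cinv c.

Definition is_manifold d (M : mfd d) : Prop :=
  [/\ hausdorff_space M, @second_countable M,
      forall x : M, exists2 c, atlas c & cdom c x,
      forall c, @atlas d M c -> is_chart c &
      forall c c', @atlas d M c -> @atlas d M c' ->
        Cinfty (cmap c @` (cdom c `&` cdom c')) (transition c c')].

Definition smooth_map d e (M : mfd d) (N : mfd e) (W : set M) (f : M -> N) :=
  {within W, continuous f} /\
  forall c c', @atlas d M c -> @atlas e N c' ->
    Cinfty (cmap c @` (W `&` cdom c `&` f @^-1` cdom c'))
           (cmap c' \o f \o cinv c).

Definition euclid (n : nat) : mfd n :=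
  @Mfd n 'rV[R]_n [set Chart setT id id].

Definition prod_chart (S T : Type) d e (c : chart S d) (c' : chart T e) :
    chart (S * T) (d + e) :=
  Chart (cdom c `*` cdom c')
        (fun p => row_mx (cmap c p.1) (cmap c' p.2))
        (fun v => (cinv c (lsubmx v), cinv c' (rsubmx v))).

Definition prod_mfd d e (M : mfd d) (N : mfd e) : mfd (d + e) :=
  @Mfd (d + e) (M * N)%type
    [set prod_chart c c' | c in @atlas d M & c' in @atlas e N].

(* A metric is given by its Gram matrices in the charts; vectors are rows, so
   the differential of f acts as v |-> v *m J. *)
Definition jacobian d (f : 'rV[R]_d -> 'rV[R]_d) (x : 'rV[R]_d) : 'M[R]_d :=
  \matrix_(i, j) 'D_(delta_mx 0 i) (fun y => f y 0 j : R) x.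

Definition is_riemannian_metric d (M : mfd d)
    (g : chart M d -> 'rV[R]_d -> 'M[R]_d) : Prop :=
  (forall c, @atlas d M c ->
    (forall k i j, Ck k (cmap c @` cdom c) (fun x => g c x i j)) /\
    forall x, (cmap c @` cdom c) x ->
      (g c x)^T = g c x /\
      forall v : 'rV[R]_d, v != 0 -> 0 < (v *m g c x *m v^T) 0 0) /\
  forall c c', @atlas d M c -> @atlas d M c' ->
    forall x, (cmap c @` (cdom c `&` cdom c')) x ->
      let J := jacobian (transition c c') x in
      g c x = J *m g c' (transition c c' x) *m J^T.

Definition lattice (n : nat) (m : 'rV[int]_n) : 'rV[R]_n :=
  map_mx intr m.

(* The R^n/Z^n-action is presented as an R^n-action whose isotropy groups are
   all equal to Z^n.  A local trivialisation V x R^n/Z^n -> pi^-1(V) is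
   (z, [t]) |-> t . chi z for a smooth local section chi; smoothness of its
   inverse x |-> (pi x, [theta x]) means that theta locally lifts to a smooth
   R^n-valued map. *)
Definition is_principal_torus_bundle (n dX dZ : nat) (X : mfd dX) (Z : mfd dZ)
    (pr : X -> Z) (act : 'rV[R]_n -> X -> X) : Prop :=
  [/\ (forall x, act 0 x = x) /\
        (forall t t' x, act (t + t') x = act t (act t' x)),
      @smooth_map _ _ (prod_mfd (euclid n) X) X setT (fun p => act p.1 p.2),
      forall t x, act t x = x <-> exists m, t = lattice m,
      smooth_map setT pr /\ (forall t x, pr (act t x) = pr x) &
      forall z : Z, exists (V : set Z) (chi : Z -> X),
        [/\ open V /\ V z, smooth_map V chi,
            forall y, V y -> pr (chi y) = y &
            forall x, V (pr x) -> exists (N : set X) (theta : X -> euclid n),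
              [/\ open N /\ N x, N `<=` pr @^-1` V, smooth_map N theta &
                  forall y, N y -> y = act (theta y) (chi (pr y))]]].

Record setup (n : nat) (I : Type) := Setup {
  dimX : nat; dimZ : nat;
  spX : mfd dimX; spZ : mfd dimZ;
  metric : chart spZ dimZ -> 'rV[R]_dimZ -> 'M[R]_dimZ;
  proj : spX -> spZ;
  tact : 'rV[R]_n -> spX -> spX;
  cov : I -> set spX;
  sec : I -> spZ -> spX;
  scoch : I -> I -> spZ -> 'rV[R]_n }.

Definition pcov n I (S : setup n I) (i : I) : set (spZ S) :=
  @proj n I S @` cov i.
Arguments pcov [n I] S i _.

Definition is_standard_setup n I (S : setup n I) : Prop :=
  [/\ [/\ is_manifold (spX S), is_manifold (spZ S),
          is_riemannian_metric (@metric n I S) &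
          is_principal_torus_bundle (@proj n I S) (@tact n I S)],
      good_open_cover R (@cov n I S) /\ good_open_cover R (@pcov n I S),
      forall i, smooth_map (pcov S i) (@sec n I S i) /\
        forall z, pcov S i z -> cov i (sec i z) /\ proj (sec i z) = z,
      forall i j, {within pcov S i `&` pcov S j, continuous (@scoch n I S i j)}
        /\ forall z, (pcov S i `&` pcov S j) z ->
             tact (scoch i j z) (sec j z) = sec i z &
      forall i z, pcov S i z -> scoch i i z = 0 :> 'rV[R]_n].

End Smooth.
Arguments pcov [R n I] S i _.

Section Circle.
Variable R : realType.

Record circle := Circle { cval : R[i]; _ : `|cval| == 1 }.

HB.instance Definition _ := [isSub for cval].
HB.instance Definition _ := [Choice of circle by <:].

Fact circle_norm (x : circle) : `|cval x| = 1.
Proof. by case: x => z /= /eqP. Qed.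

Fact circle0P : `|1 : R[i]| == 1.
Proof. by rewrite normr1. Qed.

Fact circleDP (x y : circle) : `|cval x * cval y| == 1.
Proof. by rewrite normrM !circle_norm mulr1. Qed.

Fact circleNP (x : circle) : `|(cval x)^-1| == 1.
Proof. by rewrite normfV circle_norm invr1. Qed.

Definition circle0 := Circle circle0P.
Definition circleD x y := Circle (circleDP x y).
Definition circleN x := Circle (circleNP x).

Fact circleA : associative circleD.
Proof. by move=> x y z; apply/val_inj; rewrite /= mulrA. Qed.
Fact circleC : commutative circleD.
Proof. by move=> x y; apply/val_inj; rewrite /= mulrC. Qed.
Fact circle0D : left_id circle0 circleD.
Proof. by move=> x; apply/val_inj; rewrite /= mul1r. Qed.
Fact circleND : left_inverse circle0 circleN circleD.
Proof.
move=> x; apply/val_inj; rewrite /= mulVf //.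
by rewrite -normr_eq0 circle_norm oner_eq0.
Qed.

HB.instance Definition _ :=
  GRing.isZmodule.Build circle circleA circleC circle0D circleND.

End Circle.

(* A degree k Cech cochain is evaluated on lists [:: i_0; ...; i_k] of k + 1
   indices; the empty list stands for degree -1. *)
Section Cech.
Variables (R : realType) (I : Type).

Definition cech (Z : Type) (V : zmodType) (phi : seq I -> Z -> V)
    (l : seq I) (z : Z) : V :=
  \sum_(i < size l) phi (take i l ++ drop i.+1 l) z *~ (-1) ^+ i.

Definition coch2 (Z : Type) (V : zmodType) (s : I -> I -> Z -> V)
    (l : seq I) : Z -> V :=
  if l is [:: i; j] then s i j else 0.

(* The integral cocycle F with lattice F = cech s. *)
Definition cechs n (S : setup R n I) (l : seq I) (z : spZ S) : 'rV[int]_n :=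
  map_mx Num.floor (cech (coch2 (@scoch R n I S)) l z).

Variables (n : nat) (Z : topologicalType) (W : I -> set Z).
Variable F : seq I -> Z -> 'rV[int]_n.

Definition triple : zmodType :=
  ((seq I -> Z -> circle R) * (seq I -> Z -> 'rV[int]_n -> circle R) *
   (seq I -> Z -> 'M[circle R]_n))%type.

Definition continuousT (A : set Z) (f : Z -> circle R) : Prop :=
  {within A, continuous ((fun z => cval (f z)) : Z -> R[i]^o)}.

(* Membership in C^k_F: components of degrees k, k - 1 and k - 2, i.e. on lists
   of k + 1, k and k - 1 indices (k.-1 = 0 also when k = 0, where the last
   component has degree -2 and vanishes as well). *)
Definition in_cochains (k : nat) (phi : triple) : Prop :=
  [/\ forall l, size l = k.+1 -> continuousT (capl W l) (phi.1.1 l),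
      forall l, size l = k ->
        if l is [::] then phi.1.2 l = 0 else
        (forall m, continuousT (capl W l) (fun z => phi.1.2 l z m)) /\
        forall z, capl W l z -> {morph phi.1.2 l z : m m' / m + m'} &
      forall l, size l = k.-1 ->
        if l is [::] then phi.2 l = 0 else
        (forall i j, continuousT (capl W l) (fun z => phi.2 l z i j)) /\
        forall z, capl W l z -> forall i j : 'I_n, (j <= i)%N -> phi.2 l z i j = 0].

Definition eq_cochains (k : nat) (phi psi : triple) : Prop :=
  [/\ forall l z, size l = k.+1 -> capl W l z -> phi.1.1 l z = psi.1.1 l z,
      forall l z, size l = k -> capl W l z -> phi.1.2 l z = psi.1.2 l z &
      forall l z, size l = k.-1 -> capl W l z -> phi.2 l z = psi.2 l z].

Definition CF (l : seq I) (z : Z) (i j : 'I_n) : int :=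
  if l is [:: a; b; c; d] then
    F [:: a; b; c] z 0 i * F [:: a; c; d] z 0 j
    - F [:: b; c; d] z 0 i * F [:: a; b; d] z 0 j
  else 0.

Definition cup11 (k : nat) (phi : seq I -> Z -> 'rV[int]_n -> circle R)
    (l : seq I) (z : Z) : circle R :=
  phi (take k l) z (F (drop k.-1 l) z).

Definition cup21 (k : nat) (phi : seq I -> Z -> 'M[circle R]_n)
    (l : seq I) (z : Z) (m : 'rV[int]_n) : circle R :=
  let f := F (drop k.-2 l) z in
  \sum_(i < n) \sum_(j < n | (i < j)%N)
    phi (take k.-1 l) z i j *~ (f 0 i * m 0 j - m 0 i * f 0 j).

Definition cup22 (k : nat) (phi : seq I -> Z -> 'M[circle R]_n)
    (l : seq I) (z : Z) : circle R :=
  \sum_(i < n) \sum_(j < n | (i < j)%N)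
    phi (take k.-1 l) z i j *~ CF (drop k.-2 l) z i j.

Definition DF (k : nat) (phi : triple) : triple :=
  (fun l z => cech phi.1.1 l z + cup11 k phi.1.2 l z *~ (-1) ^+ k.+1
              + cup22 k phi.2 l z *~ (-1) ^+ k.+1,
   fun l z m => cech phi.1.2 l z m + cup21 k phi.2 l z m *~ (-1) ^+ k,
   cech phi.2).

Definition is_cocycle (k : nat) (phi : triple) : Prop :=
  in_cochains k phi /\ eq_cochains k.+1 (DF k phi) 0.

(* The class of phi in H^k.+1, as a set of cocycles. *)
Definition coh_class (k : nat) (phi : triple) : set triple :=
  [set phi' | is_cocycle k.+1 phi' /\
     exists2 psi, in_cochains k psi & eq_cochains k.+1 phi' (phi + DF k psi)].

Definition cohomology (k : nat) : set (set triple) :=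
  [set coh_class k phi | phi in is_cocycle k.+1].

End Cech.

Section Operators.
Variables (R : realType) (H : completeNormedModType R[i]).
Variable ip : H -> H -> R[i].

Definition is_hilbert : Prop :=
  [/\ forall a x y z, ip (a *: x + y) z = a * ip x z + ip y z,
      forall x y, ip y x = Num.conj (ip x y) &
      forall x, `|x| ^+ 2 = ip x x].

Definition separable_space : Prop := exists2 D : set H, countable D & dense D.

Definition infinite_dim : Prop :=
  forall (m : nat) (e : 'I_m -> H),
    exists x, forall c : 'I_m -> R[i], x <> \sum_i c i *: e i.

Definition opnorm (T : H -> H) : R :=
  sup [set complex.Re `|T x| | x in [set x | `|x| <= 1]].

Definition compact_op (T : H -> H) : Prop :=
  linear T /\ compact (closure (T @` [set x | `|x| <= 1])).

Definition adj (T : H -> H) : H -> H :=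
  xget (fun=> 0) [set T' | forall x y, ip (T x) y = ip x (T' y)].

Definition unitary (v : H -> H) : Prop :=
  [/\ linear v, forall y, exists x, v x = y &
      forall x y, ip (v x) (v y) = ip x y].

Definition Ad (v T : H -> H) : H -> H := v \o T \o adj v.

Definition opexp (v : H -> H) (k : int) : H -> H :=
  match k with Posz p => iter p v | Negz p => iter p.+1 (adj v) end.

Definition scalar_of (T : H -> H) : circle R :=
  xget 0 [set c | forall x, T x = cval c *: x].

Definition norm_continuous (Y : topologicalType) (U : set Y) (f : Y -> H -> H) :=
  forall y, U y -> forall e : R, 0 < e ->
    \forall y' \near within U (nbhs y), opnorm (f y' - f y) < e.

Definition strong_continuous (Y : topologicalType) (U : set Y)
    (v : Y -> H -> H) : Prop :=
  forall x : H, {within U, continuous (fun y => v y x)}.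

End Operators.

(* The elements of the algebra are those of [mem], inside an ambient complex
   vector space [car]; the operations matter on [mem] only. *)
Record calg (R : realType) := Calg {
  car :> lmodType R[i];
  mem : set car;
  mul : car -> car -> car;
  star : car -> car;
  nrm : car -> R }.

Record is_cstar (R : realType) (A : calg R) : Prop := IsCstar {
  cs_zero : mem (0 : A);
  cs_lin : forall (c : R[i]) (a b : A), mem a -> mem b -> mem (c *: a + b);
  cs_mul : forall a b : A, mem a -> mem b -> mem (mul a b);
  cs_star : forall a : A, mem a -> mem (star a);
  cs_mulA : forall a b c : A, mem a -> mem b -> mem c ->
    mul a (mul b c) = mul (mul a b) c;
  cs_mull : forall (t : R[i]) (a b c : A), mem a -> mem b -> mem c ->
    mul (t *: a + b) c = t *: mul a c + mul b c;
  cs_mulr : forall (t : R[i]) (a b c : A), mem a -> mem b -> mem c ->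
    mul c (t *: a + b) = t *: mul c a + mul c b;
  cs_starK : forall a : A, mem a -> star (star a) = a;
  cs_starD : forall (t : R[i]) (a b : A), mem a -> mem b ->
    star (t *: a + b) = Num.conj t *: star a + star b;
  cs_starM : forall a b : A, mem a -> mem b ->
    star (mul a b) = mul (star b) (star a);
  cs_nrm0 : forall a : A, mem a -> nrm a = 0 -> a = 0;
  cs_nrmD : forall a b : A, mem a -> mem b -> nrm (a + b) <= nrm a + nrm b;
  cs_nrmZ : forall (t : R[i]) (a : A), mem a ->
    nrm (t *: a) = complex.Re `|t| * nrm a;
  cs_nrmM : forall a b : A, mem a -> mem b -> nrm (mul a b) <= nrm a * nrm b;
  cs_cstar : forall a : A, mem a -> nrm (mul (star a) a) = nrm a ^+ 2;
  cs_complete : forall u : nat -> A, (forall k, mem (u k)) ->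
    (forall e : R, 0 < e -> exists N, forall p q, (N <= p)%N -> (N <= q)%N ->
       nrm (u p - u q) < e) ->
    exists2 a : A, mem a &
      forall e : R, 0 < e -> exists N, forall p, (N <= p)%N -> nrm (u p - a) < e }.

Record star_iso (R : realType) (A B : calg R) (psi : A -> B) : Prop := StarIso {
  si_bij : set_bij (@mem R A) (@mem R B) psi;
  si_lin : forall (t : R[i]) (a b : A), mem a -> mem b ->
    psi (t *: a + b) = t *: psi a + psi b;
  si_mul : forall a b : A, mem a -> mem b -> psi (mul a b) = mul (psi a) (psi b);
  si_star : forall a : A, mem a -> psi (star a) = star (psi a) }.

(* [cmul f a] is f . a for bounded continuous f, i.e. the C_0(X)-module
   structure together with its canonical extension to C_b(X). *)
Record xalg (R : realType) (X : Type) := Xalg {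
  xcalg :> calg R;
  cmul : (X -> R[i]) -> xcalg -> xcalg }.

Definition linear_over (R : realType) (X : Type) (A B : xalg R X)
    (P : set (X -> R[i])) (psi : A -> B) : Prop :=
  forall f (a : A), P f -> mem a -> psi (cmul f a) = cmul f (psi a).

(* A|_U = C_0(U) . A *)
Definition restr (R : realType) (X : topologicalType) (A : xalg R X)
    (U : set X) : xalg R X :=
  @Xalg R X
    (@Calg R A [set cmul f a | f in C0 U & a in @mem R A]
       (@mul R A) (@star R A) (@nrm R A))
    (@cmul R X A).

Record xsys (R : realType) (X : Type) (n : nat) := Xsys {
  xsalg :> xalg R X;
  act : 'rV[R]_n -> xsalg -> xsalg }.

Section Algebras.
Variables (R : realType) (H : completeNormedModType R[i]).
Variable ip : H -> H -> R[i].

Definition Kalg : calg R :=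
  @Calg R (H -> H) (@compact_op R H) (fun S T => S \o T) (adj ip) (@opnorm R H).

Section OverX.
Variable X : topologicalType.

Definition C0K (U : set X) : xalg R X :=
  @Xalg R X
    (@Calg R (X -> H -> H)
      [set f | [/\ forall x, U x -> compact_op (f x),
                   forall x, ~ U x -> f x = 0,
                   norm_continuous U f &
                   forall e : R, 0 < e ->
                     compact (U `&` [set x | e <= opnorm (f x)])]]
      (fun f g x => f x \o g x) (fun f x => adj ip (f x))
      (fun f => sup [set opnorm (f x) | x in U]))
    (fun h f x => h x *: f x).

(* A locally trivial bundle with fibre K and structure group Aut K (with the
   point-norm topology), given by its coordinate transformations. *)
Definition is_K_bundle (J : Type) (V : J -> set X)
    (g : J -> J -> X -> (H -> H) -> H -> H) : Prop :=
  [/\ (forall i, open (V i)) /\ \bigcup_i V i = setT,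
      forall i j x, (V i `&` V j) x -> @star_iso R Kalg Kalg (g i j x),
      forall i j T, compact_op T ->
        norm_continuous (V i `&` V j) (fun x => g i j x T),
      forall i x T, V i x -> compact_op T -> g i i x T = T &
      forall i j k x T, (V i `&` V j `&` V k) x -> compact_op T ->
        g i j x (g j k x T) = g i k x T].

Definition section_alg (J : Type) (V : J -> set X)
    (g : J -> J -> X -> (H -> H) -> H -> H) : xalg R X :=
  @Xalg R X
    (@Calg R (J -> X -> H -> H)
      [set f | [/\ forall i x, V i x -> compact_op (f i x),
                   forall i x, ~ V i x -> f i x = 0,
                   forall i, norm_continuous (V i) (f i),
                   forall i j x, (V i `&` V j) x -> f i x = g i j x (f j x) &
                   forall e : R, 0 < e ->
                     compact [set x | exists2 i, V i x & e <= opnorm (f i x)]]]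
      (fun f g i x => f i x \o g i x) (fun f i x => adj ip (f i x))
      (fun f => sup [set r | exists i, exists2 x, V i x & r = opnorm (f i x)]))
    (fun h f i x => h x *: f i x).

Definition is_ct_algebra (A : xalg R X) : Prop :=
  [/\ is_cstar A, forall f (a : A), Cb f -> mem a -> mem (cmul f a) &
  exists (J : Type) (V : J -> set X) (g : J -> J -> X -> (H -> H) -> H -> H)
         (psi : A -> section_alg V g),
    [/\ is_K_bundle V g, star_iso psi & linear_over (@Cb R X) psi]].

Variable n : nat.
Variable tact : 'rV[R]_n -> X -> X.

Definition orbit_continuous (A : calg R) (f : 'rV[R]_n -> A) : Prop :=
  forall t (e : R), 0 < e -> \forall t' \near t, nrm (f t' - f t) < e.

(* Membership in the collection of pairs (A, alpha). *)
Definition in_Br (A : xsys R X n) : Prop :=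
  [/\ is_ct_algebra A,
      forall t, star_iso (@act _ _ _ A t),
      forall a : A, mem a -> act 0 a = a /\
        forall t t', act (t + t') a = act t (act t' a),
      forall a : A, mem a -> orbit_continuous (fun t => act t a) &
      forall t f (a : A), Cb f -> mem a ->
        act t (cmul f a) = cmul (fun x => f (tact (- t) x)) (act t a)].

(* Multipliers are double centralisers w = (L, R), with w a = L a, a w = R a. *)
Definition is_multiplier (A : calg R) (w : (A -> A) * (A -> A)) : Prop :=
  (forall a : A, mem a -> mem (w.1 a) /\ mem (w.2 a)) /\
  forall a b : A, mem a -> mem b -> mul a (w.1 b) = mul (w.2 a) b.

Definition mstar (A : calg R) (w : (A -> A) * (A -> A)) : (A -> A) * (A -> A) :=
  (fun a => star (w.2 (star a)), fun a => star (w.1 (star a))).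

Definition unitary_multiplier (A : calg R) (w : (A -> A) * (A -> A)) : Prop :=
  is_multiplier w /\
  forall a : A, mem a ->
    [/\ (mstar w).1 (w.1 a) = a, w.1 ((mstar w).1 a) = a,
        (mstar w).2 (w.2 a) = a & w.2 ((mstar w).2 a) = a].

Definition outer_conjugate (A B : xsys R X n) : Prop :=
  exists (psi : A -> B) (w : 'rV[R]_n -> (A -> A) * (A -> A)),
    [/\ star_iso psi /\ linear_over (C0 setT) psi,
        forall t, unitary_multiplier (w t),
        forall a : A, mem a ->
          orbit_continuous (fun t => (w t).1 a) /\
          orbit_continuous (fun t => (w t).2 a),
        forall t (a : A), mem a ->
          act t (psi a) = psi ((mstar (w t)).2 ((w t).1 (act t a))) &
        forall t t' (a : A), mem a ->
          (w (t + t')).1 a = (w t).1 (act t ((w t').1 (act (- t) a))) /\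
          (w (t + t')).2 a = act t ((w t').2 (act (- t) ((w t).2 a)))].

(* The value at y in U of an arbitrary a : A under Phi : A|_U -> C_0(U, K):
   Phi (f . a) y for f in C_0(U) with f y = 1; it does not depend on f. *)
Definition induced_value (A : xalg R X) (U : set X) (Phi : A -> X -> H -> H)
    (a : A) (y : X) : H -> H :=
  Phi (cmul (xget (fun=> 0) [set f | C0 U f /\ f y = 1]) a) y.

End OverX.

Variables (n : nat) (I : Type) (S : setup R n I).

Record choices (A : xsys R (spX S) n) := Choices {
  Phi : I -> A -> spX S -> H -> H;
  vgen : I -> 'I_n -> spX S -> H -> H;
  vtrans : I -> I -> spZ S -> H -> H }.

(* B is beta^(alpha,Phi)_(i(t,x)j): it carries the value at t^-1 x in the
   trivialisation i to the value at x in the trivialisation j. *)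
Definition is_beta (A : xsys R (spX S) n) (Phi : I -> A -> spX S -> H -> H)
    (i : I) (t : 'rV[R]_n) (x : spX S) (j : I) (B : (H -> H) -> H -> H) : Prop :=
  forall a : A, mem a ->
    induced_value (cov j) (Phi j) (act t a) x =
    B (induced_value (cov i) (Phi i) a (tact (- t) x)).

Definition are_choices (A : xsys R (spX S) n) (D : choices A) : Prop :=
  [/\ forall i,
        @star_iso R (restr A (cov i)) (C0K (cov i)) (Phi D i) /\
        @linear_over R _ (restr A (cov i)) (C0K (cov i))
          (C0 (cov i)) (Phi D i),
      forall i k,
        (forall y, cov i y -> unitary ip (vgen D i k y)) /\
        strong_continuous (cov i) (vgen D i k),
      forall i k a y, @mem R (restr A (cov i)) a -> cov i y ->
        Phi D i (act (delta_mx 0 k) a) y = Ad ip (vgen D i k y) (Phi D i a y),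
      forall i j,
        (forall z, (pcov S i `&` pcov S j) z -> unitary ip (vtrans D i j z)) /\
        strong_continuous (pcov S i `&` pcov S j) (vtrans D i j) &
      forall i j z, (pcov S i `&` pcov S j) z ->
        is_beta (Phi D) i (- scoch i j z) (sec j z) j (Ad ip (vtrans D i j z))].

Definition vpow (A : xsys R (spX S) n) (D : choices A) (i : I)
    (m : 'rV[int]_n) (z : spZ S) : H -> H :=
  \big[(fun f g => f \o g)/id]_(k < n) opexp ip (vgen D i k (sec i z)) (m 0 k).

Definition cocycle_of (A : xsys R (spX S) n) (D : choices A) :
    triple R I n (spZ S) :=
  (fun l z => if l is [:: a; b; c] then
     scalar_of (vtrans D b c z \o vtrans D a b z
       \o adj ip (vpow D a (- cechs l z) z) \o adj ip (vtrans D a c z))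
   else 0,
   fun l z m => if l is [:: a; b] then
     scalar_of (vpow D b m z \o vtrans D a b z
       \o adj ip (vpow D a m z) \o adj ip (vtrans D a b z))
   else 0,
   fun l z => \matrix_(i, j) if l is [:: a] then
     if (i < j)%N then
       let vi := vpow D a (delta_mx 0 i) z in
       let vj := vpow D a (delta_mx 0 j) z in
       scalar_of (vj \o vi \o adj ip vj \o adj ip vi)
     else 0
   else 0).

Definition H2class (phi : triple R I n (spZ S)) : set (triple R I n (spZ S)) :=
  coh_class (@pcov R n I S) (@cechs R I n S) 1 phi.

(* Xi [A, alpha] = c: c is a cohomology class, some admissible choices for
   (A, alpha) exist, and all of them yield c. *)
Definition Xi_is (A : xsys R (spX S) n) (c : set (triple R I n (spZ S))) : Prop :=
  cohomology (@pcov R n I S) (@cechs R I n S) 1 c /\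
  [set H2class (cocycle_of D) | D in @are_choices A] = [set c].

(* On a single pi(U_i), elements are bounded continuous functions
   R^n -> C_b(pi(U_i), K) (sup norm); vanishing at infinity is imposed on X
   for the function t . sigma_i(z) |-> `|xi_i(t)(z)|.  Asking each xi_i(t) to
   vanish at infinity on pi(U_i) itself would force the family to vanish over
   the boundary of pi(U_i) in Z, so that the spectrum would not be X.  Values
   at z outside pi(U_i) are 0. *)
Definition in_Aphi (A : xsys R (spX S) n) (D : choices A)
    (xi : I -> 'rV[R]_n -> spZ S -> H -> H) : Prop :=
  [/\ forall i t,
        [/\ forall z, pcov S i z -> compact_op (xi i t z),
            forall z, ~ pcov S i z -> xi i t z = 0,
            norm_continuous (pcov S i) (xi i t) &
            exists M : R, forall z, pcov S i z -> opnorm (xi i t z) <= M],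
      forall i t (e : R), 0 < e -> \forall t' \near t,
        forall z, pcov S i z -> opnorm (xi i t' z - xi i t z) < e,
      forall i t m z, pcov S i z ->
        xi i (t + lattice R m) z = Ad ip (vpow D i (- m) z) (xi i t z),
      forall i j t z, (pcov S i `&` pcov S j) z ->
        Ad ip (vtrans D i j z) (xi i t z) = xi j (t + scoch i j z) z &
      forall e : R, 0 < e ->
        compact [set x | exists i t z,
          [/\ pcov S i z, x = tact t (sec i z) & e <= opnorm (xi i t z)]]].

Definition Aphi (A : xsys R (spX S) n) (D : choices A) : xsys R (spX S) n :=
  @Xsys R (spX S) n
    (@Xalg R (spX S)
      (@Calg R (I -> 'rV[R]_n -> spZ S -> H -> H) (in_Aphi D)
        (fun xi eta i t z => xi i t z \o eta i t z)
        (fun xi i t z => adj ip (xi i t z))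
        (fun xi => sup [set r | exists i t, exists2 z, pcov S i z &
                                r = opnorm (xi i t z)]))
      (fun f xi i t z => f (tact t (sec i z)) *: xi i t z))
    (fun r xi i t z => xi i (t - r) z).

End Algebras.

(* Main.v *)
(* The isomorphism A -> A_phi sends a to the family
   xi_i(t)(z) = Phi_i(alpha_(-t) a)(sigma_i(z)); what v^m and v_(ij) implement
   says exactly that the family satisfies the two gluing conditions.  It is
   isometric because two representations onto the compacts with the same
   kernel differ by an automorphism of K, which is isometric.  It intertwines
   the actions, so that the unitary cocycle w of the outer conjugacy is trivial,
   and it carries (Phi, v) to choices for A_phi with the same unitaries, hence
   with the same cocycle phi.

   It remains that Xi is well defined.  A unitary is determined up to a scalar
   by the automorphism of K it implements, so that two factorisations of one
   automorphism through the v's differ by a scalar; this gives phi and, on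
   triple and quadruple overlaps, D phi = 0.  Two sets of choices for the same
   algebra differ over pi(U_i) by automorphisms of K depending continuously on
   z, which lift to unitaries u_i(z) because pi(U_i) is contractible.  The
   scalars by which the u_i fail to intertwine the v's form a 1-cochain psi
   with phi' = phi + D psi. *)
Require Import Defs.
From mathcomp Require Import all_boot all_order all_algebra.
From mathcomp Require Import all_classical all_reals all_analysis.
From mathcomp Require Import complex ring lra.
Import Defs.
Set Implicit Arguments.
Unset Strict Implicit.
Unset Printing Implicit Defensive.
Import Order.TTheory GRing.Theory Num.Theory numFieldNormedType.Exports.
Local Open Scope classical_set_scope.
Local Open Scope ring_scope.
Local Open Scope complex_scope.

(** An element of the algebra has no values of its own: [induced_value] reads it through one
    trivialisation after a cut-off, while [is_ct_algebra] supplies an unrelated family of values.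
    What ties them together is that each evaluation at x has the kernel [van], which refers to the
    module structure only; the delicate inclusion comes from dividing a section by the square root
    of its norm. Equal kernels then give automorphisms of K, so norms can be compared without naming
    these automorphisms. Isometry is not part of [star_iso], and the norm of [Aphi] is a supremum
    defined independently of A. Contractivity of representations is therefore derived from the
    C*-identity by a Neumann series, and the axioms of [Aphi] that involve the norm are checked
    directly. Lifting automorphisms of K to unitaries over a contractible set reduces to finding a
    continuous unit vector in the range of a moving rank one projection: such a vector determines
    the implementing unitary by an explicit formula. *)

Section RealNorm.
Variable R : realType.

Lemma ge0_complexE (z : R[i]) : 0 <= z -> z = (complex.Re z)%:C.
Proof. by case: z => a b; rewrite lecE /= => /andP[/eqP -> _]. Qed.

Variable V : normedModType R[i].
Implicit Types x y z : V.

(** The norm of a module over R[i] takes values in R[i]. Its real part loses nothing ([nrE]) and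
    lies in R, where [lra] and [nra] apply. *)
Definition nr (x : V) : R := complex.Re `|x|.

Lemma nrE x : `|x| = (nr x)%:C. Proof. exact/ge0_complexE/normr_ge0. Qed.

Lemma nr_ge0 x : 0 <= nr x.
Proof. by rewrite -lecR -nrE normr_ge0. Qed.

Lemma nr0 : nr 0 = 0. Proof. by rewrite /nr normr0. Qed.

Lemma nr0_eq0 x : nr x = 0 -> x = 0.
Proof. by move=> h; apply/normr0_eq0; rewrite nrE h. Qed.

Lemma nrD x y : nr (x + y) <= nr x + nr y.
Proof. by rewrite -lecR rmorphD /= -!nrE ler_normD. Qed.

Lemma nrN x : nr (- x) = nr x. Proof. by rewrite /nr normrN. Qed.

Lemma nrB x y : nr (x - y) = nr (y - x). Proof. by rewrite /nr distrC. Qed.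

Lemma nr_dist x y : `|nr x - nr y| <= nr (x - y).
Proof.
rewrite ler_norml lerBrDr lerBlDr; apply/andP; split.
  rewrite addrC lerBlDr.
  by rewrite -[X in nr X <= _](subrK x) (le_trans (nrD _ _)) // nrB addrC.
by rewrite -[X in nr X <= _](subrK y) nrD.
Qed.

Lemma nr_tri x y z : nr (x - z) <= nr (x - y) + nr (y - z).
Proof. by rewrite (le_trans _ (nrD _ _)) // addrA subrK. Qed.

Lemma nrZ (a : R[i]) x : nr (a *: x) = complex.Re `|a| * nr x.
Proof.
apply: (@complexI R); rewrite rmorphM /= -!nrE normrZ.
by rewrite -(ge0_complexE (normr_ge0 a)).
Qed.

Lemma nrZr (a : R) x : nr (a%:C *: x) = `|a| * nr x.
Proof. by rewrite nrZ normc_def /= expr0n addr0 sqrtr_sqr. Qed.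

Lemma nbhs_nrP x (P : set V) :
  nbhs x P <-> exists2 e : R, 0 < e & forall y, nr (x - y) < e -> P y.
Proof.
split.
  move=> /nbhs_ballP[e /= e0 h]; exists (complex.Re e).
    by rewrite -ltcR -ge0_complexE // ltW.
  move=> y xy; apply: h; rewrite -ball_normE /ball_ /= nrE.
  by rewrite (ge0_complexE (ltW e0)) ltcR.
move=> [e e0 h]; apply/nbhs_ballP; exists e%:C => /=; first by rewrite ltcR.
by move=> y; rewrite -ball_normE /ball_ /= nrE ltcR; exact: h.
Qed.

Lemma cvg_nrP T (F : set_system T) (FF : Filter F) (f : T -> V) y :
  f @ F --> y <-> forall e : R, 0 < e -> \forall t \near F, nr (f t - y) < e.
Proof.
split => [fy e e0|h P /nbhs_nrP[e e0 eP]].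
  by apply: (fy [set z | nr (z - y) < e]); apply/nbhs_nrP; exists e => // z /=; rewrite nrB.
by apply: filterS (h _ e0) => t; rewrite nrB => /eP.
Qed.

Lemma nr_le1 x : (`|x| <= 1) = (nr x <= 1).
Proof. by rewrite nrE -[X in _ <= X](rmorph1 (real_complex R)) lecR. Qed.

Lemma nrZ_pos (a : R) x : 0 <= a -> nr (a%:C *: x) = a * nr x.
Proof. by move=> a0; rewrite nrZr ger0_norm. Qed.

Lemma nr_gt0 x : x != 0 -> 0 < nr x.
Proof.
by move=> x0; rewrite lt_neqAle nr_ge0 andbT eq_sym; apply/eqP => /nr0_eq0; exact/eqP.
Qed.

End RealNorm.

(** * Completeness and total boundedness *)

Section Complete.
Variable (R : realType) (H : completeNormedModType R[i]).

Lemma nr_complete (u : nat -> H) :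
  (forall e : R, 0 < e -> exists N, forall p q, (N <= p)%N -> (N <= q)%N ->
     nr (u p - u q) < e) ->
  exists x, forall e : R, 0 < e -> exists N, forall p, (N <= p)%N -> nr (u p - x) < e.
Proof.
move=> h.
have cu : cauchy (u @ \oo).
  apply/cauchy_ballP => e e0 /=.
  have [|N hN] := h (complex.Re e); first by rewrite -ltcR -ge0_complexE // ltW.
  exists (u @` [set p | (N <= p)%N], u @` [set p | (N <= p)%N]) => /=.
    by split; exists N => // p Np; exists p.
  move=> [x y] [/= [p Np <-] [q Nq <-]].
  by rewrite -ball_normE /ball_ /= nrE (ge0_complexE (ltW e0)) ltcR hN.
have ux : u @ \oo --> lim (u @ \oo) by exact: (@cauchy_cvg _ _ _ cu).
exists (lim (u @ \oo)) => e e0; have /cvg_nrP/(_ e e0)[N _ hN] := ux.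
by exists N => p Np; exact: hN.
Qed.

(** The centres may lie outside S, so total boundedness passes to subsets at once ([tb_sub]). *)
Definition tb (S : set H) := forall e : R, 0 < e ->
  exists s : seq H, forall x, S x -> exists2 y, y \in s & nr (x - y) < e.

Lemma compact_tb (S : set H) : compact S -> tb S.
Proof.
move=> cS e e0.
rewrite compact_cover in cS.
have [||D _ hD] := cS H S (fun y => interior [set x | nr (x - y) < e]).
- by move=> y _; exact: open_interior.
- move=> x Sx; exists x => //.
  by apply/nbhs_nrP; exists e => // z; rewrite nrB.
exists (finmap.enum_fset D) => x /hD [y yD] /interior_subset /= xy.
by exists y.
Qed.

Lemma tb_closure (S : set H) : tb S -> tb (closure S).
Proof.
move=> tS e e0; have [s hs] := tS (e / 2) (divr_gt0 e0 (ltr0n _ 2)).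
exists s => x cx.
have /(_ [set z | nr (x - z) < e / 2])[] := cx.
  by apply/nbhs_nrP; exists (e / 2) => //; rewrite divr_gt0.
move=> z [/hs[y ys zy] /= xz]; exists y => //.
by rewrite (le_lt_trans (nr_tri _ z _)) // [ltRHS]splitr ltrD.
Qed.

Lemma ultra_seq (T : choiceType) (U : set_system H) (s : seq T) (f : T -> set H) :
  UltraFilter U -> U (\bigcup_(y in [set` s]) f y) -> exists2 y, y \in s & U (f y).
Proof.
move=> UU; elim: s => [|a s ih] h.
  exfalso; apply: (@filter_not_empty _ U).
  by apply: filterS h => x [y /=]; rewrite in_nil.
have [ha|ha] := in_ultra_setVsetC (f a) UU; first by exists a => //; rewrite mem_head.
have [|y ys hy] := ih.
  apply: filterS (filterI h ha) => x [[y /=]].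
  by rewrite in_cons => /orP[/eqP ->//|ys fy _]; exists y.
by exists y => //; rewrite in_cons ys orbT.
Qed.

(** An ultrafilter on a totally bounded set contains a ball of every radius, so it is Cauchy and
    converges by completeness of [H]. *)
Lemma tb_compact (S : set H) : closed S -> tb S -> compact S.
Proof.
move=> clS tS; rewrite compact_ultra => U UU US.
have cU : cauchy U.
  apply/cauchy_ballP => e e0.
  set d := complex.Re e / 2.
  have e0' : 0 < complex.Re e by rewrite -ltcR -ge0_complexE // ltW.
  have [s hs] := tS d (divr_gt0 e0' (ltr0n _ 2)).
  have [|y ys Uy] := @ultra_seq H U s (fun y => [set x | nr (x - y) < d]) UU.
    by apply: filterS US => x /hs[y ys xy]; exists y.
  exists ([set x | nr (x - y) < d], [set x | nr (x - y) < d]) => //=.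
  move=> [x z] [/= xy zy]; rewrite -ball_normE /ball_ /= nrE (ge0_complexE (ltW e0)) ltcR.
  by rewrite (le_lt_trans (nr_tri _ y _)) // [ltRHS]splitr ltrD // nrB.
have PU : ProperFilter U by exact: ultra_proper.
have Ux : U --> lim U := @cauchy_cvg _ _ PU cU; exists (lim U); split => //.
by apply: clS => B /Ux UB; exact: (@filter_ex _ U PU _ (filterI US UB)).
Qed.

Lemma compact_closureP (S : set H) : compact (closure S) <-> tb S.
Proof.
split=> [/compact_tb h|h]; last first.
  by apply: tb_compact; [exact: closed_closure|exact: tb_closure].
by move=> e /h[s hs]; exists s => x /subset_closure; exact: hs.
Qed.

Lemma tb_sub (S S' : set H) : S `<=` S' -> tb S' -> tb S.
Proof. by move=> h t e /t[s hs]; exists s => x /h; exact: hs. Qed.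

Lemma tb_approx (T : Type) (B : set T) (f : T -> H) :
  (forall e : R, 0 < e -> exists2 g : T -> H, tb (g @` B) &
     forall t, B t -> nr (f t - g t) < e) -> tb (f @` B).
Proof.
move=> h e e0; have e20 : 0 < e / 2 by rewrite divr_gt0.
have [g tg fg] := h _ e20; have [s hs] := tg _ e20.
exists s => _ [t Bt <-]; have [|y ys gy] := hs (g t); first by exists t.
exists y => //; rewrite (le_lt_trans (nr_tri _ (g t) _)) // [ltRHS]splitr ltrD //.
exact: fg.
Qed.

(** No map from values of f to values of g is assumed: a finite net for f yields one for g through
    the parameters. This serves [compact_adj], where T composed with its adjoint controls the
    adjoint. *)
Lemma tb_control (T : Type) (B : set T) (f g : T -> H) :
  (forall e : R, 0 < e -> exists2 d : R, 0 < d &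
     forall t t', B t -> B t' -> nr (f t - f t') < d -> nr (g t - g t') < e) ->
  tb (f @` B) -> tb (g @` B).
Proof.
move=> h tf e e0; have [d d0 hd] := h _ e0.
have [s hs] := tf (d / 2) (divr_gt0 d0 (ltr0n _ 2)).
(* A net point y for f is replaced by g at some parameter whose f-value is within d / 2 of y. The
   default [point] occurs only for a y that is close to no value of f. *)
pose c y := xget point [set x | exists t, [/\ B t, nr (f t - y) < d / 2 & x = g t]].
exists (map c s) => _ [t Bt <-].
have [|y ys fy] := hs (f t); first by exists t.
exists (c y); first exact: map_f.
rewrite /c; case: xgetP => [x _ [t' [Bt' fy' ->]]|/(_ (g t))[]]; last by exists t.
apply: hd => //; rewrite (le_lt_trans (nr_tri _ y _)) // [ltRHS]splitr ltrD // nrB.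
exact: fy'.
Qed.

Lemma tbD (T : Type) (B : set T) (f g : T -> H) :
  tb (f @` B) -> tb (g @` B) -> tb ((fun t => f t + g t) @` B).
Proof.
move=> tf tg e e0; have e20 : 0 < e / 2 by rewrite divr_gt0.
have [s hs] := tf _ e20; have [s' hs'] := tg _ e20.
exists [seq x + y | x <- s, y <- s'] => _ [t Bt <-].
have [|x xs fx] := hs (f t); first by exists t.
have [|y ys gy] := hs' (g t); first by exists t.
exists (x + y); first by apply/allpairsP; exists (x, y).
by rewrite opprD addrACA (le_lt_trans (nrD _ _)) // [ltRHS]splitr ltrD.
Qed.

Lemma tb_lip (S : set H) (g : H -> H) (M : R) :
  (forall x y, nr (g x - g y) <= M * nr (x - y)) -> tb S -> tb (g @` S).
Proof.
move=> hM tS e e0; have M1 : 0 < `|M| + 1 by rewrite ltr_wpDl.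
have [s hs] := tS (e / (`|M| + 1)) (divr_gt0 e0 M1).
exists (map g s) => _ [x Sx <-]; have [y ys xy] := hs _ Sx.
exists (g y); first exact: map_f.
rewrite (le_lt_trans (hM _ _)) //.
rewrite (@le_lt_trans _ _ ((`|M| + 1) * nr (x - y))) //.
  by rewrite ler_wpM2r ?nr_ge0 // (le_trans (ler_norm _)) // lerDl.
by rewrite mulrC -ltr_pdivlMr.
Qed.

End Complete.

(** * Hilbert spaces and compact operators *)

Section ComplexNorm.
Variable R : realType.
Implicit Types z w : R[i].
Definition cn (z : R[i]) : R := complex.Re `|z|.

Lemma cnE (z : R[i]) : `|z| = (cn z)%:C. Proof. exact/ge0_complexE/normr_ge0. Qed.
Lemma cn_ge0 z : 0 <= cn z. Proof. by rewrite -lecR -cnE normr_ge0. Qed.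
Lemma cnM z w : cn (z * w) = cn z * cn w.
Proof. by apply: (@complexI R); rewrite rmorphM /= -!cnE normrM. Qed.
Lemma cn_real (a : R) : 0 <= a -> cn a%:C = a.
Proof.
move=> a0; have a1 : 0 <= a%:C :> R[i] by rewrite (_ : 0 = 0%:C) // lecR.
by rewrite /cn ger0_norm.
Qed.
Lemma Re_le_cn z : complex.Re z <= cn z.
Proof. by apply: (le_trans (ler_norm _)); rewrite -lecR -cnE normc_ge_Re. Qed.
Lemma cn0_eq0 z : cn z = 0 -> z = 0.
Proof. by move=> h; apply/normr0_eq0; rewrite cnE h. Qed.

Lemma addC_conj z : z + Num.conj z = (2 * complex.Re z)%:C.
Proof.
by case: z => a b; apply/eqP; rewrite eq_complex /=; apply/andP; split; apply/eqP; ring.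
Qed.
Lemma Re_mulI z : complex.Re ('i%C * z) = - complex.Im z.
Proof. by case: z => a b /=; ring. Qed.

End ComplexNorm.

Section InnerProduct.
Variables (R : realType).
Variables (H : completeNormedModType R[i]).
Variable ip : H -> H -> R[i].
Hypothesis hH : is_hilbert ip.
Implicit Types x y z : H.

Lemma ipPl a x y z : ip (a *: x + y) z = a * ip x z + ip y z.
Proof. by case: hH. Qed.
Lemma ipC x y : ip y x = Num.conj (ip x y). Proof. by case: hH. Qed.
Lemma ipDl x y z : ip (x + y) z = ip x z + ip y z.
Proof. by rewrite -[x]scale1r ipPl mul1r scale1r. Qed.
Lemma ip0l z : ip 0 z = 0.
Proof. by apply: (addrI (ip 0 z)); rewrite -ipDl !addr0. Qed.
Lemma ipZl a x z : ip (a *: x) z = a * ip x z.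
Proof. by rewrite -[a *: x]addr0 ipPl ip0l addr0. Qed.
Lemma ipNl x z : ip (- x) z = - ip x z.
Proof. by rewrite -scaleN1r ipZl mulN1r. Qed.
Lemma ipBl x y z : ip (x - y) z = ip x z - ip y z.
Proof. by rewrite ipDl ipNl. Qed.
Lemma ipDr x y z : ip z (x + y) = ip z x + ip z y.
Proof. by rewrite ipC ipDl rmorphD /= -!ipC. Qed.
Lemma ipZr a x z : ip z (a *: x) = Num.conj a * ip z x.
Proof. by rewrite ipC ipZl rmorphM /= -ipC. Qed.
Lemma ip0r z : ip z 0 = 0. Proof. by rewrite ipC ip0l rmorph0. Qed.
Lemma ipNr x z : ip z (- x) = - ip z x.
Proof. by rewrite ipC ipNl rmorphN /= -ipC. Qed.
Lemma ipBr x y z : ip z (x - y) = ip z x - ip z y.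
Proof. by rewrite ipDr ipNr. Qed.
Lemma ipxx x : ip x x = (nr x ^+ 2)%:C.
Proof. by case: hH => _ _ <-; rewrite nrE rmorphXn. Qed.
Lemma ipxx_eq0 x : ip x x = 0 -> x = 0.
Proof.
move=> h; apply: nr0_eq0; apply/eqP.
rewrite -sqrf_eq0; apply/eqP; apply: (@complexI R).
by rewrite -ipxx h.
Qed.
Lemma ip_injr x y : (forall z, ip z x = ip z y) -> x = y.
Proof. by move=> h; apply/subr0_eq/ipxx_eq0; rewrite ipBr h subrr. Qed.

Lemma nr_sqrD x y :
  nr (x + y) ^+ 2 = nr x ^+ 2 + nr y ^+ 2 + 2 * complex.Re (ip x y).
Proof.
apply: (@complexI R); rewrite !rmorphD /= -!ipxx ipDl !ipDr (ipC x y).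
rewrite -addC_conj; ring.
Qed.

Lemma nr_sqrB x y :
  nr (x - y) ^+ 2 = nr x ^+ 2 + nr y ^+ 2 - 2 * complex.Re (ip x y).
Proof. by rewrite nr_sqrD nrN ipNr raddfN mulrN. Qed.

Lemma cauchy_schwarz x y : cn (ip x y) <= nr x * nr y.
Proof.
have [->|y0] := eqVneq y 0; first by rewrite ip0r /cn normr0 nr0 mulr0.
have yy : nr y != 0 by rewrite gt_eqF // nr_gt0.
pose c : R[i] := ip x y / ip y y.
have : (nr (x - c *: y) ^+ 2)%:C = (nr x ^+ 2 - cn (ip x y) ^+ 2 / nr y ^+ 2)%:C.
  have yyC : (nr y)%:C != 0 :> R[i].
    by apply: contra yy => /eqP h; apply/eqP/(@complexI R).
  rewrite -ipxx ipBl !ipBr !ipZl !ipZr (ipC x y).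
  have -> : (nr x ^+ 2 - cn (ip x y) ^+ 2 / nr y ^+ 2)%:C =
      (nr x)%:C ^+ 2 - `|ip x y| ^+ 2 / (nr y)%:C ^+ 2 :> R[i].
    by rewrite cnE -!rmorphXn -fmorphV -rmorphM -rmorphB.
  rewrite normCK /c rmorphM fmorphV /= !ipxx !rmorphXn /=.
  have -> : Num.conj (nr y)%:C = (nr y)%:C.
    by apply/eqP; rewrite eq_complex /= oppr0 !eqxx.
  by field.
move=> /(@complexI R) h.
have h0 : 0 <= nr x ^+ 2 - cn (ip x y) ^+ 2 / nr y ^+ 2 by rewrite -h sqr_ge0.
rewrite subr_ge0 ler_pdivrMr ?exprn_gt0 ?nr_gt0 // -exprMn in h0.
by rewrite -ler_sqr // ?nnegrE ?mulr_ge0 ?nr_ge0 ?cn_ge0.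
Qed.

Lemma Re_ip_le x y : complex.Re (ip x y) <= nr x * nr y.
Proof. exact: le_trans (Re_le_cn _) (cauchy_schwarz _ _). Qed.

(** The representing vector minimises J x = |x|^2 - 2 Re phi x. By the parallelogram law ([par]) a
    minimising sequence is Cauchy; stationarity of J at its limit y gives Re phi x = Re <x, y>, and
    i x in place of x gives the imaginary parts. *)
Lemma riesz (phi : H -> R[i]) (M : R) :
  (forall a x y, phi (a *: x + y) = a * phi x + phi y) ->
  (forall x, cn (phi x) <= M * nr x) -> exists y, forall x, phi x = ip x y.
Proof.
move=> lphi bphi.
have pD x y : phi (x + y) = phi x + phi y by rewrite -[x]scale1r lphi mul1r scale1r.
have p0 : phi 0 = 0 by apply: (addrI (phi 0)); rewrite -pD !addr0.
have pZ a x : phi (a *: x) = a * phi x by rewrite -[a *: x]addr0 lphi p0 addr0.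
have pN x : phi (- x) = - phi x by rewrite -scaleN1r pZ mulN1r.
pose J x := nr x ^+ 2 - 2 * complex.Re (phi x).
have JM x : - M ^+ 2 <= J x.
  have := Re_le_cn (phi x); have := bphi x; rewrite /J => h1 h2.
  have := sqr_ge0 (nr x - M); rewrite expr2; nra.
pose I := inf (range J).
have hI : has_inf (range J).
  by split; [exists (J 0); exists 0|exists (- M ^+ 2) => _ [x _ <-]].
have Ile x : I <= J x by apply: ge_inf; [case: hI|exists x].
have par u v : nr (u - v) ^+ 2 <= 2 * (J u - I) + 2 * (J v - I).
  have := Ile ((2^-1)%:C *: (u + v)); rewrite /J nrZr exprMn.
  rewrite pZ pD nr_sqrB nr_sqrD.
  have -> : complex.Re ((2^-1)%:C * (phi u + phi v)) =
      2^-1 * (complex.Re (phi u) + complex.Re (phi v)).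
    by case: (phi u) (phi v) => a b [c d] /=; ring.
  rewrite ger0_norm ?invr_ge0 // => h.
  have e4 : 2^-1 ^+ 2 = 4^-1 :> R by field.
  rewrite e4 in h; lra.
have /choice[u hu] : forall k : nat, exists x, J x < I + k.+1%:R^-1.
  move=> k; have k0 : 0 < k.+1%:R^-1 :> R by rewrite invr_gt0.
  by have [_ [x _ <-] h] := inf_adherent k0 hI; exists x.
have small (e : R) : 0 < e -> exists N, forall k, (N <= k)%N -> J (u k) - I < e.
  move=> e0; have [N hN] := ltr_add_invr e0.
  exists N => k Nk; rewrite ltrBlDl (lt_le_trans (hu k)) // lerD2l.
  rewrite add0r in hN; rewrite (le_trans _ (ltW hN)) // lef_pV2 ?posrE ?ltr0Sn //.
  by rewrite ler_nat.
have [|y hy] := @nr_complete R H u.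
  move=> e e0; have [|N hN] := small (e ^+ 2 / 4); first by rewrite divr_gt0 // exprn_gt0.
  exists N => p q Np Nq; rewrite -ltr_sqr ?nnegrE ?nr_ge0 ?(ltW e0) //.
  by rewrite (le_lt_trans (par _ _)) //; have := hN p Np; have := hN q Nq; lra.
have Jy : J y <= I.
  apply/ler_addgt0Pl => e e0.
  (* K bounds J y - J (y - w) by K |w| when |w| <= 1: the 3 collects |w| from the square and 2 |w|
     from estimating |y - w| by |y| + |w|. *)
  pose K := 2 * nr y + 3 + 2 * `|M|.
  have K0 : 0 < K by rewrite /K; have := nr_ge0 y; have := normr_ge0 M; lra.
  pose d := Num.min 1 (e / 2 / K).
  have d0 : 0 < d by rewrite /d lt_min ltr01 !divr_gt0.
  have [N1 h1] := hy d d0; have [N2 h2] := small (e / 2) (divr_gt0 e0 (ltr0n _ 2)).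
  pose k := maxn N1 N2.
  have {}h1 := h1 k (leq_maxl _ _); have {}h2 := h2 k (leq_maxr _ _).
  have hd1 : d <= 1 by rewrite /d ge_min lexx.
  have hd2 : d * K <= e / 2.
    by rewrite -ler_pdivlMr // /d ge_min lexx orbT.
  suff : J y - J (u k) <= d * K by lra.
  have -> : y = u k + (y - u k) by rewrite subrKC.
  set w := y - u k; rewrite /J pD nr_sqrD.
  have wd : nr w < d by rewrite /w nrB.
  have r1 := Re_ip_le (u k) w; have r2 := Re_le_cn (- phi w); rewrite -pN in r2.
  have r3 := bphi (- w); rewrite nrN in r3.
  have r4 : nr (u k) <= nr y + nr w by rewrite -(nrN w) /w opprB -[X in nr X <= _](subrKC y) nrD.
  rewrite pN raddfN /= in r2.
  have -> : complex.Re (phi (u k) + phi w) = complex.Re (phi (u k)) + complex.Re (phi w).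
    by rewrite raddfD.
  have r5 : M * nr w <= `|M| * nr w by rewrite ler_wpM2r ?nr_ge0 ?ler_norm.
  rewrite pN in r3.
  have r6 : nr (u k) * nr w <= (nr y + nr w) * nr w by rewrite ler_wpM2r ?nr_ge0.
  have r7 : nr w * nr w <= 1 * nr w by rewrite ler_wpM2r ?nr_ge0 ?(ltW (lt_le_trans wd hd1)).
  have r8 : nr w * K <= d * K by rewrite ler_wpM2r ?(ltW K0) ?ltW.
  rewrite /K in r8 *; lra.
exists y.
have key x : complex.Re (phi x) = complex.Re (ip x y).
  have q (t : R) : 0 <= t ^+ 2 * nr x ^+ 2 + 2 * t * (complex.Re (ip x y) - complex.Re (phi x)).
    have := le_trans Jy (Ile (y + t%:C *: x)); rewrite /J nr_sqrD pD pZ ipZr nrZr.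
    have -> : complex.Re (Num.conj t%:C * ip y x) = t * complex.Re (ip x y).
      by rewrite (ipC x y); case: (ip x y) => a b /=; ring.
    have -> : complex.Re (phi y + t%:C * phi x) = complex.Re (phi y) + t * complex.Re (phi x).
      by case: (phi y) (phi x) => a b [c e] /=; ring.
    by rewrite exprMn real_normK ?num_real //; lra.
  set s := complex.Re (ip x y) - complex.Re (phi x) in q *.
  suff : s = 0 by rewrite /s; lra.
  have x1 : 0 < nr x ^+ 2 + 1 by have := sqr_ge0 (nr x); lra.
  (* Near the minimum of the quadratic in t; the added 1 avoids a division by zero at x = 0 and
     still makes the value negative unless s = 0. *)
  have := q (- (s / (nr x ^+ 2 + 1))).
  set w := nr x ^+ 2 + 1 in x1 *.
  have -> : (- (s / w)) ^+ 2 * nr x ^+ 2 + 2 * - (s / w) * s = - (s / w) ^+ 2 * (w + 1).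
    by rewrite (_ : nr x ^+ 2 = w - 1); [field; rewrite gt_eqF|rewrite /w addrK].
  move=> h; have h2 : (s / w) ^+ 2 <= 0 by nra.
  have /eqP : (s / w) ^+ 2 == 0 by rewrite eq_le h2 sqr_ge0.
  by move=> /eqP; rewrite sqrf_eq0 mulf_eq0 invr_eq0 (gt_eqF x1) orbF => /eqP.
move=> x; have h1 := key x; have := key ('i%C *: x).
rewrite pZ ipZl !Re_mulI => /oppr_inj h2.
by case: (phi x) (ip x y) h1 h2 => a b [c d] /= -> ->.
Qed.

End InnerProduct.

Section Operators.
Variables (R : realType) (H : completeNormedModType R[i]).
Implicit Types (x y z : H) (S T : H -> H).

Definition bop T := linear T /\ exists M : R, forall x, nr (T x) <= M * nr x.

Lemma linD T x y : linear T -> T (x + y) = T x + T y.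
Proof. by move=> l; rewrite -[x]scale1r l !scale1r. Qed.
Lemma lin0 T : linear T -> T 0 = 0.
Proof. by move=> l; apply: (addrI (T 0)); rewrite -linD // !addr0. Qed.
Lemma linZ T a x : linear T -> T (a *: x) = a *: T x.
Proof. by move=> l; rewrite -[a *: x]addr0 l lin0 // addr0. Qed.
Lemma linN T x : linear T -> T (- x) = - T x.
Proof. by move=> l; rewrite -scaleN1r linZ // scaleN1r. Qed.
Lemma linB T x y : linear T -> T (x - y) = T x - T y.
Proof. by move=> l; rewrite linD // linN. Qed.

Lemma opnorm_le T (M : R) : (forall x, nr x <= 1 -> nr (T x) <= M) -> opnorm T <= M.
Proof.
move=> h; apply: ge_sup.
  by exists (complex.Re `|T 0|); exists 0 => //=; rewrite normr0 ler01.
by move=> _ [x /= x1 <-]; apply: h; rewrite -nr_le1.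
Qed.

Lemma opnorm_le_bop T (M : R) : 0 <= M -> (forall x, nr (T x) <= M * nr x) -> opnorm T <= M.
Proof.
move=> M0 h; apply: opnorm_le => x x1; rewrite (le_trans (h x)) //.
by rewrite ler_piMr.
Qed.

Lemma opnorm_ub1 T x : bop T -> nr x <= 1 -> nr (T x) <= opnorm T.
Proof.
move=> [lT [M hM]] x1; apply: ub_le_sup; last by exists x => //=; rewrite nr_le1.
exists `|M| => _ [y /= y1 <-]; rewrite nr_le1 in y1; rewrite (le_trans (hM y)) //.
rewrite (@le_trans _ _ (`|M| * nr y)) ?ler_wpM2r ?nr_ge0 ?ler_norm //.
by rewrite ler_piMr.
Qed.

Lemma opnorm_ge0 T : 0 <= opnorm T.
Proof.
have [hs|hs] := pselect (has_sup [set complex.Re `|T x| | x in [set x | `|x| <= 1]]).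
  apply: (@le_trans _ _ (complex.Re `|T 0|)); first exact: nr_ge0.
  apply: ub_le_sup; first by case: hs.
  by exists 0 => //=; rewrite normr0 ler01.
by rewrite /opnorm sup_out.
Qed.

Lemma opnorm_ub T x : bop T -> nr (T x) <= opnorm T * nr x.
Proof.
move=> bT; have [->|x0] := eqVneq x 0.
  by case: bT => lT _; rewrite lin0 // nr0 mulr0.
have nx : 0 < nr x by exact: nr_gt0.
have := @opnorm_ub1 T ((nr x)^-1%:C *: x) bT.
rewrite linZ; last by case: bT.
rewrite !nrZ_pos ?invr_ge0 ?nr_ge0 // mulVf ?gt_eqF // lexx => /(_ isT).
by rewrite ler_pdivrMl // mulrC.
Qed.

Lemma bopE T : linear T -> (exists M : R, forall x, nr x <= 1 -> nr (T x) <= M) -> bop T.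
Proof.
move=> lT [M hM]; split => //; exists M => x; have [->|x0] := eqVneq x 0.
  by rewrite lin0 // nr0 mulr0.
have nx : 0 < nr x by exact: nr_gt0.
have := hM ((nr x)^-1%:C *: x).
rewrite linZ // !nrZ_pos ?invr_ge0 ?nr_ge0 // mulVf ?gt_eqF // lexx => /(_ isT).
by rewrite ler_pdivrMl // mulrC.
Qed.

Lemma bop0 : bop (0 : H -> H).
Proof.
split; first by move=> a x y; rewrite /= scaler0 addr0.
by exists 0 => x; rewrite nr0 mul0r.
Qed.

Lemma bopPl a S T : bop S -> bop T -> bop (a *: S + T).
Proof.
move=> bS bT; split.
  case: bS bT => [lS _] [lT _] b x y.
  have e z : (a *: S + T) z = a *: S z + T z by [].
  by rewrite !e lS lT !scalerDr !scalerA (mulrC b a) addrACA.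
exists (complex.Re `|a| * opnorm S + opnorm T) => x.
rewrite (le_trans (nrD _ _)) // mulrDl lerD ?opnorm_ub //.
by rewrite nrZ -mulrA ler_wpM2l ?cn_ge0 // opnorm_ub.
Qed.

Lemma bopD S T : bop S -> bop T -> bop (S + T).
Proof. by move=> bS bT; rewrite -[S]scale1r; exact: bopPl. Qed.
Lemma bopZ a S : bop S -> bop (a *: S).
Proof. by move=> bS; rewrite -[_ *: _]addr0; apply: bopPl => //; exact: bop0. Qed.
Lemma bopN S : bop S -> bop (- S).
Proof. by move=> bS; rewrite -scaleN1r; exact: bopZ. Qed.
Lemma bopB S T : bop S -> bop T -> bop (S - T).
Proof. by move=> bS bT; apply/bopD/bopN. Qed.

Lemma bop_comp S T : bop S -> bop T -> bop (S \o T).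
Proof.
move=> bS bT; split.
  by case: bS bT => [lS _] [lT _] b x y; rewrite /= lT lS.
exists (opnorm S * opnorm T) => x /=; rewrite (le_trans (opnorm_ub _ _)) //.
by rewrite -mulrA ler_wpM2l ?opnorm_ge0 ?opnorm_ub.
Qed.

Lemma opnormD S T : bop S -> bop T -> opnorm (S + T) <= opnorm S + opnorm T.
Proof.
move=> bS bT; apply: opnorm_le => x x1; rewrite (le_trans (nrD _ _)) //.
by rewrite lerD // opnorm_ub1.
Qed.

Lemma opnorm0 : opnorm (0 : H -> H) = 0.
Proof.
apply/eqP; rewrite eq_le opnorm_ge0 andbT; apply: opnorm_le => x _.
by rewrite nr0.
Qed.

Lemma opnormZ a T : bop T -> opnorm (a *: T) = cn a * opnorm T.
Proof.
move=> bT; apply/eqP; rewrite eq_le; apply/andP; split.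
  apply: opnorm_le => x x1; rewrite nrZ ler_wpM2l ?cn_ge0 //.
  exact: opnorm_ub1.
have [->|a0] := eqVneq a 0.
  by rewrite /cn normr0 mul0r opnorm_ge0.
have ca : 0 < cn a by rewrite lt_neqAle cn_ge0 eq_sym andbT; apply: contra a0 => /eqP/cn0_eq0 ->.
rewrite mulrC -ler_pdivlMr //; apply: opnorm_le => x x1.
rewrite ler_pdivlMr // mulrC -nrZ; apply: (@opnorm_ub1 (a *: T)) => //.
exact: bopZ.
Qed.

Lemma opnormN T : opnorm (- T) = opnorm T.
Proof.
by rewrite /opnorm; congr sup; apply: eq_imagel => x _; rewrite -[(- T) x]/(- T x) normrN.
Qed.

Lemma opnormB S T : opnorm (S - T) = opnorm (T - S).
Proof. by rewrite -opnormN opprB. Qed.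

Lemma opnorm_tri S T U : bop S -> bop T -> bop U ->
  opnorm (S - U) <= opnorm (S - T) + opnorm (T - U).
Proof.
move=> bS bT bU; have -> : S - U = (S - T) + (T - U) by rewrite addrA subrK.
by apply: opnormD; exact: bopB.
Qed.

Lemma opnorm_dist S T : bop S -> bop T -> `|opnorm S - opnorm T| <= opnorm (S - T).
Proof.
move=> bS bT; have bB := bopB bS bT; have bB' := bopB bT bS.
have h1 := opnormD bB bT; have h2 := opnormD bB' bS.
by rewrite !subrK in h1 h2; rewrite opnormB in h2; rewrite ler_norml; apply/andP; split; lra.
Qed.

Lemma opnorm_comp S T : bop S -> bop T -> opnorm (S \o T) <= opnorm S * opnorm T.
Proof.
move=> bS bT; apply: opnorm_le => x x1 /=; rewrite (le_trans (opnorm_ub _ _)) //.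
by rewrite ler_wpM2l ?opnorm_ge0 ?opnorm_ub1.
Qed.

Lemma opnorm0_eq0 T : bop T -> opnorm T = 0 -> T = 0.
Proof.
move=> bT h; apply/funext => x; apply: nr0_eq0; apply/eqP.
by rewrite eq_le nr_ge0 andbT (le_trans (opnorm_ub _ _)) // h mul0r.
Qed.

Definition ball1 : set H := [set x | nr x <= 1].

Lemma compact_opP T : compact_op T <-> linear T /\ tb (T @` ball1).
Proof.
have -> : compact_op T = (linear T /\ compact (closure (T @` ball1))).
  by rewrite /compact_op; congr (_ /\ compact (closure (T @` _))); apply/funext => x;
     rewrite /ball1 /= nr_le1.
by split=> -[lT /compact_closureP h].
Qed.

Lemma compact_bop T : compact_op T -> bop T.
Proof.
move=> /compact_opP[lT tT]; apply: bopE => //.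
have [s hs] := tT 1 ltr01; exists (\sum_(y <- s) nr y + 1) => x x1.
have [|y ys Ty] := hs (T x); first by exists x.
rewrite -[T x](subrK y) addrC (le_trans (nrD _ _)) //; apply: lerD; last exact: ltW.
elim: s ys {hs} => // a s ih; rewrite in_cons big_cons => /orP[/eqP <-|/ih h].
  by rewrite lerDl sumr_ge0 // => i _; exact: nr_ge0.
by rewrite (le_trans h) // lerDr nr_ge0.
Qed.

Lemma compact_compr S T : compact_op S -> bop T -> compact_op (S \o T).
Proof.
move=> cS bT; have bS := compact_bop cS; move: cS => /compact_opP[lS tS].
apply/compact_opP; split; first by case: (bop_comp bS bT).
(* T maps the unit ball into the ball of this radius; the added 1 keeps the factor invertible when T
   = 0. *)
have M0 : 0 < opnorm T + 1 by rewrite ltr_wpDl ?opnorm_ge0.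
apply: (@tb_sub _ _ _ ((fun x => (opnorm T + 1)%:C *: x) @` (S @` ball1))).
  move=> _ [x x1 <-]; exists (S ((opnorm T + 1)^-1%:C *: T x)).
    exists ((opnorm T + 1)^-1%:C *: T x) => //.
    rewrite /ball1 /= nrZ_pos ?invr_ge0 ?(ltW M0) // ler_pdivrMl // mulr1.
    by rewrite (le_trans (opnorm_ub1 bT x1)) // lerDl.
  rewrite /= linZ // scalerA -rmorphM mulfV ?gt_eqF //.
  by rewrite rmorph1 scale1r.
apply: tb_lip tS => x y; rewrite -scalerBr nrZ_pos ?(ltW M0) //.
Qed.

Lemma compact_compl S T : bop S -> compact_op T -> compact_op (S \o T).
Proof.
move=> bS /[dup]/compact_bop bT /compact_opP[lT tT].
apply/compact_opP; split; first by case: (bop_comp bS bT).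
rewrite (_ : (S \o T) @` ball1 = S @` (T @` ball1)); last by rewrite -image_comp.
apply: tb_lip tT => x y; rewrite -linB; last by case: bS.
exact: opnorm_ub.
Qed.

Lemma copPl a S T : compact_op S -> compact_op T -> compact_op (a *: S + T).
Proof.
move=> cS cT; have [lST _] := bopPl a (compact_bop cS) (compact_bop cT).
have [_ tT] := (compact_opP T).1 cT; apply/compact_opP; split => //.
apply: (@tbD R H H ball1 (a *: S) T) => //.
have : compact_op ((fun x => a *: x) \o S).
  apply: compact_compl => //; split; first by move=> b x y; rewrite scalerDr !scalerA mulrC.
  by exists (cn a) => x; rewrite nrZ.
by move=> /compact_opP[].
Qed.

Lemma cop0 : compact_op (0 : H -> H).
Proof.
apply/compact_opP; split; first by case: bop0.
move=> e e0; exists [:: 0] => _ [x _ <-]; exists 0; first by rewrite mem_head.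
by rewrite subrr nr0.
Qed.

Lemma copD S T : compact_op S -> compact_op T -> compact_op (S + T).
Proof. by move=> cS cT; rewrite -[S]scale1r; exact: copPl. Qed.
Lemma copZ a S : compact_op S -> compact_op (a *: S).
Proof. by move=> bS; rewrite -[_ *: _]addr0; apply: copPl => //; exact: cop0. Qed.
Lemma copN S : compact_op S -> compact_op (- S).
Proof. by move=> bS; rewrite -scaleN1r; exact: copZ. Qed.
Lemma copB S T : compact_op S -> compact_op T -> compact_op (S - T).
Proof. by move=> bS bT; apply/copD/copN. Qed.

(** Limits exist pointwise by completeness of [H]. Letting the second index of the Cauchy condition
    grow makes the convergence uniform on the unit ball, and total boundedness survives uniform
    limits ([tb_approx]). *)
Lemma compact_limit (u : nat -> H -> H) : (forall k, compact_op (u k)) ->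
  (forall e : R, 0 < e -> exists N, forall p q, (N <= p)%N -> (N <= q)%N ->
     opnorm (u p - u q) < e) ->
  exists2 T, compact_op T &
    forall e : R, 0 < e -> exists N, forall p, (N <= p)%N -> opnorm (u p - T) < e.
Proof.
move=> cu hu.
have bu k : bop (u k) by exact: compact_bop.
have /choice[T hT] : forall x, exists y, forall e : R, 0 < e ->
    exists N, forall p, (N <= p)%N -> nr (u p x - y) < e.
  move=> x; apply: nr_complete => e e0.
  have x1 : 0 < nr x + 1 by rewrite ltr_wpDl ?nr_ge0.
  have [N hN] := hu (e / (nr x + 1)) (divr_gt0 e0 x1).
  exists N => p q Np Nq; have := opnorm_ub x (bopB (bu p) (bu q)).
  rewrite -[(u p - u q) x]/(u p x - u q x) => h; rewrite (le_lt_trans h) //.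
  rewrite (@le_lt_trans _ _ (opnorm (u p - u q) * (nr x + 1))) //.
    by rewrite ler_wpM2l ?opnorm_ge0 // lerDl.
  by rewrite -ltr_pdivlMr // hN.
have unif (e : R) : 0 < e -> exists N, forall p x, (N <= p)%N -> nr (u p x - T x) <= e * nr x.
  move=> e0; have [N hN] := hu e e0; exists N => p x Np.
  apply/ler_addgt0Pr => d d0; have [N' hN'] := hT x d d0.
  pose q := maxn N N'.
  rewrite (le_trans (nr_tri _ (u q x) _)) // lerD ?(ltW (hN' _ (leq_maxr _ _))) //.
  have := opnorm_ub x (bopB (bu p) (bu q)).
  rewrite -[(u p - u q) x]/(u p x - u q x) => h; rewrite (le_trans h) //.
  by rewrite ler_wpM2r ?nr_ge0 // ltW // hN // leq_maxl.
have lT : linear T.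
  move=> a x y; apply/subr0_eq/nr0_eq0/eqP; rewrite eq_le nr_ge0 andbT.
  apply/ler_addgt0Pr => e e0; rewrite add0r.
  pose K := nr (a *: x + y) + cn a * nr x + nr y + 1.
  have K0 : 0 < K.
    by rewrite ltr_wpDl // !addr_ge0 ?mulr_ge0 ?cn_ge0 ?nr_ge0.
  have [N hN] := unif (e / K) (divr_gt0 e0 K0).
  have h1 := hN N (a *: x + y) (leqnn _); have h2 := hN N x (leqnn _); have h3 := hN N y (leqnn _).
  have -> : T (a *: x + y) - (a *: T x + T y) =
      - (u N (a *: x + y) - T (a *: x + y)) + (a *: (u N x - T x) + (u N y - T y)).
    have [lu _] := bu N; rewrite lu scalerBr opprB.
    by rewrite [a *: u N x - _ + _]addrACA -opprD addrA subrK.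
  rewrite (le_trans (nrD _ _)) // nrN (@le_trans _ _ (e / K * K)) //; last by rewrite divfK // gt_eqF.
  have h4 : nr (a *: (u N x - T x) + (u N y - T y)) <= cn a * (e / K * nr x) + e / K * nr y.
    by rewrite (le_trans (nrD _ _)) // lerD // nrZ ler_wpM2l ?cn_ge0.
  have eK : 0 < e / K by rewrite divr_gt0.
  set t := e / K in h1 h4 eK *.
  rewrite /K !mulrDr mulr1 -!addrA lerD // addrA (le_trans h4) //.
  by rewrite mulrCA ler_wpDr ?(ltW eK).
have small (e : R) : 0 < e -> exists N, forall p, (N <= p)%N -> opnorm (u p - T) < e.
  move=> e0; have [N hN] := unif (e / 2) (divr_gt0 e0 (ltr0n _ 2)).
  exists N => p Np; rewrite (@le_lt_trans _ _ (e / 2)) //; last by rewrite ltr_pdivrMr // ltr_pMr // ltr1n.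
  by apply: opnorm_le_bop => [|x]; [rewrite divr_ge0 // ltW|exact: hN].
exists T => //; apply/compact_opP; split => //.
apply: tb_approx => e e0; have [N hN] := unif (e / 2) (divr_gt0 e0 (ltr0n _ 2)).
exists (u N); first by have [] := (compact_opP _).1 (cu N).
move=> x x1; rewrite nrB (le_lt_trans (hN N x (leqnn _))) //.
rewrite (@le_lt_trans _ _ (e / 2)) //; last by rewrite ltr_pdivrMr // ltr_pMr // ltr1n.
by rewrite ler_piMr // divr_ge0 // ltW.
Qed.

End Operators.

Section Adjoint.
Variables (R : realType) (H : completeNormedModType R[i]).
Variable ip : H -> H -> R[i].
Hypothesis hH : is_hilbert ip.
Implicit Types (x y z : H) (S T v : H -> H).
Local Notation adj := (adj ip).
Local Notation Kalg := (@Kalg R H ip).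

(** [adj] is picked by [xget], hence is an adjoint as soon as one exists; [riesz], applied to x |->
    <T x, y> for each y, provides it. *)
Lemma adjP T x y : bop T -> ip (T x) y = ip x (adj T y).
Proof.
move=> bT; rewrite /Defs.adj; case: xgetP => [T' _ -> //|].
have /choice[T' hT'] : forall y, exists y', forall x, ip (T x) y = ip x y'.
  move=> {}y; apply: (riesz hH (M := opnorm T * nr y)).
    by move=> a u v; case: bT => lT _; rewrite lT (ipPl hH).
  move=> u; rewrite (le_trans (cauchy_schwarz hH _ _)) //.
  by rewrite mulrAC ler_wpM2r ?nr_ge0 // opnorm_ub.
by move=> /(_ T')[]; move=> u v; exact: hT'.
Qed.

Lemma adjP' T x y : bop T -> ip (adj T x) y = ip x (T y).
Proof. by move=> bT; rewrite (ipC hH) -adjP // -(ipC hH). Qed.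

Lemma adj_unique T T' : (forall x y, ip (T x) y = ip x (T' y)) -> adj T = T'.
Proof.
move=> h; rewrite /Defs.adj; case: xgetP => [T2 _ h2|/(_ T')]//.
by apply/funext => y; apply: (ip_injr hH) => x; rewrite -h2 h.
Qed.

Lemma bop_adj T : bop T -> bop (adj T).
Proof.
move=> bT; split.
  move=> a x y; apply: (ip_injr hH) => z.
  by rewrite -adjP // (ipDr hH) (ipZr hH) (ipDr hH) (ipZr hH) -!adjP.
exists (opnorm T) => x.
have [->|h] := eqVneq (nr (adj T x)) 0; first by rewrite mulr_ge0 ?opnorm_ge0 ?nr_ge0.
have h0 : 0 < nr (adj T x) by rewrite lt_neqAle nr_ge0 eq_sym h.
rewrite -(ler_pM2r h0) -expr2.
have -> : nr (adj T x) ^+ 2 = complex.Re (ip (T (adj T x)) x).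
  by rewrite adjP // (ipxx hH).
rewrite (le_trans (Re_ip_le hH _ _)) // mulrAC ler_wpM2r ?nr_ge0 //.
exact: opnorm_ub.
Qed.

Lemma adjK T : bop T -> adj (adj T) = T.
Proof. by move=> bT; apply: adj_unique => x y; rewrite adjP'. Qed.

Lemma adj_comp S T : bop S -> bop T -> adj (S \o T) = adj T \o adj S.
Proof. by move=> bS bT; apply: adj_unique => x y; rewrite /= !adjP. Qed.

Lemma adjPl a S T : bop S -> bop T ->
  adj (a *: S + T) = Num.conj a *: adj S + adj T.
Proof.
move=> bS bT; apply: adj_unique => x y.
rewrite -[(a *: S + T) x]/(a *: S x + T x).
rewrite -[(_ *: adj S + adj T) y]/(Num.conj a *: adj S y + adj T y).
by rewrite (ipPl hH) (ipDr hH) (ipZr hH) conjCK !adjP.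
Qed.

Lemma adj0 : adj 0 = 0.
Proof. by apply: adj_unique => x y; rewrite (ip0l hH) (ip0r hH). Qed.

Lemma adj_id : adj id = id.
Proof. exact: adj_unique. Qed.

Lemma opnorm_adj T : bop T -> opnorm (adj T) = opnorm T.
Proof.
have le T' : bop T' -> opnorm (adj T') <= opnorm T'.
  move=> bT; apply: opnorm_le_bop => [|x]; first exact: opnorm_ge0.
  have [->|h] := eqVneq (nr (adj T' x)) 0; first by rewrite mulr_ge0 ?opnorm_ge0 ?nr_ge0.
  have h0 : 0 < nr (adj T' x) by rewrite lt_neqAle nr_ge0 eq_sym h.
  rewrite -(ler_pM2r h0) -expr2.
  have -> : nr (adj T' x) ^+ 2 = complex.Re (ip (T' (adj T' x)) x).
    by rewrite adjP // (ipxx hH).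
  rewrite (le_trans (Re_ip_le hH _ _)) // mulrAC ler_wpM2r ?nr_ge0 //.
  exact: opnorm_ub.
move=> bT; apply/eqP; rewrite eq_le le //= -{1}(adjK bT) le //.
exact: bop_adj.
Qed.

Lemma opnorm_cstar T : bop T -> opnorm (adj T \o T) = opnorm T ^+ 2.
Proof.
move=> bT; have bA := bop_adj bT; apply/eqP; rewrite eq_le; apply/andP; split.
  by rewrite expr2 -{1}(opnorm_adj bT) opnorm_comp.
have h x : nr x <= 1 -> nr (T x) <= Num.sqrt (opnorm (adj T \o T)).
  move=> x1; rewrite -(ger0_norm (nr_ge0 (T x))) -sqrtr_sqr ler_sqrt ?opnorm_ge0 //.
  have -> : nr (T x) ^+ 2 = complex.Re (ip ((adj T \o T) x) x).
    by rewrite /= adjP' // (ipxx hH).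
  rewrite (le_trans (Re_ip_le hH _ _)) // (le_trans _ (opnorm_ub1 (bop_comp bA bT) x1)) //.
  by rewrite ler_piMr // nr_ge0.
have : opnorm T <= Num.sqrt (opnorm (adj T \o T)) by exact: opnorm_le.
rewrite -ler_sqr ?nnegrE ?sqrtr_ge0 ?opnorm_ge0 // sqr_sqrtr //.
exact: opnorm_ge0.
Qed.

(** With S the adjoint of T, |S (x - y)|^2 = <T S (x - y), x - y>, and |x - y| <= 2 on the unit
    ball. So S varies by less than e where the compact operator T S varies by less than e^2 / 2. *)
Lemma compact_adj T : compact_op T -> compact_op (adj T).
Proof.
move=> cT; have bT := compact_bop cT; have bA := bop_adj bT.
apply/compact_opP; split; first by case: bA.
have /compact_opP[lTT tTT] := compact_compr cT bA.
apply: tb_control tTT => e e0; exists (e ^+ 2 / 2); first by rewrite divr_gt0 // exprn_gt0.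
move=> x y x1 y1 h; rewrite -ltr_sqr ?nnegrE ?nr_ge0 ?(ltW e0) //.
rewrite -linB; last by case: bA.
have -> : nr (adj T (x - y)) ^+ 2 = complex.Re (ip ((T \o adj T) (x - y)) (x - y)).
  by rewrite /= adjP // (ipxx hH).
rewrite (le_lt_trans (Re_ip_le hH _ _)) // linB //.
have xy : nr (x - y) <= 2.
  by rewrite (le_trans (nrD _ _)) // nrN (_ : 2 = 1 + 1) // lerD.
have := nr_ge0 ((T \o adj T) x - (T \o adj T) y).
move: (nr _) h => t h t0; have := nr_ge0 (x - y); nra.
Qed.

Lemma Kalg_cstar : is_cstar Kalg.
Proof.
have B T : compact_op T -> bop T by exact: compact_bop.
split.
- exact (@cop0 R H).
- by move=> c a b; exact: copPl.
- by move=> a b ca /B bb; exact: compact_compr.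
- by move=> a; exact: compact_adj.
- by [].
- by [].
- move=> t a b c _ _ [lc _]; apply/funext => x /=.
  by rewrite -[LHS]/(c (t *: a x + b x)) lc.
- by move=> a /B; exact: adjK.
- by move=> t a b /B ba /B bb; exact: adjPl.
- by move=> a b /B ba /B bb; exact: adj_comp.
- by move=> a /B; exact: opnorm0_eq0.
- by move=> a b /B ba /B bb; exact: opnormD.
- by move=> t a /B; exact: opnormZ.
- by move=> a b /B ba /B bb; exact: opnorm_comp.
- by move=> a /B; exact: opnorm_cstar.
- exact: compact_limit.
Qed.

Lemma nr_unitary v x : unitary ip v -> nr (v x) = nr x.
Proof.
move=> [_ _ h]; apply/eqP; rewrite -(@eqrXn2 _ 2) ?nr_ge0 //; apply/eqP.
by apply: (@complexI R); rewrite -!(ipxx hH) h.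
Qed.

Lemma unitary_bop v : unitary ip v -> bop v.
Proof.
move=> uv; split; first by case: uv.
by exists 1 => x; rewrite mul1r nr_unitary.
Qed.

Lemma unitaryK v : unitary ip v -> adj v \o v = id.
Proof.
move=> uv; have bv := unitary_bop uv; apply/funext => x /=.
by apply: (ip_injr hH) => y; rewrite -adjP //; case: uv.
Qed.

Lemma unitaryKV v : unitary ip v -> v \o adj v = id.
Proof.
move=> uv; have h := unitaryK uv; apply/funext => x /=.
have [_ /(_ x)[y <-] _] := uv.
by rewrite -[adj v (v y)]/((adj v \o v) y) h.
Qed.

Lemma unitaryE v w : bop v -> bop w -> w \o v = id -> v \o w = id -> adj v = w -> unitary ip v.
Proof.
move=> bv bw wv vw e; split; first by case: bv.
  by move=> y; exists (w y); rewrite -[v (w y)]/((v \o w) y) vw.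
by move=> x y; rewrite adjP // e -[w (v y)]/((w \o v) y) wv.
Qed.

Lemma unitary_adj v : unitary ip v -> unitary ip (adj v).
Proof.
move=> uv; have bv := unitary_bop uv.
by apply: (@unitaryE _ v); [exact: bop_adj| |exact: unitaryKV|exact: unitaryK|exact: adjK].
Qed.

Lemma unitary_comp v w : unitary ip v -> unitary ip w -> unitary ip (v \o w).
Proof.
move=> uv uw; split.
- by case: (bop_comp (unitary_bop uv) (unitary_bop uw)).
- move=> y; case: uv uw => _ /(_ y)[x <-] _ [_ /(_ x)[z <-] _]; by exists z.
- by move=> x y /=; case: uv uw => _ _ -> [_ _ ->].
Qed.

Lemma unitary_id : unitary ip id.
Proof. by split => // y; exists y. Qed.

Lemma Ad_comp v w T : unitary ip v -> unitary ip w -> Ad ip (v \o w) T = Ad ip v (Ad ip w T).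
Proof. by move=> uv uw; rewrite /Ad adj_comp //; exact: unitary_bop. Qed.

Lemma Ad_id T : Ad ip id T = T.
Proof. by rewrite /Ad adj_id. Qed.

Lemma AdK v T : unitary ip v -> Ad ip (adj v) (Ad ip v T) = T.
Proof. by move=> uv; rewrite -Ad_comp ?unitaryK ?Ad_id //; exact: unitary_adj. Qed.

Lemma AdKV v T : unitary ip v -> Ad ip v (Ad ip (adj v) T) = T.
Proof. by move=> uv; rewrite -Ad_comp ?unitaryKV ?Ad_id //; exact: unitary_adj. Qed.

Lemma Ad_compact v T : unitary ip v -> compact_op T -> compact_op (Ad ip v T).
Proof.
move=> uv cT; have bv := unitary_bop uv; rewrite /Ad.
by apply: compact_compr; [exact: compact_compl|exact: bop_adj].
Qed.

Lemma Ad_bop v T : unitary ip v -> bop T -> bop (Ad ip v T).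
Proof.
move=> uv cT; have bv := unitary_bop uv; rewrite /Ad.
by apply: bop_comp; [exact: bop_comp|exact: bop_adj].
Qed.

Lemma opnorm_Ad v T : unitary ip v -> bop T -> opnorm (Ad ip v T) = opnorm T.
Proof.
have le u S : unitary ip u -> bop S -> opnorm (Ad ip u S) <= opnorm S.
  move=> uu bS; have bu := unitary_bop uu; apply: opnorm_le => x x1.
  rewrite /Ad /= nr_unitary // opnorm_ub1 // nr_unitary //; exact: unitary_adj.
move=> uv bT; apply/eqP; rewrite eq_le le //= -{1}(AdK T uv) le //.
  exact: unitary_adj.
exact: Ad_bop.
Qed.

End Adjoint.

(** * Representations by compact operators *)

Lemma addr_self0 (V : zmodType) (x : V) : x = x + x -> x = 0.
Proof. by move=> /(congr1 (fun y => y - x)); rewrite addrK subrr. Qed.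

Section StarIso.
Variable R : realType.
Implicit Types A B C : calg R.

Record alg_closed A : Prop := AlgClosed {
  ac0 : mem (0 : A);
  acPl : forall (c : R[i]) (a b : A), mem a -> mem b -> mem (c *: a + b);
  acM : forall a b : A, mem a -> mem b -> mem (mul a b);
  acS : forall a : A, mem a -> mem (star a) }.

Lemma cstar_closed A : is_cstar A -> alg_closed A.
Proof. by move=> h; split; case: h. Qed.

Lemma acD A (a b : A) : alg_closed A -> mem a -> mem b -> mem (a + b).
Proof. by move=> h ha hb; rewrite -[a]scale1r; exact: acPl. Qed.
Lemma acZ A c (a : A) : alg_closed A -> mem a -> mem (c *: a).
Proof. by move=> h ha; rewrite -[_ *: _]addr0; apply: acPl => //; exact: ac0. Qed.
Lemma acN A (a : A) : alg_closed A -> mem a -> mem (- a).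
Proof. by move=> h ha; rewrite -scaleN1r; exact: acZ. Qed.
Lemma acB A (a b : A) : alg_closed A -> mem a -> mem b -> mem (a - b).
Proof. by move=> h ha hb; apply: acD => //; exact: acN. Qed.

Lemma si_mem A B (psi : A -> B) (a : A) : star_iso psi -> mem a -> mem (psi a).
Proof. by move=> [[h _ _] _ _ _]; exact: h. Qed.

Lemma si_inj A B (psi : A -> B) (a b : A) :
  star_iso psi -> mem a -> mem b -> psi a = psi b -> a = b.
Proof. by move=> [[_ h _] _ _ _] ha hb; apply: h; rewrite inE. Qed.

Lemma si_surj A B (psi : A -> B) (b : B) :
  star_iso psi -> mem b -> exists2 a : A, mem a & psi a = b.
Proof. by move=> [[_ _ h] _ _ _] /h[a]; exists a. Qed.

Lemma star_isoI A B (psi : A -> B) :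
  (forall a : A, mem a -> mem (psi a)) ->
  (forall a b : A, mem a -> mem b -> psi a = psi b -> a = b) ->
  (forall b : B, mem b -> exists2 a : A, mem a & psi a = b) ->
  (forall (t : R[i]) (a b : A), mem a -> mem b -> psi (t *: a + b) = t *: psi a + psi b) ->
  (forall a b : A, mem a -> mem b -> psi (mul a b) = mul (psi a) (psi b)) ->
  (forall a : A, mem a -> psi (star a) = star (psi a)) -> star_iso psi.
Proof.
move=> h1 h2 h3 h4 h5 h6; split => //; split => //.
by move=> a b; rewrite !inE; exact: h2.
Qed.

Lemma star_iso_inv A B (psi : A -> B) : alg_closed A -> star_iso psi ->
  exists phi : B -> A, [/\ star_iso phi,
    forall a : A, mem a -> phi (psi a) = a &
    forall b : B, mem b -> psi (phi b) = b].
Proof.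
move=> cA h.
pose phi b := xget 0 [set a : A | mem a /\ psi a = b].
have phiP (b : B) : mem b -> mem (phi b) /\ psi (phi b) = b.
  move=> hb; rewrite /phi; case: xgetP => [a _ [] //|].
  by have [a ha <-] := si_surj h hb => /(_ a)[].
have phiK (a : A) : mem a -> phi (psi a) = a.
  by move=> ha; have [h1 h2] := phiP _ (si_mem h ha); exact: (si_inj h).
have inj (a b : A) := @si_inj _ _ _ a b h.
exists phi; split=> //; last by move=> b /phiP[].
apply: star_isoI.
- by move=> b /phiP[].
- by move=> a b /phiP[_ h1] /phiP[_ h2] e; rewrite -h1 -h2 e.
- by move=> a ha; exists (psi a); [exact: si_mem h ha|exact: phiK].
- move=> t a b /phiP[ma {1}<-] /phiP[mb {1}<-]; rewrite -(si_lin h) // phiK //.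
  exact: acPl.
- move=> a b /phiP[ma {1}<-] /phiP[mb {1}<-]; rewrite -(si_mul h) // phiK //.
  exact: acM.
- by move=> a /phiP[ma {1}<-]; rewrite -(si_star h) // phiK //; exact: acS.
Qed.

Lemma star_iso_comp A B C (psi : A -> B) (phi : B -> C) :
  star_iso psi -> star_iso phi -> star_iso (phi \o psi).
Proof.
move=> h k; have m (a : A) := @si_mem _ _ _ a h; apply: star_isoI => /=.
- by move=> a /m; exact: si_mem.
- by move=> a b ma mb /(si_inj k (m _ ma) (m _ mb)); exact: si_inj h _ _.
- by move=> c /(si_surj k)[b /(si_surj h)[a ma <-] <-]; exists a.
- by move=> t a b ma mb; rewrite (si_lin h) // (si_lin k) //; exact: m.
- by move=> a b ma mb; rewrite (si_mul h) // (si_mul k) //; exact: m.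
- by move=> a ma; rewrite (si_star h) // (si_star k) //; exact: m.
Qed.

Lemma si0 A B (psi : A -> B) : alg_closed A -> star_iso psi -> psi 0 = 0.
Proof.
move=> cA h; have := si_lin h 1 (ac0 cA) (ac0 cA).
by rewrite !scale1r addr0 => /addr_self0.
Qed.

Lemma siZ A B (psi : A -> B) c (a : A) : alg_closed A -> star_iso psi -> mem a ->
  psi (c *: a) = c *: psi a.
Proof.
by move=> cA h ha; rewrite -[in LHS](addr0 (c *: a)) (si_lin h) ?(si0 cA h) ?addr0 //; exact: ac0.
Qed.

Lemma siB A B (psi : A -> B) (a b : A) : alg_closed A -> star_iso psi -> mem a -> mem b ->
  psi (a - b) = psi a - psi b.
Proof.
move=> cA h ha hb; rewrite addrC -scaleN1r (si_lin h) // scaleN1r addrC //.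
Qed.

End StarIso.

(** * Quasi-inverses in a C*-algebra *)

Section Neumann.
Variables (R : realType) (A : calg R).
Hypothesis hA : is_cstar A.
Let cA := cstar_closed hA.

Lemma nrm0 : nrm (0 : A) = 0.
Proof. by rewrite -(scale0r 0) (cs_nrmZ hA) ?normr0 ?mul0r //; exact: ac0. Qed.

Lemma nrmN (a : A) : mem a -> nrm (- a) = nrm a.
Proof. by move=> ha; rewrite -scaleN1r (cs_nrmZ hA) // normrN1 mul1r. Qed.

Lemma nrm_ge0 (a : A) : mem a -> 0 <= nrm a.
Proof.
move=> ha; have := cs_nrmD hA ha (acN cA ha); rewrite subrr nrm0 nrmN //; lra.
Qed.

Lemma mulBl (a b c : A) : mem a -> mem b -> mem c -> mul (a - b) c = mul a c - mul b c.
Proof.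
by move=> ha hb hc; rewrite addrC -scaleN1r (cs_mull hA) // scaleN1r addrC.
Qed.

Lemma expr_small (r B : R) : 0 <= r -> r < 1 -> 0 <= B -> forall e, 0 < e ->
  exists N, forall p, (N <= p)%N -> r ^+ p * B < e.
Proof.
move=> r0 r1 B0 e e0; have B1 : 0 < B + 1 by rewrite ltr_wpDl.
have /cvgrPdist_lt/(_ _ (divr_gt0 e0 B1))[N _ hN] : (fun n => r ^+ n) @ \oo --> (0 : R).
  by apply: cvg_expr; rewrite ger0_norm.
exists N => p /hN /=; rewrite sub0r normrN ger0_norm ?exprn_ge0 // => h.
rewrite (@le_lt_trans _ _ (r ^+ p * (B + 1))) //; last by rewrite -ltr_pdivlMr.
by rewrite ler_wpM2l ?exprn_ge0 // lerDl.
Qed.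

(* [b] is a quasi-inverse: (1 + b)(1 - c) = 1, without a unit. *)
Lemma neumann (c : A) : mem c -> nrm c < 1 -> exists2 b : A, mem b & b = c + mul b c.
Proof.
move=> hc r1; set r := nrm c in r1 *; have r0 : 0 <= r by exact: nrm_ge0.
have r1' : 0 < 1 - r by rewrite subr_gt0.
(* The partial sums c + c^2 + ... + c^n of the Neumann series; [B] below is the geometric sum r +
   r^2 + ... that bounds their norms. *)
pose s := fix s n : A := if n is m.+1 then c + mul (s m) c else 0.
have ms n : mem (s n).
  by elim: n => [|n ih]; [exact: ac0|apply: acD => //; exact: acM].
pose B := r / (1 - r).
have B0 : 0 <= B by rewrite divr_ge0 // ltW.
have sB n : nrm (s n) <= B.
  elim: n => [|n ih]; first by rewrite /= nrm0.
  have h1 := cs_nrmD hA hc (acM cA (ms n) hc); rewrite /= (le_trans h1) //.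
  have h2 := cs_nrmM hA (ms n) hc.
  have h3 : nrm (s n) * r <= B * r by rewrite ler_wpM2r.
  have : r + B * r = B by rewrite /B; field; rewrite gt_eqF.
  rewrite -/r in h2 *; lra.
have sc q m : nrm (s (q + m)%N - s q) <= r ^+ q * B.
  elim: q => [|q ih]; first by rewrite add0n expr0 mul1r subr0.
  rewrite addSn /= opprD addrACA subrr add0r -mulBl //.
  rewrite (le_trans (cs_nrmM hA _ _)) //; first exact: acB.
  by rewrite exprSr mulrAC ler_wpM2r.
have [|b mb hb] := @cs_complete _ _ hA s ms.
  move=> e e0; have [N hN] := expr_small r0 r1 B0 e0.
  exists N => p q Np Nq; wlog pq : p q Np Nq / (q <= p)%N.
    move=> h; have [/h->//|/ltnW/h h'] := leqP q p.
    rewrite -nrmN ?opprB ?h' //; exact: acB.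
  by rewrite -(subnKC pq) (le_lt_trans (sc _ _)) // hN.
exists b => //; apply/subr0_eq/(cs_nrm0 hA).
  by apply: acB => //; apply: acD => //; exact: acM.
apply/eqP; rewrite eq_le nrm_ge0 ?andbT; last by apply: acB => //; apply: acD => //; exact: acM.
apply/ler_addgt0Pr => e e0; rewrite add0r.
have [N hN] := hb (e / 2) (divr_gt0 e0 (ltr0n _ 2)).
have -> : b - (c + mul b c) = - (s N.+1 - b) + mul (s N - b) c.
  rewrite mulBl //= opprB -addrA; congr (_ + _).
  by rewrite opprD [in RHS]opprD -addrA addKr.
rewrite (le_trans (cs_nrmD hA _ _)) //.
- by apply: acN => //; exact: acB.
- by apply: acM => //; exact: acB.
rewrite nrmN; last exact: acB.
rewrite [leRHS]splitr lerD //; first exact/ltW/hN.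
rewrite (le_trans (cs_nrmM hA _ _)) //; first exact: acB.
rewrite (le_trans _ (ltW (hN N _))) // ler_piMr ?(ltW r1) // nrm_ge0 //.
exact: acB.
Qed.

End Neumann.

Section Representations.
Variables (R : realType) (H : completeNormedModType R[i]).
Variable ip : H -> H -> R[i].
Hypothesis hH : is_hilbert ip.
Implicit Types (x y z : H) (S T v : H -> H).
Local Notation adj := (adj ip).
Local Notation Kalg := (@Kalg R H ip).

(* If |q a| > |a| then c = a* a / |q a|^2 has norm < 1, hence a quasi-inverse,
   and 1 - q c is bounded below; but q c is positive of norm 1. *)
Lemma hom_contractive (A : calg R) (q : A -> H -> H) : is_cstar A ->
  (forall a, mem a -> bop (q a)) ->
  (forall t a b, mem a -> mem b -> q (t *: a + b) = t *: q a + q b) ->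
  (forall a b, mem a -> mem b -> q (mul a b) = q a \o q b) ->
  (forall a, mem a -> q (star a) = adj (q a)) ->
  forall a, mem a -> opnorm (q a) <= nrm a.
Proof.
move=> hA qb ql qm qs a ma; have cA := cstar_closed hA.
rewrite leNgt; apply/negP => lt; set M := opnorm (q a) in lt *.
have M0 : 0 < M by rewrite (le_lt_trans (nrm_ge0 hA ma)).
have M20 : 0 < M ^+ 2 by rewrite exprn_gt0.
have mc0 : mem (mul (star a) a) by apply: acM => //; exact: acS.
pose c : A := (M ^+ 2)^-1%:C *: mul (star a) a.
have mc : mem c by exact: acZ.
have q0 : q 0 = 0.
  have := ql 1 0 0 (ac0 cA) (ac0 cA).
  by rewrite !scale1r addr0 => /addr_self0.
have [|b mb bE] := neumann hA mc.
  rewrite (cs_nrmZ hA) // -/(cn _) cn_real ?invr_ge0 ?(ltW M20) // (cs_cstar hA) //.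
  by rewrite ltr_pdivrMl // mulr1 ltr_sqr ?nnegrE ?(nrm_ge0 hA) ?(ltW M0).
have qcE : q c = (M ^+ 2)^-1%:C *: (adj (q a) \o q a).
  by rewrite -[c]addr0 ql ?q0 ?addr0 ?qm ?qs //; [exact: acS|exact: ac0].
have bq := qb _ ma; have bT := qb _ mc; have bB := qb _ mb.
have T1 : opnorm (q c) = 1.
  rewrite qcE opnormZ; last exact/bop_comp/bq/bop_adj.
  by rewrite cn_real ?invr_ge0 ?(ltW M20) // opnorm_cstar // mulVf // gt_eqF.
have qbE : q b = q c + (q b \o q c).
  by rewrite {1}bE -[c in c + _]scale1r ql ?scale1r ?qm //; exact: acM.
pose K := 1 + opnorm (q b).
have K1 : 1 <= K by rewrite /K lerDl opnorm_ge0.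
have key x : nr x <= K * nr (x - q c x).
  have e : q b x = q c x + q b (q c x) by rewrite {1}qbE.
  have -> : nr x = nr ((x - q c x) + q b (x - q c x)).
    by rewrite linB; [rewrite e addrK subrK|case: bB].
  rewrite (le_trans (nrD _ _)) // /K mulrDl mul1r lerD2l.
  exact: opnorm_ub.
(* [key] gives |x|^2 <= K^2 |x - q c x|^2, and the right-hand norm squared is at most 2 |x|^2 - 2 |q
   a x|^2 / M^2. Together |q a x|^2 <= M^2 (1 - d) |x|^2, against M being the norm of q a. *)
pose d := (2 * K ^+ 2)^-1.
have K20 : 0 < 2 * K ^+ 2 by rewrite mulr_gt0 // exprn_gt0 // (lt_le_trans ltr01).
have d0 : 0 < d by rewrite invr_gt0.
have bound x : nr x <= 1 -> nr (q a x) ^+ 2 <= M ^+ 2 * (1 - d).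
  move=> x1; have h1 := key x.
  have h2 : nr (x - q c x) ^+ 2 <= 2 * nr x ^+ 2 - 2 * (nr (q a x) ^+ 2 / M ^+ 2).
    rewrite (nr_sqrB hH).
    have -> : complex.Re (ip x (q c x)) = nr (q a x) ^+ 2 / M ^+ 2.
      rewrite qcE -[(_ *: _) x]/(_ *: (adj (q a) (q a x))) (ipZr hH) -adjP // (ipxx hH) /=.
      by field; rewrite gt_eqF.
    have : nr (q c x) <= nr x.
      by rewrite (le_trans (opnorm_ub _ bT)) // T1 mul1r.
    have := nr_ge0 (q c x); have := nr_ge0 x.
    move: (nr _) (nr x) => u w; nra.
  have h3 : nr x ^+ 2 <= K ^+ 2 * nr (x - q c x) ^+ 2.
    rewrite -exprMn ler_sqr ?nnegrE ?nr_ge0 //.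
    by rewrite mulr_ge0 ?nr_ge0 // (le_trans ler01).
  have h4 : nr x ^+ 2 <= K ^+ 2 * (2 * nr x ^+ 2 - 2 * (nr (q a x) ^+ 2 / M ^+ 2)).
    by rewrite (le_trans h3) // ler_wpM2l // exprn_ge0 // (le_trans ler01).
  have h5 : nr (q a x) ^+ 2 / M ^+ 2 <= nr x ^+ 2 * (1 - d).
    rewrite -(ler_pM2l K20).
    have -> : 2 * K ^+ 2 * (nr x ^+ 2 * (1 - d)) = 2 * K ^+ 2 * nr x ^+ 2 - nr x ^+ 2.
      by rewrite /d; field; rewrite gt_eqF // (lt_le_trans ltr01).
    lra.
  rewrite -ler_pdivrMl // mulrC (le_trans h5) // ler_piMl //.
    have : d <= 1; last lra.
    rewrite /d invf_le1 // ; have : 1 <= K ^+ 2 by rewrite exprn_ege1.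
    lra.
  by rewrite expr_le1 // nr_ge0.
have : M <= Num.sqrt (M ^+ 2 * (1 - d)).
  apply: opnorm_le => x x1; rewrite -(ger0_norm (nr_ge0 (q a x))) -sqrtr_sqr.
  apply: ler_wsqrtr; exact: bound.
rewrite -ler_sqr ?nnegrE ?sqrtr_ge0 ?(ltW M0) // sqr_sqrtr; last first.
  by have := bound 0; rewrite nr0 ler01 => /(_ isT); apply: le_trans; rewrite sqr_ge0.
nra.
Qed.

Record is_rep (A : calg R) (q : A -> H -> H) : Prop := IsRep {
  rp_compact : forall a, mem a -> compact_op (q a);
  rp_lin : forall t a b, mem a -> mem b -> q (t *: a + b) = t *: q a + q b;
  rp_mul : forall a b, mem a -> mem b -> q (mul a b) = q a \o q b;
  rp_star : forall a, mem a -> q (star a) = adj (q a) }.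

Lemma rep_contractive (A : calg R) (q : A -> H -> H) (a : A) :
  is_cstar A -> is_rep q -> mem a -> opnorm (q a) <= nrm a.
Proof.
move=> hA [h1 h2 h3 h4]; apply: hom_contractive => // b mb.
exact/compact_bop/h1.
Qed.

Lemma rep0 (A : calg R) (q : A -> H -> H) : alg_closed A -> is_rep q -> q 0 = 0.
Proof.
move=> cA [_ ql _ _]; have := ql 1 0 0 (ac0 cA) (ac0 cA).
by rewrite !scale1r addr0 => /addr_self0.
Qed.

Lemma repB (A : calg R) (q : A -> H -> H) a b : is_rep q -> mem a -> mem b ->
  q (a - b) = q a - q b.
Proof. by move=> h ma mb; rewrite addrC -scaleN1r (rp_lin h) // scaleN1r addrC. Qed.

(** The map and its inverse are both representations of [Kalg], hence contractive. *)
Lemma Kiso_norm (th : Kalg -> Kalg) T : star_iso th -> compact_op T ->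
  opnorm (th T) = opnorm T.
Proof.
have le (f : Kalg -> Kalg) S : star_iso f -> compact_op S -> opnorm (f S) <= opnorm S.
  move=> h cS; apply: (@rep_contractive Kalg f S (Kalg_cstar hH)) => //; split.
  - by move=> a ma; exact: (si_mem h).
  - by move=> t a b ma mb; exact: (si_lin h).
  - by move=> a b ma mb; exact: (si_mul h).
  - by move=> a ma; exact: (si_star h).
move=> h cT; apply/eqP; rewrite eq_le le //=.
have [f [hf fK _]] := star_iso_inv (cstar_closed (Kalg_cstar hH)) h.
by rewrite -{1}(fK T cT) le //; exact: (si_mem h).
Qed.

Lemma rep_link (A : calg R) (p q : A -> H -> H) : alg_closed A -> is_rep p -> is_rep q ->
  (forall T, compact_op T -> exists2 a, mem a & p a = T) ->
  (forall T, compact_op T -> exists2 a, mem a & q a = T) ->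
  (forall a, mem a -> p a = 0 <-> q a = 0) ->
  exists2 th : Kalg -> Kalg, star_iso th & forall a, mem a -> q a = th (p a).
Proof.
move=> cA hp hq sp sq pq.
pose th T := q (xget 0 [set a | mem a /\ p a = T]).
have thE a : mem a -> q a = th (p a).
  move=> ma; rewrite /th; case: xgetP => [b _ [mb pb]|/(_ a)[]//].
  apply/subr0_eq; rewrite -(repB hq) //; apply/pq; first exact: acB.
  by rewrite (repB hp) // pb subrr.
exists th => //; apply: star_isoI.
- by move=> _ /sp[a ma <-]; rewrite -thE //; exact: (rp_compact hq).
- move=> _ _ /sp[a ma <-] /sp[b mb <-]; rewrite -!thE // => e.
  apply/subr0_eq; rewrite -(repB hp) //; apply/pq; first exact: acB.
  by rewrite (repB hq) // e subrr.
- by move=> _ /sq[a ma <-]; exists (p a); [exact: (rp_compact hp)|rewrite -thE].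
- move=> t _ _ /sp[a ma <-] /sp[b mb <-]; rewrite -(rp_lin hp) // -!thE ?(rp_lin hq) //.
  exact: acPl.
- move=> _ _ /sp[a ma <-] /sp[b mb <-].
  rewrite -[mul _ _]/(p a \o p b) -(rp_mul hp) // -!thE ?(rp_mul hq) //.
  exact: acM.
- move=> _ /sp[a ma <-]; rewrite -[star _]/(adj (p a)) -(rp_star hp) // -!thE ?(rp_star hq) //.
  exact: acS.
Qed.

(** The rank one operator |x><y|; [ip] is linear in its first argument. *)
Definition ketbra x y : H -> H := fun z => ip z y *: x.

Lemma bop_ketbra x y : bop (ketbra x y).
Proof.
split; first by move=> a u v; rewrite /ketbra (ipPl hH) scalerDl scalerA.
exists (nr x * nr y) => z; rewrite /ketbra nrZ -/(cn _).
by rewrite mulrC -mulrA ler_wpM2l ?nr_ge0 // mulrC cauchy_schwarz.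
Qed.

Lemma tb_segment (M : R) x : tb [set t%:C *: x | t in `[- M, M]%classic].
Proof.
apply: compact_tb; apply: continuous_compact; last exact: segment_compact.
apply: continuous_subspaceT => t; apply/cvg_nrP => e e0.
have K0 : 0 < nr x + 1 by rewrite ltr_wpDl ?nr_ge0.
near=> s; rewrite -scalerBl -rmorphB nrZr.
rewrite (@le_lt_trans _ _ (`|s - t| * (nr x + 1))) //.
  by rewrite ler_wpM2l // lerDl.
rewrite -ltr_pdivlMr // distrC; near: s.
by apply: (@cvgr_dist_lt _ R^o) => //; rewrite divr_gt0.
Unshelve. all: end_near. Qed.

(** Splitting <z, y> into real and imaginary parts puts the image of the unit ball into a sum of two
    compact segments, along x and along i x. *)
Lemma compact_ketbra x y : compact_op (ketbra x y).
Proof.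
apply/compact_opP; split; first by case: (bop_ketbra x y).
rewrite (_ : ketbra x y = fun z => (complex.Re (ip z y))%:C *: x +
    (complex.Im (ip z y))%:C *: ('i%C *: x)); last first.
  apply/funext => z; rewrite /ketbra scalerA -scalerDl; congr (_ *: _).
  by case: (ip z y) => a b; apply/eqP; rewrite eq_complex /=; apply/andP; split; apply/eqP; ring.
have bd z : ball1 z -> cn (ip z y) <= nr y.
  move=> z1; rewrite (le_trans (cauchy_schwarz hH _ _)) //.
  by rewrite ler_piMl ?nr_ge0.
apply: tbD.
  apply: tb_sub (@tb_segment (nr y) x) => _ [z /bd zy <-].
  exists (complex.Re (ip z y)) => //; rewrite /= in_itv /= -ler_norml.
  by rewrite (le_trans _ zy) // -lecR -cnE normc_ge_Re.
apply: tb_sub (@tb_segment (nr y) ('i%C *: x)) => _ [z /bd zy <-].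
exists (complex.Im (ip z y)) => //; rewrite /= in_itv /= -ler_norml.
rewrite (le_trans _ zy) // -normrN -Re_mulI -lecR -cnE.
rewrite (le_trans (normc_ge_Re _)) // normrM (_ : `|'i%C| = 1 :> R[i]) ?mul1r //.
by rewrite normc_def /= expr0n /= add0r expr1n sqrtr1.
Qed.

Lemma ketbra_compl T x y : linear T -> T \o ketbra x y = ketbra (T x) y.
Proof. by move=> lT; apply/funext => z; rewrite /ketbra /= linZ. Qed.

Lemma adj_ketbra x y : adj (ketbra x y) = ketbra y x.
Proof.
apply: (adj_unique hH) => u v; rewrite /ketbra (ipZl hH) (ipZr hH).
by rewrite -(ipC hH) mulrC.
Qed.

Lemma ketbra_ket x y z w : ketbra x y \o ketbra z w = ip z y *: ketbra x w.
Proof.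
apply/funext => v; rewrite /ketbra /= (ipZl hH).
by rewrite -[RHS]/(ip z y *: (ip v w *: x)) scalerA mulrC.
Qed.

Lemma ketbraPl a x y z : ketbra (a *: x + y) z = a *: ketbra x z + ketbra y z.
Proof.
apply/funext => v; rewrite /ketbra.
by rewrite -[RHS]/(a *: (ip v z *: x) + ip v z *: y) scalerDr !scalerA mulrC.
Qed.

Variable e : H.
Hypothesis e1 : nr e = 1.

Lemma ipee : ip e e = 1. Proof. by rewrite (ipxx hH) e1 expr1n. Qed.

(** Since T |x><e| = |T x><e|, the map u intertwines T with th T. It is isometric because the
    adjoint of |x><e| times |y><e| is a multiple of |e><e|, whose image fixes xi, and surjective
    because y = |y><xi| xi and |y><xi| is some th S. The automorphism is thus implemented by a
    formula in the single vector xi, so continuity of u will follow from that of xi. *)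
Lemma Kiso_inner (th : Kalg -> Kalg) xi : star_iso th -> nr xi = 1 ->
  th (ketbra e e) xi = xi ->
  let u x := th (ketbra x e) xi in
  unitary ip u /\ forall T, compact_op T -> th T = Ad ip u T.
Proof.
move=> h xi1 thxi u.
have kk x y : mem (ketbra x y : Kalg) := compact_ketbra x y.
have uT T x : compact_op T -> u (T x) = th T (u x).
  move=> cT; rewrite /u -(ketbra_compl x e); last by case: (compact_bop cT).
  by rewrite -[_ \o _]/(mul (T : Kalg) (ketbra x e : Kalg)) (si_mul h).
have xx : ip xi xi = 1 by rewrite (ipxx hH) xi1 expr1n.
have uu : unitary ip u.
  split.
  - move=> a x y; rewrite /u ketbraPl (si_lin h) //.
  - move=> y; have [S cS hS] := si_surj h (kk y xi).
    exists (S e); rewrite uT //; rewrite /u.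
    by rewrite thxi hS /ketbra xx scale1r.
  - move=> x y; rewrite /u; have bk z w := compact_bop (si_mem h (kk z w)).
    rewrite adjP // -[adj (th _)]/(star (th (ketbra x e))) -(si_star h) //.
    rewrite [star _]adj_ketbra.
    rewrite -[th _ (th _ _)]/(mul (th (ketbra e x)) (th (ketbra y e)) xi) -(si_mul h) //.
    rewrite [mul _ _]ketbra_ket (siZ _ (cstar_closed (Kalg_cstar hH)) h) //.
    rewrite -[(_ *: th _) xi]/(_ *: (th _ xi)) thxi (ipZr hH) xx mulr1.
    by rewrite -(ipC hH).
split=> // T cT; rewrite /Ad; apply/funext => x /=.
by rewrite uT // -[u (adj u x)]/((u \o adj u) x) (unitaryKV hH).
Qed.

(** The image of the projection |e><e| is a projection, nonzero because th is injective; normalising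
    a nonzero vector of its range gives the xi needed in [Kiso_inner]. *)
Lemma Kiso_proj (th : Kalg -> Kalg) (P := th (ketbra e e)) : star_iso th ->
  [/\ bop P, P \o P = P, adj P = P & exists2 xi, nr xi = 1 & P xi = xi].
Proof.
move=> h; have ke : mem (ketbra e e : Kalg) := compact_ketbra e e.
have bP : bop P := compact_bop (si_mem h ke).
have PP : P \o P = P.
  rewrite -[P \o P]/(mul (th (ketbra e e)) (th (ketbra e e))) -(si_mul h) //.
  by rewrite [mul _ _]ketbra_ket ipee scale1r.
split => //.
  by rewrite -[adj P]/(star (th (ketbra e e))) -(si_star h) // [star _]adj_ketbra.
have [y Py] : exists y, P y != 0.
  apply: contrapT => /forallNP P0.
  have : P = th 0.
    rewrite (si0 (cstar_closed (Kalg_cstar hH)) h); apply/funext => y.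
    by have /negP := P0 y; rewrite negbK => /eqP.
  move=> /(si_inj h ke (ac0 (cstar_closed (Kalg_cstar hH))))/(congr1 (fun f => f e)).
  rewrite /ketbra ipee scale1r => e0; move: e1; rewrite e0 nr0 => /eqP.
  by rewrite eq_sym oner_eq0.
have n0 := nr_gt0 Py.
exists ((nr (P y))^-1%:C *: P y); first by rewrite nrZ_pos ?invr_ge0 ?nr_ge0 // mulVf // gt_eqF.
by rewrite linZ -?[P (P y)]/((P \o P) y) ?PP //; case: bP.
Qed.

Lemma scalar_ofP U c : (forall x, U x = cval c *: x) -> scalar_of U = c.
Proof.
move=> h; rewrite /scalar_of; case: xgetP => [d _ hd|/(_ c)[]//].
apply: val_inj => /=; have : (cval d - cval c) *: e = 0.
  by rewrite scalerBl -hd -h subrr.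
move=> /(congr1 (fun z => ip z e)); rewrite (ipZl hH) ipee mulr1 (ip0l hH).
exact: subr0_eq.
Qed.

(** The commutant of K is trivial: applying Ad U (|x><e|) = |x><e| to the vector U e gives U x = <U
    e, e> x for every x. *)
Lemma scalar_comm U : unitary ip U -> (forall T, compact_op T -> Ad ip U T = T) ->
  forall x, U x = cval (scalar_of U) *: x.
Proof.
move=> uU h.
have Ux x : U x = ip (U e) e *: x.
  have := h _ (compact_ketbra x e) => /(congr1 (fun f => f (U e))).
  rewrite /Ad /= -[adj U (U e)]/((adj U \o U) e) (unitaryK hH) //=.
  by rewrite /ketbra ipee scale1r.
have c1 : `|ip (U e) e| == 1.
  have c1 := nr_unitary hH e uU; rewrite Ux nrZ e1 mulr1 in c1.
  by rewrite cnE /cn c1.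
move=> x; rewrite (@scalar_ofP U (Circle c1)) // => y; exact: Ux.
Qed.

End Representations.

(** * Equality of unitaries up to a scalar *)

Section Scalars.
Variables (R : realType) (H : completeNormedModType R[i]).
Variable ip : H -> H -> R[i].
Hypothesis hH : is_hilbert ip.
Implicit Types (T U V v w : H -> H) (c d : circle R).

Definition sc c T : H -> H := fun x => cval c *: T x.

Lemma sc0 T : sc 0 T = T.
Proof. by apply/funext => x; rewrite /sc scale1r. Qed.

Lemma scD c d T : sc c (sc d T) = sc (c + d) T.
Proof. by apply/funext => x; rewrite /sc scalerA. Qed.

Lemma scl c T U : sc c T \o U = sc c (T \o U). Proof. by []. Qed.

Lemma scr c T U : linear T -> T \o sc c U = sc c (T \o U).
Proof. by move=> lT; apply/funext => x; rewrite /sc /= linZ. Qed.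

Lemma unitary_lin v : unitary ip v -> linear v. Proof. by case. Qed.

Lemma unitary_cancel v T U : unitary ip v -> v \o T = v \o U -> T = U.
Proof.
move=> uv /(congr1 (fun f => adj ip v \o f)).
by rewrite -[LHS]/((adj ip v \o v) \o T) -[RHS]/((adj ip v \o v) \o U) (unitaryK hH).
Qed.

Variable e : H.
Hypothesis e1 : nr e = 1.

Lemma sc_inj c d v : unitary ip v -> sc c v = sc d v -> c = d.
Proof.
move=> uv /(congr1 (fun f => ip (f e) (v e))); rewrite /sc !(ipZl hH).
have -> : ip (v e) (v e) = 1 by rewrite (ipxx hH) (nr_unitary hH) // e1 expr1n.
by rewrite !mulr1; exact: val_inj.
Qed.

Lemma sc_ip c v : unitary ip v -> ip (sc c v e) (v e) = cval c.
Proof.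
move=> uv; rewrite /sc (ipZl hH).
by rewrite (ipxx hH) (nr_unitary hH) // e1 expr1n mulr1.
Qed.

Lemma scalar_ofE U v : unitary ip U -> unitary ip v ->
  (forall T, compact_op T -> Ad ip U T = Ad ip v T) -> U = sc (scalar_of (U \o adj ip v)) v.
Proof.
move=> uU uv h; have ua := unitary_adj hH uv.
have uUv := unitary_comp hH uU ua.
have h' T : compact_op T -> Ad ip (U \o adj ip v) T = T.
  move=> cT; rewrite (Ad_comp hH) // h ?(AdKV hH) //; exact: (Ad_compact hH).
have k := scalar_comm hH e1 uUv h'.
apply/funext => x; rewrite /sc -k /=.
by rewrite -[adj ip v (v x)]/((adj ip v \o v) x) (unitaryK hH).
Qed.

Lemma unitary_sc c v : unitary ip v -> unitary ip (sc c v).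
Proof.
move=> uv; have bv := unitary_bop hH uv; split.
- by move=> a x y; rewrite /sc (unitary_lin uv) scalerDr !scalerA mulrC.
- move=> y; have [_ h _] := uv; have [x hx] := h (cval (- c) *: y).
  by exists x; rewrite /sc hx scalerA -[_ * _]/(cval (c - c)) subrr scale1r.
- move=> x y; rewrite /sc (ipZl hH) (ipZr hH); have [_ _ ->] := uv.
  by rewrite mulrA -normCK circle_norm expr1n mul1r.
Qed.

Lemma opexpD1 v k : unitary ip v -> opexp ip v (k + 1) = v \o opexp ip v k.
Proof.
move=> uv; case: k => p; first by rewrite -PoszD addn1.
case: p => [|p]; first by rewrite /= -[RHS]/(v \o adj ip v) (unitaryKV hH).
have -> : Negz p.+1 + 1 = Negz p by rewrite !NegzE -addn1 PoszD opprD addrNK.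
by rewrite /= -[RHS]/((v \o adj ip v) \o iter p.+1 (adj ip v)) (unitaryKV hH).
Qed.

Lemma opexp_unitary v k : unitary ip v -> unitary ip (opexp ip v k).
Proof.
move=> uv; have it w p : unitary ip w -> unitary ip (iter p w).
  by move=> uw; elim: p => [|p ih]; [exact: (unitary_id ip)|exact: (unitary_comp hH uw ih)].
by case: k => p /=; [exact: it|exact: (it _ p.+1 (unitary_adj hH uv))].
Qed.

(** The downward step goes from k + 1 to k, so that applications cancel a unitary instead of
    computing with inverse powers. *)
Lemma int_step (P : int -> Prop) : P 0 -> (forall k, P k -> P (k + 1)) ->
  (forall k, P (k + 1) -> P k) -> forall k, P k.
Proof.
move=> P0 up down; case=> p.
  by elim: p => // p ih; rewrite -addn1 PoszD; exact: up.
elim: p => [|p ih]; apply: down; first by [].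
by have -> : Negz p.+1 + 1 = Negz p by rewrite !NegzE -addn1 PoszD opprD addrNK.
Qed.

Lemma opexpD v k l : unitary ip v -> opexp ip v (k + l) = opexp ip v k \o opexp ip v l.
Proof.
move=> uv; elim/int_step: k => [|k ih|k ih].
- by rewrite add0r.
- by rewrite addrAC !opexpD1 // ih.
- by apply: (unitary_cancel uv); rewrite -opexpD1 // addrAC ih opexpD1.
Qed.

Lemma opexp_commute U V c k : unitary ip U -> unitary ip V -> U \o V = sc c (V \o U) ->
  opexp ip U k \o V = sc (c *~ k) (V \o opexp ip U k).
Proof.
move=> uU uV h; have lU := unitary_lin uU; elim/int_step: k => [|k ih|k ih].
- by rewrite mulr0z sc0.
- rewrite opexpD1 // -[LHS]/(U \o (opexp ip U k \o V)) ih scr //.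
  rewrite -[U \o (V \o _)]/((U \o V) \o opexp ip U k) h scl scD.
  by rewrite mulrzDr mulr1z.
- apply: (unitary_cancel uU); rewrite scr //.
  rewrite -[U \o (V \o _)]/((U \o V) \o opexp ip U k) h scl scD.
  rewrite -[LHS]/((U \o opexp ip U k) \o V) -opexpD1 // ih opexpD1 //.
  by rewrite mulrzDr mulr1z.
Qed.

Lemma opexp_commute2 U V c k l : unitary ip U -> unitary ip V -> U \o V = sc c (V \o U) ->
  opexp ip U k \o opexp ip V l = sc (c *~ (k * l)) (opexp ip V l \o opexp ip U k).
Proof.
move=> uU uV h; have h1 := opexp_commute k uU uV h.
have h2 : V \o opexp ip U k = sc (- (c *~ k)) (opexp ip U k \o V).
  by rewrite h1 scD addNr sc0.
have := opexp_commute l uV (opexp_unitary k uU) h2 => h3.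
by rewrite h3 scD mulNrz -mulrzA addrN sc0.
Qed.

Section Powers.
Variables (n : nat) (v : 'I_n -> H -> H).
Hypothesis uv : forall k, unitary ip (v k).
Variable om : 'I_n -> 'I_n -> circle R.
Hypothesis hom : forall i j : 'I_n, (i < j)%N -> v j \o v i = sc (om i j) (v i \o v j).

(** [vpow] is the case of [index_enum]; an arbitrary list of indices allows induction. *)
Definition cprod (r : seq 'I_n) (m : 'rV[int]_n) : H -> H :=
  \big[(fun f g => f \o g)/id]_(k <- r) opexp ip (v k) (m 0 k).

Lemma cprod_unitary r m : unitary ip (cprod r m).
Proof.
elim: r => [|k r ih]; first by rewrite /cprod big_nil; exact: (unitary_id ip).
by rewrite /cprod big_cons; exact: (unitary_comp hH (opexp_unitary _ (uv k)) ih).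
Qed.

Lemma cprod_cons k r m : cprod (k :: r) m = opexp ip (v k) (m 0 k) \o cprod r m.
Proof. by rewrite /cprod big_cons. Qed.

Lemma cprod_commute (k : 'I_n) r m (b : int) : all (fun j : 'I_n => (k < j)%N) r ->
  cprod r m \o opexp ip (v k) b =
  sc (\sum_(j <- r) om k j *~ (b * m 0 j)) (opexp ip (v k) b \o cprod r m).
Proof.
elim: r => [|j r ih] /=; first by rewrite /cprod !big_nil sc0.
move=> /andP[kj /ih E]; have lj := unitary_lin (opexp_unitary (m 0 j) (uv j)).
rewrite cprod_cons -[LHS]/(opexp ip (v j) (m 0 j) \o (cprod r m \o opexp ip (v k) b)) E scr //.
rewrite -[opexp ip (v j) _ \o _]/((opexp ip (v j) (m 0 j) \o opexp ip (v k) b) \o cprod r m).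
rewrite (opexp_commute2 _ _ (uv j) (uv k) (hom kj)) scl scD big_cons.
by congr (sc _ _); rewrite addrC mulrC.
Qed.

(** Each power v_k^(m'_k) of the second factor moves left past the powers v_j^(m_j) of the first
    with j > k, which costs m'_k m_j times om k j. Sortedness of r ensures that it crosses no
    others. *)
Lemma cprodM r m m' : sorted (fun i j : 'I_n => (i < j)%N) r ->
  cprod r m \o cprod r m' =
  sc (\sum_(i <- r) \sum_(j <- r | (i < j)%N) om i j *~ (m' 0 i * m 0 j)) (cprod r (m + m')).
Proof.
elim: r => [|k r ih] /=; first by rewrite /cprod !big_nil sc0.
rewrite path_sortedE; last by move=> a b c; exact: ltn_trans.
move=> /andP[kr /ih E]; have lk := unitary_lin (opexp_unitary (m 0 k) (uv k)).
have lk' := unitary_lin (opexp_unitary (m' 0 k) (uv k)).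
rewrite !cprod_cons.
rewrite -[LHS]/(opexp ip (v k) (m 0 k) \o ((cprod r m \o opexp ip (v k) (m' 0 k)) \o cprod r m')).
rewrite cprod_commute // scl scr //.
rewrite -[opexp _ _ _ \o _]/(opexp ip (v k) (m 0 k) \o (opexp ip (v k) (m' 0 k) \o (cprod r m \o cprod r m'))).
rewrite E !scr // scD mxE opexpD //.
rewrite -[opexp _ _ _ \o _]/(opexp ip (v k) (m 0 k) \o opexp ip (v k) (m' 0 k) \o cprod r (m + m')).
congr (sc _ _); rewrite !big_cons ltnn; congr (_ + _).
  by rewrite big_seq_cond [RHS]big_seq_cond; apply: eq_bigl => j; case: (boolP (j \in r)) => //= /(allP kr) ->.
rewrite big_seq_cond [RHS]big_seq_cond; apply: eq_bigr => i; rewrite andbT => /(allP kr) ki.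
by rewrite big_cons ltnNge (ltnW ki).
Qed.

Lemma sorted_enum_ord : sorted (fun i j : 'I_n => (i < j)%N) (index_enum 'I_n).
Proof.
have -> : index_enum 'I_n = enum 'I_n by rewrite enumT; unlock index_enum.
by have := iota_ltn_sorted 0 n; rewrite -val_enum_ord sorted_map.
Qed.

Lemma powM m m' :
  cprod (index_enum _) m \o cprod (index_enum _) m' =
  sc (\sum_(i < n) \sum_(j < n | (i < j)%N) om i j *~ (m' 0 i * m 0 j)) (cprod (index_enum _) (m + m')).
Proof. exact: cprodM sorted_enum_ord. Qed.

Lemma cprod_delta r k : uniq r -> cprod r (delta_mx 0 k) = if k \in r then v k else id.
Proof.
elim: r => [|j r ih] /=; first by rewrite /cprod big_nil.
move=> /andP[jr /ih E]; rewrite cprod_cons E mxE eqxx in_cons eq_sym /=.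
by have [<-|kj] := eqVneq j k; [rewrite (negbTE jr)|].
Qed.

Lemma pow_delta k : cprod (index_enum _) (delta_mx 0 k) = v k.
Proof. by rewrite cprod_delta ?index_enum_uniq // mem_index_enum. Qed.

End Powers.

Lemma cprod_scale n (v w : 'I_n -> H -> H) u (psi : 'I_n -> circle R) r m :
  unitary ip u -> (forall k, unitary ip (v k)) -> (forall k, unitary ip (w k)) ->
  (forall k, w k \o u = sc (psi k) (u \o v k)) ->
  cprod w r m \o u = sc (\sum_(k <- r) psi k *~ m 0 k) (u \o cprod v r m).
Proof.
move=> uu uv uw h.
have pw k (b : int) : opexp ip (w k) b \o u = sc (psi k *~ b) (u \o opexp ip (v k) b).
  have lw := unitary_lin (uw k); elim/int_step: b => [|b ih|b ih].
  - by rewrite mulr0z sc0.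
  - rewrite !opexpD1 // -[LHS]/(w k \o (opexp ip (w k) b \o u)) ih scr //.
    rewrite -[w k \o _]/((w k \o u) \o opexp ip (v k) b) h scl scD.
    by rewrite mulrzDr mulr1z.
  - apply: (unitary_cancel (uw k)); rewrite scr //.
    rewrite -[w k \o (u \o _)]/((w k \o u) \o opexp ip (v k) b) h scl scD.
    rewrite -[LHS]/((w k \o opexp ip (w k) b) \o u) -opexpD1 // ih opexpD1 //.
    by rewrite mulrzDr mulr1z.
elim: r => [|k r ih]; first by rewrite /cprod !big_nil sc0.
rewrite !cprod_cons big_cons -[LHS]/(opexp ip (w k) (m 0 k) \o (cprod w r m \o u)) ih.
rewrite scr; last exact: unitary_lin (opexp_unitary _ (uw k)).
rewrite -[opexp ip (w k) _ \o _]/((opexp ip (w k) (m 0 k) \o u) \o cprod v r m) pw scl scD.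
by congr (sc _ _); rewrite addrC.
Qed.

Section StrongContinuity.
Variable Y : topologicalType.

Definition scont (U : Y -> H -> H) (y : Y) : Prop := forall x : H, (fun z => U z x) @ y --> U y x.

Lemma scont_comp (U V : Y -> H -> H) y : (\forall z \near y, unitary ip (U z)) ->
  scont U y -> scont V y -> scont (fun z => U z \o V z) y.
Proof.
move=> uU cU cV x; apply/cvg_nrP => d d0; have d2 : 0 < d / 2 by rewrite divr_gt0.
have /cvg_nrP/(_ _ d2) h1 := cU (V y x); have /cvg_nrP/(_ _ d2) h2 := cV x.
apply: filterS (filterI uU (filterI h1 h2)) => z [uz [a1 a2]] /=.
rewrite (le_lt_trans (nr_tri _ (U z (V y x)) _)) // [ltRHS]splitr ltrD //.
by case: (uz) => lu _ _; rewrite -linB // (nr_unitary hH _ uz).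
Qed.

(** Taking adjoints is strongly continuous on unitaries: with w the image of x under the adjoint of
    U y, applying the isometry U z turns the difference of the two adjoints at x into x - U z w = U
    y w - U z w. *)
Lemma scont_adj (U : Y -> H -> H) y : (\forall z \near y, unitary ip (U z)) ->
  scont U y -> scont (fun z => adj ip (U z)) y.
Proof.
move=> uU cU x; have uy := nbhs_singleton uU.
apply/cvg_nrP => d d0; have /cvg_nrP/(_ _ d0) h1 := cU (adj ip (U y) x).
apply: filterS (filterI uU h1) => z [uz a1].
rewrite -(nr_unitary hH _ uz) linB; last by case: uz.
rewrite -[U z (adj ip (U z) x)]/((U z \o adj ip (U z)) x) (unitaryKV hH) //=.
rewrite nrB; move: a1; rewrite -[U y _]/((U y \o adj ip (U y)) x) (unitaryKV hH) //.
Qed.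

Lemma scont_opexp (U : Y -> H -> H) y k : (\forall z \near y, unitary ip (U z)) ->
  scont U y -> scont (fun z => opexp ip (U z) k) y.
Proof.
move=> uU cU.
have it (V : Y -> H -> H) p : (\forall z \near y, unitary ip (V z)) -> scont V y ->
    scont (fun z => iter p (V z)) y.
  move=> uV cV; elim: p => [|p ih]; first by move=> x; exact: cvg_cst.
  exact: (@scont_comp V (fun z => iter p (V z))).
case: k => p; first exact: it.
apply: (@it (fun z => adj ip (U z)) p.+1); last exact: scont_adj.
by apply: filterS uU => z uz; exact: (unitary_adj hH).
Qed.

Lemma scont_cprod n (v : Y -> 'I_n -> H -> H) r m y :
  (\forall z \near y, forall k, unitary ip (v z k)) ->
  (forall k, scont (fun z => v z k) y) -> scont (fun z => cprod (v z) r m) y.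
Proof.
move=> uv cv; elim: r => [|k r ih].
  by rewrite /cprod => x; under eq_fun do rewrite big_nil; rewrite big_nil; exact: cvg_cst.
rewrite (_ : (fun z => cprod (v z) (k :: r) m) = fun z => opexp ip (v z k) (m 0 k) \o cprod (v z) r m); last first.
  by apply/funext => z; rewrite cprod_cons.
apply: scont_comp => //.
  by apply: filterS uv => z uz; apply: opexp_unitary.
by apply: scont_opexp => //; apply: filterS uv => z uz.
Qed.

(** The scalar is recovered as the inner product of U z e and V z e ([sc_ip]), which depends
    continuously on z. All continuity of the cochains rests on this. *)
Lemma scont_scalar (c : Y -> circle R) (U V : Y -> H -> H) y :
  (\forall z \near y, unitary ip (V z) /\ U z = sc (c z) (V z)) ->
  scont U y -> scont V y -> (fun z => cval (c z) : R[i]^o) @ y --> (cval (c y) : R[i]^o).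
Proof.
move=> h cU cV; have [uy Uy] := nbhs_singleton h.
apply/cvg_nrP => d d0; have d2 : 0 < d / 2 by rewrite divr_gt0.
have /cvg_nrP/(_ _ d2) h1 := cU e; have /cvg_nrP/(_ _ d2) h2 := cV e.
apply: filterS (filterI h (filterI h1 h2)) => z [[uz Uz] [a1 a2]].
rewrite -(sc_ip _ uz) -Uz -(sc_ip _ uy) -Uy.
have -> : ip (U z e) (V z e) - ip (U y e) (V y e) =
    ip (U z e - U y e) (V z e) + ip (U y e) (V z e - V y e).
  by rewrite (ipBl hH) (ipBr hH) addrA subrK.
have n1 : nr (V z e) = 1 by rewrite (nr_unitary hH).
have n2 : nr (U y e) = 1 by rewrite Uy (nr_unitary hH) //; exact: unitary_sc.
rewrite (le_lt_trans (@nrD _ R[i]^o _ _)) // [ltRHS]splitr ltrD //.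
  by rewrite (le_lt_trans (cauchy_schwarz hH _ _)) // n1 mulr1.
by rewrite (le_lt_trans (cauchy_schwarz hH _ _)) // n2 mul1r.
Qed.

End StrongContinuity.

End Scalars.

Section CechValues.
Variables (I : Type) (Z : Type) (V : zmodType) (phi : seq I -> Z -> V).

Lemma cech1 a z : cech phi [:: a] z = phi [::] z.
Proof. by rewrite /cech !big_ord_recl big_ord0 /= addr0. Qed.

Lemma cech2 a b z : cech phi [:: a; b] z = phi [:: b] z - phi [:: a] z.
Proof. by rewrite /cech !big_ord_recl big_ord0 /= addr0 expr1 mulrNz. Qed.

Lemma cech3 a b c z :
  cech phi [:: a; b; c] z = phi [:: b; c] z - phi [:: a; c] z + phi [:: a; b] z.
Proof.
rewrite /cech !big_ord_recl big_ord0 /= addr0 expr1 mulrNz addrA.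
by rewrite /bump /= expr2 mulrNN.
Qed.

Lemma cech4 a b c d z : cech phi [:: a; b; c; d] z =
  phi [:: b; c; d] z - phi [:: a; c; d] z + phi [:: a; b; d] z - phi [:: a; b; c] z.
Proof.
rewrite /cech !big_ord_recl big_ord0 /= addr0 /bump /= !addrA.
by rewrite !addn0 (_ : (-1) ^+ (1 + 1) = 1 :> int) // (_ : (-1) ^+ (1 + (1 + 1)) = -1 :> int) //.
Qed.

End CechValues.

(** * The scalar identities behind the cocycle and coboundary equations *)

Section ScalarRelations.
Variables (R : realType) (H : completeNormedModType R[i]).
Variable ip : H -> H -> R[i].
Hypothesis hH : is_hilbert ip.
Variable e : H.
Hypothesis e1 : nr e = 1.
Implicit Types (T U V : H -> H).

Lemma compA T U V : T \o U \o V = T \o (U \o V). Proof. by []. Qed.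

(* An equation [T = sc c U] is read as an arrow from T to U labelled by c,
   which can be whiskered, composed and inverted; two arrows with the same ends
   have the same label. *)
Lemma scrw c T U V : unitary ip V -> T = sc c U -> V \o T = sc c (V \o U).
Proof. by move=> uV ->; rewrite (scr _ _ (unitary_lin uV)). Qed.

Lemma sclw c T U V : T = sc c U -> T \o V = sc c (U \o V).
Proof. by move=> ->. Qed.

Lemma sctr c d T U V : T = sc c U -> U = sc d V -> T = sc (c + d) V.
Proof. by move=> -> ->; rewrite scD. Qed.

Lemma scsym c T U : T = sc c U -> U = sc (- c) T.
Proof. by move=> ->; rewrite scD addNr sc0. Qed.

Lemma scuniq c d T U : unitary ip U -> T = sc c U -> T = sc d U -> c = d.
Proof. by move=> uU -> /(sc_inj hH e1 uU). Qed.

Variable n : nat.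
Local Notation W := (fun v : 'I_n -> H -> H => cprod ip v (index_enum _)).

Definition twisted (om : 'I_n -> 'I_n -> circle R) (v : 'I_n -> H -> H) : Prop :=
  forall i j : 'I_n, (i < j)%N -> v j \o v i = sc (om i j) (v i \o v j).

(* The 2-cocycle of the projective representation m |-> v^m. *)
Definition mu (om : 'I_n -> 'I_n -> circle R) (m m' : 'rV[int]_n) : circle R :=
  \sum_(i < n) \sum_(j < n | (i < j)%N) om i j *~ (m' 0 i * m 0 j).

Lemma muNl om m m' : mu om (- m) m' = - mu om m m'.
Proof.
rewrite /mu -sumrN; apply: eq_bigr => i _; rewrite -sumrN; apply: eq_bigr => j _.
by rewrite mxE mulrN mulrNz.
Qed.

Lemma muNr om m m' : mu om m (- m') = - mu om m m'.
Proof.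
rewrite /mu -sumrN; apply: eq_bigr => i _; rewrite -sumrN; apply: eq_bigr => j _.
by rewrite mxE mulNr mulrNz.
Qed.

Section OnePair.
Variables (va vb : 'I_n -> H -> H) (T : H -> H).
Hypothesis (ua : forall k, unitary ip (va k)) (ub : forall k, unitary ip (vb k)).
Hypothesis uT : unitary ip T.

(** Commutators do not see the scalars chi by which T fails to intertwine the generators. Used both
    for closedness of phi^02 on overlaps and for its independence of the choices. *)
Lemma twist_eq oa ob chi : twisted oa va -> twisted ob vb ->
  (forall k, vb k \o T = sc (chi k) (T \o va k)) ->
  forall i j : 'I_n, (i < j)%N -> ob i j = oa i j.
Proof.
move=> ha hb h i j ij.
have P k l : vb k \o vb l \o T = sc (chi k + chi l) (T \o (va k \o va l)).
  rewrite compA [in RHS]addrC; apply: (sctr (scrw (ub k) (h l))).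
  exact: sclw (h k).
have h1 := sctr (P j i) (scrw uT (ha i j ij)).
have h2 := sctr (sclw T (hb i j ij)) (P i j).
have := scuniq (unitary_comp hH uT (unitary_comp hH (ua i) (ua j))) h1 h2.
by rewrite [RHS]addrC (addrC (chi j)) => /addrI.
Qed.

(** Both projective representations have the same multiplier [mu], because they share [om]; it
    cancels when chi (m + m') is computed from chi m and chi m'. *)
Lemma chi_add om chi : twisted om va -> twisted om vb ->
  (forall m, W vb m \o T = sc (chi m) (T \o W va m)) -> {morph chi : m m' / m + m'}.
Proof.
move=> ha hb h m m'.
have h1 := sctr (scsym (sclw T (powM hH ub hb m m'))) (sctr (scrw (cprod_unitary hH ub _ m) (h m'))
  (sctr (sclw _ (h m)) (scrw uT (powM hH ua ha m m')))).
have := scuniq (unitary_comp hH uT (cprod_unitary hH ua _ _)) (h (m + m')) h1.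
by move=> ->; rewrite addrC addrA addrK addrC.
Qed.

End OnePair.

(* The two ways of moving W_c^m to the right of T_bc T_ab. *)
Lemma chi_cocycle va vb vc Tab Tbc Tac om cab cbc cac k F m :
  (forall k, unitary ip (va k)) -> (forall k, unitary ip (vb k)) -> (forall k, unitary ip (vc k)) ->
  unitary ip Tab -> unitary ip Tbc -> unitary ip Tac -> twisted om va ->
  W vb m \o Tab = sc (cab m) (Tab \o W va m) ->
  W vc m \o Tbc = sc (cbc m) (Tbc \o W vb m) ->
  W vc m \o Tac = sc (cac m) (Tac \o W va m) ->
  Tbc \o Tab = sc k (Tac \o W va (- F)) ->
  cbc m - cac m + cab m = mu om m (- F) - mu om (- F) m.
Proof.
move=> ua ub uc uab ubc uac ha hab hbc hac hk.
have h1 := sctr (sclw Tab hbc) (sctr (scrw ubc hab) (sctr (sclw (W va m) hk)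
  (scrw uac (powM hH ua ha (- F) m)))).
have h2 := sctr (scrw (cprod_unitary hH uc _ m) hk) (sctr (sclw (W va (- F)) hac)
  (scrw uac (powM hH ua ha m (- F)))).
rewrite (addrC m) in h2.
have := scuniq (unitary_comp hH uac (cprod_unitary hH ua _ _)) h1 h2.
rewrite -!/(mu _ _ _) (addrCA (cab m)) (addrCA (cbc m)) => /addrI E.
by rewrite -[mu om m _](addKr (cac m)) -E !addrA addrK [LHS](ACl (2*1*3)).
Qed.

(* The two ways of composing T_cd T_bc T_ab. *)
Lemma kappa_cocycle va vb Tab Tac Tad Tbc Tbd Tcd om cab kabc kabd kacd kbcd Fabc Fabd Facd Fbcd :
  (forall k, unitary ip (va k)) -> (forall k, unitary ip (vb k)) ->
  unitary ip Tab -> unitary ip Tad -> unitary ip Tbd -> unitary ip Tcd -> twisted om va ->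
  W vb (- Fbcd) \o Tab = sc (cab (- Fbcd)) (Tab \o W va (- Fbcd)) ->
  Tbc \o Tab = sc kabc (Tac \o W va (- Fabc)) ->
  Tbd \o Tab = sc kabd (Tad \o W va (- Fabd)) ->
  Tcd \o Tac = sc kacd (Tad \o W va (- Facd)) ->
  Tcd \o Tbc = sc kbcd (Tbd \o W vb (- Fbcd)) ->
  Facd + Fabc = Fabd + Fbcd ->
  kbcd - kacd + kabd - kabc = - cab (- Fbcd) + mu om Facd Fabc - mu om Fabd Fbcd.
Proof.
move=> ua ub uab uad ubd ucd ha hx habc habd hacd hbcd hF.
have h1 := sctr (scrw ucd habc) (sctr (sclw (W va (- Fabc)) hacd)
  (scrw uad (powM hH ua ha (- Facd) (- Fabc)))).
have h2 := sctr (sclw Tab hbcd) (sctr (scrw ubd hx) (sctr (sclw (W va (- Fbcd)) habd)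
  (scrw uad (powM hH ua ha (- Fabd) (- Fbcd))))).
rewrite -opprD -hF opprD in h2.
have := scuniq (unitary_comp hH uad (cprod_unitary hH ua _ _)) h1 h2.
rewrite -!/(mu _ _ _) !muNl !muNr !opprK => E.
rewrite -[mu om Facd _](addKr kacd) -[kacd + _](addKr kabc) E !addrA addrK.
by rewrite [RHS](ACl (1*5*4*2*6*3)) /= addNr add0r.
Qed.

(** The two ways of bringing W' m T' ua to a multiple of ub T W m: first exchange T' with T, or
    first move W' past T'. The scalar t occurs in both and cancels. *)
Lemma chi_cobound va vb va' vb' T T' ua ub chi chi' Pa Pb t m :
  (forall k, unitary ip (va k)) ->
  (forall k, unitary ip (vb' k)) ->
  unitary ip T -> unitary ip T' -> unitary ip ua -> unitary ip ub ->
  W va' m \o ua = sc (Pa m) (ua \o W va m) ->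
  W vb' m \o ub = sc (Pb m) (ub \o W vb m) ->
  T' \o ua = sc t (ub \o T) ->
  W vb m \o T = sc (chi m) (T \o W va m) ->
  W vb' m \o T' = sc (chi' m) (T' \o W va' m) ->
  chi' m = chi m + (Pb m - Pa m) :> circle R.
Proof.
move=> uva uvb uT uT' uua uub ha hb ht h h'.
have h1 := sctr (scrw (cprod_unitary hH uvb _ m) ht) (sctr (sclw T hb) (scrw uub h)).
have h2 := sctr (sclw ua h') (sctr (scrw uT' ha) (sclw (W va m) ht)).
have := scuniq (unitary_comp hH uub (unitary_comp hH uT (cprod_unitary hH uva _ _))) h1 h2 => E.
rewrite -[LHS](addrK (Pa m + t)) -E opprD !addrA.
by rewrite [LHS](ACl (3*2*4*1*5)) /= addrK.
Qed.

(** The two ways of bringing T'_bc T'_ab ua to a multiple of uc T_ac W (- F). The term - P (- F)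
    becomes the cup product of the comparison cochain with F once P is additive. *)
Lemma kappa_cobound va va' Tab Tbc Tac Tab' Tbc' Tac' ua ub uc k k' P tab tbc tac F :
  (forall k, unitary ip (va k)) ->
  unitary ip Tac -> unitary ip Tac' -> unitary ip Tbc' -> unitary ip uc ->
  W va' (- F) \o ua = sc (P (- F)) (ua \o W va (- F)) ->
  Tab' \o ua = sc tab (ub \o Tab) ->
  Tbc' \o ub = sc tbc (uc \o Tbc) ->
  Tac' \o ua = sc tac (uc \o Tac) ->
  Tbc \o Tab = sc k (Tac \o W va (- F)) ->
  Tbc' \o Tab' = sc k' (Tac' \o W va' (- F)) ->
  k' = k + (tbc - tac + tab - P (- F)) :> circle R.
Proof.
move=> uva uT uT' ubc uuc ha hab hbc hac h h'.
have h1 := sctr (scrw ubc hab) (sctr (sclw Tab hbc) (scrw uuc h)).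
have h2 := sctr (sclw ua h') (sctr (scrw uT' ha) (sclw (W va (- F)) hac)).
have := scuniq (unitary_comp hH uuc (unitary_comp hH uT (cprod_unitary hH uva _ _))) h1 h2 => E.
rewrite -[LHS](addrK (P (- F) + tac)) -E opprD !addrA.
by rewrite [LHS](ACl (3*2*5*1*4)).
Qed.

End ScalarRelations.

(** * Fibres of continuous trace algebras *)

Section Bumps.
Variable R : realType.

(** Complete regularity and local compactness in one: cut-off functions with compact support.
    Together with the Hausdorff property this is the form in which the manifold structure of X
    enters the analysis of the algebras. *)
Definition bump_space (X : topologicalType) := forall (U : set X) x, open U -> U x ->
  exists h : X -> R, [/\ continuous h, h x = 1, forall y, 0 <= h y <= 1 &
    exists K, [/\ compact K, K `<=` U & forall y, h y != 0 -> K y]].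

Lemma within_open_cvg (X Y : topologicalType) (U : set X) (f : X -> Y) x :
  open U -> {within U, continuous f} -> U x -> f @ x --> f x.
Proof. by move=> oU; rewrite continuous_open_subspace // => cf Ux; apply: cf; rewrite inE. Qed.

Lemma within_openI (X Y : topologicalType) (U : set X) (f : X -> Y) :
  open U -> (forall x, U x -> f @ x --> f x) -> {within U, continuous f}.
Proof. by move=> oU h; rewrite continuous_open_subspace // => x; rewrite inE; exact: h. Qed.

Lemma rV_ballP d (v w : 'rV[R]_d) (e : R) : 0 < e ->
  ball v e w <-> forall i, `|v ord0 i - w ord0 i| < e.
Proof.
move=> e0; split=> [[_ h] i|h]; first exact: (h ord0 i).
by split => // i j; rewrite ord1; exact: h.
Qed.

Lemma rV_bump d (W : set 'rV[R]_d) v : open W -> W v ->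
  exists b : 'rV[R]_d -> R, [/\ continuous b, b v = 1, forall w, 0 <= b w <= 1 &
    exists K, [/\ compact K, K `<=` W & forall w, b w != 0 -> K w]].
Proof.
move=> oW Wv; have /nbhs_ballP[e /= e0 he] : nbhs v W by exact: open_nbhs_nbhs.
(* Balls of the maximum norm are cubes. Halving the radius puts the closed cube, which contains the
   support of the tent function, inside W. *)
pose r := e / 2; have r0 : 0 < r by rewrite divr_gt0.
exists (fun w => Num.max 0 (1 - `|v - w| / r)); split.
- have ct : continuous (fun w : 'rV[R]_d => 1 - `|v - w| / r).
    move=> w P /nbhs_ballP[d' /= d0 hP]; apply/nbhs_ballP; exists (d' * r) => /=.
      by rewrite mulr_gt0.
    move=> w'; rewrite -ball_normE /= => h; apply: hP; rewrite -ball_normE /=.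
    rewrite (_ : _ - _ = (`|v - w'| - `|v - w|) / r); last by ring.
    rewrite normrM (ger0_norm (x := r^-1)) ?invr_ge0 ?(ltW r0) // ltr_pdivrMr //.
    rewrite (le_lt_trans (ler_dist_dist _ _)) // (_ : _ - _ = w - w') //.
    by rewrite opprB addrC -addrA addKr addrC.
  have cm : continuous (fun t : R => Num.max 0 t).
    rewrite (_ : (fun t => _) = fun t : R => (0 + t + `|0 - t|) / 2); last first.
      by apply/funext => t; rewrite maxr_absE.
    move=> t; apply: cvgM; last exact: cvg_cst.
    apply: cvgD; first by apply: cvgD; [exact: cvg_cst|exact: cvg_id].
    by apply: cvg_norm; apply: cvgB; [exact: cvg_cst|exact: cvg_id].
  by move=> w; exact: (cvg_comp _ _ (ct w) (cm _)).
- by rewrite subrr normr0 mul0r subr0 max_r.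
- move=> w; rewrite le_max lexx /= ge_max ler01 /= gerBl.
  by rewrite divr_ge0 // ltW.
- exists [set w | forall i, `[v ord0 i - r, v ord0 i + r]%classic (w ord0 i)]; split.
  + apply: (@rV_compact _ d (fun i => `[v ord0 i - r, v ord0 i + r]%classic)) => i.
    exact: segment_compact.
  + move=> w hw; apply: he; apply/(rV_ballP _ _ e0) => i.
    have := hw i; rewrite /= in_itv /= -ler_distl distrC => h.
    by rewrite (le_lt_trans h) // /r ltr_pdivrMr // ltr_pMr // ltr1n.
  + move=> w; have [vw|vw] := ltP `|v - w| r.
      move=> _ i; rewrite /= in_itv /= -ler_distl distrC ltW //.
      have : ball v r w by rewrite -ball_normE.
      by move=> /(rV_ballP _ _ r0).
    by rewrite max_l ?eqxx // subr_le0 ler_pdivlMr // mul1r.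
Qed.

(** A tent function in a chart, extended by zero. Continuity of the extension off the chart holds
    because the compact set C containing its support is closed in a Hausdorff space. *)
Lemma manifold_bump d (M : mfd R d) : is_manifold M -> bump_space M.
Proof.
move=> [hM _ chM chartM _] U x oU Ux.
have [c ac cx] := chM x; have [[oc oc'] cc ci cK] := chartM c ac.
pose W := cmap c @` (cdom c `&` U).
have oW : open W.
  rewrite openE => _ [y [cy Uy] <-]; rewrite /interior.
  have ccy : (cmap c @` cdom c) (cmap c y) by exists y.
  have h := within_open_cvg oc' ci ccy; rewrite cK // in h.
  have h1 : \forall w \near cmap c y, (cdom c `&` U) (cinv c w).
    by apply: h; apply: open_nbhs_nbhs; split; [exact: openI|].
  apply: filterS (filterI h1 (open_nbhs_nbhs (conj oc' ccy))).
  by move=> w [/= [h2 h3] [z cz zw]]; exists z => //; split => //; move: h3; rewrite -zw cK.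
have [|b [cb bv b01 [K [cK' KW bK]]]] := rV_bump oW (v := cmap c x); first by exists x.
pose h y := if `[< cdom c y >] then b (cmap c y) else 0.
pose C := cinv c @` K.
have cC : compact C.
  apply: continuous_compact => //; apply: continuous_subspaceW ci.
  by move=> w /KW[y [cy _] <-]; exists y.
have CU : C `<=` cdom c `&` U.
  by move=> _ [w /KW[y [cy Uy] <-] <-]; rewrite cK.
have hC y : h y != 0 -> C y.
  rewrite /h; case: asboolP => [cy /bK Ky|]; last by rewrite eqxx.
  by exists (cmap c y) => //; rewrite cK.
exists h; split.
- move=> y; have [Cy|nCy] := pselect (C y).
    have [cy Uy] := CU y Cy.
    have e : \forall z \near y, b (cmap c z) = h z.
      by apply: filterS (open_nbhs_nbhs (conj oc cy)) => z cz; rewrite /h asboolT.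
    apply: cvg_trans (near_eq_cvg e) _.
    rewrite /h asboolT //; apply: (cvg_comp _ _ (within_open_cvg oc cc cy)).
    exact: cb.
  have hy : h y = 0 by apply/eqP; apply: contraPT nCy => /hC ? /(_ _).
  rewrite /continuous_at hy; apply: (@cvg_trans _ ((fun=> 0) @ y)); last exact: cvg_cst.
  apply: near_eq_cvg.
  have oC : open (~` C) by apply: closed_openC; exact: compact_closed.
  apply: filterS (open_nbhs_nbhs (conj oC nCy)) => z nCz.
  by apply/esym/eqP; apply: contraPT nCz => /hC ? /(_ _).
- by rewrite /h asboolT.
- by move=> y; rewrite /h; case: asboolP => // _; rewrite lexx ler01.
- by exists C; split => // y /CU[].
Qed.

End Bumps.

(** * Functions vanishing at infinity *)

Section C0.
Variables (R : realType) (X : topologicalType).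
Hypothesis hX : hausdorff_space X.
Implicit Types (f g : X -> R[i]) (U : set X).

Lemma cont_nrP (V : normedModType R[i]) (f : X -> V) x :
  f @ x --> f x <-> forall e : R, 0 < e -> \forall y \near x, nr (f y - f x) < e.
Proof. exact: cvg_nrP. Qed.

Lemma cont_real (h : X -> R) : continuous h -> continuous (fun x => (h x)%:C : R[i]^o).
Proof.
move=> ch x; apply/cont_nrP => e e0.
have /cvgrPdist_lt/(_ _ e0) := ch x; apply: filterS => y.
by rewrite -rmorphB /= /nr normc_def /= expr0n addr0 sqrtr_sqr distrC.
Qed.

Lemma cn_continuous f x : ((f : X -> R[i]^o) @ x --> (f x : R[i]^o)) ->
  (fun y => cn (f y)) @ x --> cn (f x).
Proof.
move=> /cont_nrP cf; apply/cvgrPdist_lt => e e0; apply: filterS (cf _ e0) => y h.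
rewrite distrC; exact: le_lt_trans (nr_dist _ _) h.
Qed.

Lemma C0_supp U f (e : R) : C0 U f -> 0 < e -> compact [set x | e <= cn (f x)].
Proof.
move=> [_ f0 cf] e0; have := cf e%:C; rewrite ltcR => /(_ e0).
congr compact; apply/seteqP; split=> x /=; first by case=> _; rewrite cnE lecR.
move=> h; rewrite cnE lecR; split=> //; apply: contrapT => /f0 fx.
by move: h; rewrite fx /cn normr0 leNgt e0.
Qed.

(** The definition of [C0] asks for continuity inside U only. At a point outside U, where f is 0,
    the complement of the compact, hence closed, set where |f| >= e is a neighbourhood. *)
Lemma C0_cont U f : open U -> C0 U f -> continuous (f : X -> R[i]^o).
Proof.
move=> oU hf x; have [Ux|nUx] := pselect (U x).
  by case: hf => cf _ _; exact: within_open_cvg cf Ux.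
have fx : f x = 0 by case: hf => _ + _; exact.
apply/cont_nrP => e e0.
have oK : open (~` [set x | e <= cn (f x)]).
  by apply: closed_openC; apply: compact_closed => //; exact: C0_supp hf e0.
have nx : (~` [set x | e <= cn (f x)]) x by rewrite /= fx /cn normr0; apply/negP; rewrite -ltNge.
apply: filterS (open_nbhs_nbhs (conj oK nx)) => y /= /negP.
by rewrite -ltNge fx subr0.
Qed.

Lemma C0_off U f x : C0 U f -> ~ U x -> f x = 0. Proof. by case=> _ + _; exact. Qed.

Lemma C0I U f : continuous (f : X -> R[i]^o) -> (forall x, ~ U x -> f x = 0) ->
  (forall e : R, 0 < e -> exists2 K, compact K & forall x, e <= cn (f x) -> K x) -> C0 U f.
Proof.
move=> cf f0 h; split=> //; first exact: continuous_subspaceT.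
move=> e e0; have e0' : 0 < complex.Re e by rewrite -ltcR -ge0_complexE // ltW.
have [K cK hK] := h _ e0'.
rewrite (_ : U `&` _ = [set x | complex.Re e <= cn (f x)]); last first.
  apply/seteqP; split=> x /=; first by case=> _; rewrite cnE (ge0_complexE (ltW e0)) lecR.
  move=> hx; rewrite cnE (ge0_complexE (ltW e0)) lecR; split=> //; apply: contrapT => /f0 fx.
  by move: hx; rewrite fx /cn normr0 leNgt e0'.
apply: (subclosed_compact _ cK) => //.
have -> : [set x | complex.Re e <= cn (f x)] = (fun x => cn (f x)) @^-1` [set t | complex.Re e <= t] by [].
apply: preimage_closed; last exact: closed_ge.
by move=> x _; apply: cn_continuous; exact: cf.
Qed.

Lemma C0_Cb U f : open U -> C0 U f -> Cb f.
Proof.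
move=> oU hf; have cf := C0_cont oU hf; split => //.
have cK := C0_supp hf ltr01.
have : compact ((fun x => cn (f x)) @` [set x | 1 <= cn (f x)]).
  apply: continuous_compact => //; apply: continuous_subspaceT => x.
  by apply: cn_continuous; exact: cf.
move=> /compact_bounded[M [_ hM]].
pose M' := Num.max 1 (M + 1); exists M'%:C => x; rewrite cnE lecR /M' le_max.
case: (lerP (cn (f x)) 1) => //= h.
have : `|cn (f x)| <= M + 1.
  by apply: hM; [rewrite ltrDl|exists x => //=; rewrite ltW].
by rewrite ger0_norm // cn_ge0.
Qed.

Lemma CbM f g : Cb f -> Cb g -> Cb (fun x => f x * g x).
Proof.
move=> [cf [M hM]] [cg [N hN]]; split.
  by move=> x; apply: (@cvgM R[i]); [exact: cf|exact: cg].
by exists (M * N) => x; rewrite normrM ler_pM.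
Qed.

Lemma Cb_conj f : Cb f -> Cb (fun x => Num.conj (f x)).
Proof.
move=> [cf [M hM]]; split; last by exists M => x; rewrite norm_conjC.
move=> x; apply/cont_nrP => e e0; have /cont_nrP := cf x => /(_ _ e0).
by apply: filterS => y; rewrite -rmorphB /nr norm_conjC.
Qed.

Lemma Cb_comp (t : X -> X) f : continuous t -> Cb f -> Cb (fun x => f (t x)).
Proof.
move=> ct [cf [M hM]]; split; last by exists M.
by move=> x; apply: (cvg_comp _ _ (ct x)); exact: cf.
Qed.

Lemma C0M U f g : open U -> Cb f -> C0 U g -> C0 U (fun x => f x * g x).
Proof.
move=> oU cf cg; have [c1 _] := CbM cf (C0_Cb oU cg); apply: C0I => //.
  by move=> x /(C0_off cg) ->; rewrite mulr0.
move=> e e0; case: cf => _ [M hM].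
have M0 : 0 < cn M + 1 by rewrite ltr_wpDl ?cn_ge0.
exists [set x | e / (cn M + 1) <= cn (g x)].
  by apply: C0_supp cg _; rewrite divr_gt0.
move=> x; rewrite cnM /= ler_pdivrMr // => h; rewrite (le_trans h) // mulrC ler_wpM2l ?cn_ge0 //.
have M_ge0 : 0 <= M by exact: le_trans (normr_ge0 _) (hM x).
apply: (@le_trans _ _ (cn M)); last by rewrite lerDl.
by have h' := hM x; rewrite -(ger0_norm M_ge0) !cnE lecR in h'.
Qed.

Lemma C0_conj U f : open U -> C0 U f -> C0 U (fun x => Num.conj (f x)).
Proof.
move=> oU cf; have [c1 _] := Cb_conj (C0_Cb oU cf); apply: C0I => //.
  by move=> x /(C0_off cf) ->; rewrite rmorph0.
move=> e e0; exists [set x | e <= cn (f x)]; first exact: C0_supp cf e0.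
by move=> x; rewrite /cn norm_conjC.
Qed.

Lemma C0_bump U x : bump_space R X -> open U -> U x -> exists2 h : X -> R,
  C0 U (fun y => (h y)%:C) & h x = 1 /\ continuous h.
Proof.
move=> bX oU Ux; have [h [ch hx h01 [K [cK KU hK]]]] := bX U x oU Ux.
exists h => //; apply: C0I; first exact: cont_real.
  move=> y nUy; rewrite (_ : h y = 0) //; apply/eqP; apply: contraPT nUy => /hK/KU ? /(_ _).
  exact.
move=> e e0; exists K => // y hy; apply: hK; apply: contraTN hy => /eqP ->.
by rewrite /cn normr0 -ltNge.
Qed.

End C0.

Section NormContinuity.
Variables (R : realType) (H : completeNormedModType R[i]).

Definition ncat (Y : topologicalType) (f : Y -> H -> H) (y : Y) : Prop :=
  forall e : R, 0 < e -> \forall y' \near y, opnorm (f y' - f y) < e.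

Variable Y : topologicalType.
Implicit Types (U : set Y) (f : Y -> H -> H) (y : Y).

Lemma ncP U f : open U -> norm_continuous U f <-> forall y, U y -> ncat f y.
Proof.
move=> oU; split=> h y Uy e e0; have := h y Uy e e0; rewrite near_withinE.
  by move=> h'; apply: filterS (filterI h' (open_nbhs_nbhs (conj oU Uy))) => z [h1 /h1].
by apply: filterS.
Qed.

Lemma ncat_ext f f' y : (\forall y' \near y, f y' = f' y') -> ncat f y -> ncat f' y.
Proof.
move=> ff' hf e e0; have fy := nbhs_singleton ff'.
by apply: filterS (filterI ff' (hf e e0)) => z [<-]; rewrite fy.
Qed.

Lemma ncat_opnorm f y : (\forall y' \near y, bop (f y')) -> ncat f y ->
  (fun z => opnorm (f z)) @ y --> opnorm (f y).
Proof.
move=> bf cf; apply/cvgrPdist_lt => e e0; have by_ := nbhs_singleton bf.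
apply: filterS (filterI bf (cf e e0)) => z [bz]; rewrite distrC; apply: le_lt_trans.
exact: opnorm_dist.
Qed.

Lemma ncatZ (c : Y -> R[i]) f y : (c : Y -> R[i]^o) @ y --> (c y : R[i]^o) ->
  (\forall y' \near y, bop (f y')) -> ncat f y -> ncat (fun z => c z *: f z) y.
Proof.
move=> /cvg_nrP cc bf cf e e0; have by_ := nbhs_singleton bf.
pose K := cn (c y) + 1 + opnorm (f y) + 1.
have K1 : 1 <= K by rewrite /K; have := cn_ge0 (c y); have := opnorm_ge0 (f y); lra.
have d0 : 0 < Num.min 1 (e / (2 * K)).
  by rewrite lt_min ltr01 divr_gt0 // mulr_gt0 // (lt_le_trans ltr01).
set d := Num.min _ _ in d0.
have dK : 2 * (d * K) <= e.
  rewrite mulrCA -ler_pdivlMr; last by rewrite mulr_gt0 // (lt_le_trans ltr01).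
  by rewrite /d ge_min lexx orbT.
have d1 : d <= 1 by rewrite /d ge_min lexx.
apply: filterS (filterI bf (filterI (cc d d0) (cf d d0))) => z [bz [hc hf]].
have -> : c z *: f z - c y *: f y = c z *: (f z - f y) + (c z - c y) *: f y.
  by rewrite scalerBr scalerBl addrA subrK.
have bB := bopB bz by_.
rewrite (le_lt_trans (opnormD (bopZ _ bB) (bopZ _ by_))) // !opnormZ //.
have hc' : cn (c z - c y) < d by [].
have cz : cn (c z) <= cn (c y) + d.
  have := ler_normD (c z - c y) (c y); rewrite subrK !cnE -rmorphD lecR => h.
  by rewrite (le_trans h) // addrC lerD2l ltW.
have := opnorm_ge0 (f y); have := opnorm_ge0 (f z - f y); have := cn_ge0 (c z); have := cn_ge0 (c y).
have := cn_ge0 (c z - c y).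
move=> a1 a2 a3 a4 a5.
set u := opnorm (f z - f y) in hf a4 *; pose v := opnorm (f y).
have h1 : cn (c z) * u <= (cn (c y) + 1) * u by rewrite ler_wpM2r //; lra.
have h2 : (cn (c y) + 1) * u <= (cn (c y) + 1) * d by rewrite ler_wpM2l //; lra.
have h3 : cn (c z - c y) * v <= d * v by rewrite ler_wpM2r //; exact: ltW.
have h4 : d * K = d * (cn (c y) + 1) + d * v + d by rewrite /K /v; ring.
rewrite -/v; lra.
Qed.

End NormContinuity.

Section Algebra.
Variables (R : realType) (H : completeNormedModType R[i]).
Variable ip : H -> H -> R[i].
Hypothesis hH : is_hilbert ip.
Variable X : topologicalType.
Hypothesis hX : hausdorff_space X.
Hypothesis bX : bump_space R X.

Let KC := cstar_closed (Kalg_cstar hH).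

Lemma cn_sqrt (r : R) : cn (Num.sqrt r)%:C = Num.sqrt r.
Proof. by rewrite cn_real // sqrtr_ge0. Qed.

Lemma le_sqrt_sqr (e r : R) : 0 <= e -> 0 <= r -> (e <= Num.sqrt r) = (e ^+ 2 <= r).
Proof.
by move=> e0 r0; rewrite -{2}(sqr_sqrtr r0) ler_sqr ?nnegrE ?sqrtr_ge0.
Qed.

(** At a zero of f the quotient is 0, as the inverse of 0 is 0, and nearby its norm is the square
    root of n, which tends to 0. The function n is separate from f because [snorm] is global while f
    is one local representative. *)
Lemma ncat_sqrtV (f : X -> H -> H) (n : X -> R) x :
  (\forall y \near x, bop (f y) /\ n y = opnorm (f y)) -> ncat f x ->
  ncat (fun y => (Num.sqrt (n y))^-1%:C *: f y) x.
Proof.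
move=> bf cf; have bf1 : \forall y \near x, bop (f y) by apply: filterS bf => y [].
have [bx nx] := nbhs_singleton bf.
have cn_ : n @ x --> n x.
  have e : \forall y \near x, opnorm (f y) = n y by apply: filterS bf => y [].
  by apply: cvg_trans (near_eq_cvg e) _; rewrite nx; exact: ncat_opnorm.
have cs : (fun y => Num.sqrt (n y)) @ x --> Num.sqrt (n x).
  by apply: (cvg_comp _ _ cn_); exact: sqrt_continuous.
have [n0|n0] := eqVneq (n x) 0.
  have fx : f x = 0 by apply: opnorm0_eq0 => //; rewrite -nx.
  move=> e e0; rewrite n0 sqrtr0 invr0 scale0r.
  have /cvgrPdist_lt/(_ _ e0) := cs; rewrite n0 sqrtr0 => cs'.
  apply: filterS (filterI bf cs') => y [[bfy ny]]; rewrite sub0r normrN subr0 => h.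
  rewrite opnormZ // cn_real ?invr_ge0 ?sqrtr_ge0 // -ny.
  have [->|ny0] := eqVneq (n y) 0; first by rewrite mulr0.
  have n_ge0 : 0 <= n y by rewrite ny opnorm_ge0.
  have s0 : Num.sqrt (n y) != 0 by rewrite sqrtr_eq0 -ltNge lt_neqAle eq_sym ny0.
  by rewrite -{2}(sqr_sqrtr n_ge0) expr2 mulKf // (le_lt_trans (ler_norm _) h).
apply: ncatZ => //; apply/cvg_nrP => e e0.
have n_ge0 : 0 <= n x by rewrite nx opnorm_ge0.
have s0 : Num.sqrt (n x) != 0 by rewrite sqrtr_eq0 -ltNge lt_neqAle eq_sym n0.
have /cvgrPdist_lt/(_ _ e0) : (fun y => (Num.sqrt (n y))^-1) @ x --> (Num.sqrt (n x))^-1.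
  exact: cvgV.
apply: filterS => y; rewrite -rmorphB /nr normc_def /= expr0n addr0 sqrtr_sqr.
by rewrite distrC.
Qed.

Section SectionAlg.
Variables (J : Type) (V : J -> set X) (g : J -> J -> X -> (H -> H) -> H -> H).
Hypothesis hK : is_K_bundle ip V g.
Local Notation SA := (section_alg ip V g).
Implicit Types s : SA.

Lemma V_open i : open (V i). Proof. by case: hK => -[h _]. Qed.
Lemma V_cover x : exists i, V i x.
Proof. by case: hK => -[_ h] _ _ _ _; have := I : [set: X] x; rewrite -h => -[i _]; exists i. Qed.

Definition snorm s (x : X) : R := xget 0 [set r | exists2 i, V i x & r = opnorm (s i x)].

Lemma sec_norm s i j x : mem s -> V i x -> V j x -> opnorm (s i x) = opnorm (s j x).
Proof.
move=> [h1 _ _ h4 _] ix jx; rewrite (h4 i j x) //.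
by case: hK => _ h _ _ _; apply: (Kiso_norm hH (h i j x (conj ix jx))); exact: h1.
Qed.

Lemma snormE s i x : mem s -> V i x -> snorm s x = opnorm (s i x).
Proof.
move=> ms ix; rewrite /snorm; case: xgetP => [_ _ [j jx ->]|/(_ (opnorm (s i x)))[]].
  exact: sec_norm.
by exists i.
Qed.

Lemma snorm_ge0 s x : mem s -> 0 <= snorm s x.
Proof. by move=> ms; have [i ix] := V_cover x; rewrite (snormE ms ix) opnorm_ge0. Qed.

Lemma sec_ncat s i x : mem s -> V i x -> ncat (s i) x.
Proof. by move=> [_ _ h _ _] ix; apply: (ncP _ (V_open i)).1. Qed.

Lemma sec_bop s i x : mem s -> bop (s i x).
Proof.
move=> [h1 h2 _ _ _]; have [ix|ix] := pselect (V i x); first exact/compact_bop/h1.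
by rewrite h2 //; exact: bop0.
Qed.

Lemma snorm_cont s : mem s -> continuous (snorm s).
Proof.
move=> ms x; have [i ix] := V_cover x.
have e : \forall y \near x, opnorm (s i y) = snorm s y.
  by apply: filterS (open_nbhs_nbhs (conj (V_open i) ix)) => y iy; rewrite -snormE.
apply: cvg_trans (near_eq_cvg e) _; rewrite (snormE ms ix).
apply: ncat_opnorm; last exact: sec_ncat.
by apply: filterE => y; exact: sec_bop.
Qed.

Lemma snorm_set s e : mem s ->
  [set x | exists2 i, V i x & e <= opnorm (s i x)] = [set x | e <= snorm s x].
Proof.
move=> ms; apply/seteqP; split=> x /=.
  by move=> [i ix]; rewrite (snormE ms ix).
by have [i ix] := V_cover x; rewrite (snormE ms ix); exists i.
Qed.

(** h is the square root of the norm of s, and s' = s / h still vanishes at infinity since its norm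
    is h again. This identifies the kernel of evaluation at x0 with [van]. *)
Lemma sec_factor s x0 : mem s -> snorm s x0 = 0 -> exists h s',
  [/\ Cb h, h x0 = 0, mem s' & s = cmul h s'].
Proof.
move=> ms s0.
pose h x : R[i] := (Num.sqrt (snorm s x))%:C.
pose s' : SA := fun i x => (Num.sqrt (snorm s x))^-1%:C *: s i x.
exists h, s'.
have bs i x : bop (s i x) := sec_bop i x ms.
have hh : Cb h.
  apply: (@C0_Cb _ _ hX setT) openT _; apply: C0I => //.
    apply: (@cont_real R X (fun x => Num.sqrt (snorm s x))) => x.
    exact: (cvg_comp _ _ (@snorm_cont s ms x) (@sqrt_continuous R _)).
    by move=> x /(_ I).
  move=> e e0; exists [set x | e ^+ 2 <= snorm s x].
    by rewrite -snorm_set //; case: ms => _ _ _ _; apply; rewrite exprn_gt0.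
  by move=> x; rewrite cn_sqrt le_sqrt_sqr ?(ltW e0) ?snorm_ge0.
have ns' i x : V i x -> opnorm (s' i x) = Num.sqrt (snorm s x).
  move=> ix; rewrite opnormZ // cn_real ?invr_ge0 ?sqrtr_ge0 // -snormE //.
  have [->|n0] := eqVneq (snorm s x) 0; first by rewrite sqrtr0 mulr0.
  have n_ge0 := snorm_ge0 x ms.
  have sn : Num.sqrt (snorm s x) != 0 by rewrite sqrtr_eq0 -ltNge lt_neqAle eq_sym n0.
  by rewrite -{2}(sqr_sqrtr n_ge0) expr2 mulKf.
split=> //.
- by rewrite /h s0 sqrtr0.
- have [h1 h2 h3 h4 h5] := ms; split.
  + by move=> i x ix; apply: copZ; exact: h1.
  + by move=> i x ix; rewrite /s' h2 // scaler0.
  + move=> i; apply/(ncP _ (V_open i)) => x ix; apply: ncat_sqrtV; last exact: sec_ncat.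
    apply: filterS (open_nbhs_nbhs (conj (V_open i) ix)) => y iy.
    by split => //; exact: snormE.
  + move=> i j x [ix jx]; rewrite /s' (h4 i j x) //.
    have [_ gi _ _ _] := hK; rewrite (siZ _ KC (gi i j x (conj ix jx))) //.
    exact: h1.
  + move=> e e0.
    rewrite (_ : [set x | _] = [set x | e ^+ 2 <= snorm s x]); last first.
      apply/seteqP; split=> x /=.
        by move=> [i ix]; rewrite ns' // le_sqrt_sqr ?(ltW e0) ?snorm_ge0.
      have [i ix] := V_cover x; rewrite -le_sqrt_sqr ?(ltW e0) ?snorm_ge0 // => ?.
      by exists i => //; rewrite ns'.
    by rewrite -snorm_set //; apply: h5; rewrite exprn_gt0.
- apply/funext => i; apply/funext => x.
  rewrite -[RHS]/(h x *: ((Num.sqrt (snorm s x))^-1%:C *: s i x)) scalerA -rmorphM.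
  have [n0|n0] := eqVneq (snorm s x) 0.
    rewrite n0 sqrtr0 mul0r scale0r.
    have [ix|ix] := pselect (V i x); last by case: ms => _ h2 _ _ _; rewrite h2.
    by apply: opnorm0_eq0 => //; rewrite -snormE.
  have n_ge0 := snorm_ge0 x ms.
  rewrite mulfV ?rmorph1 ?scale1r //.
  by rewrite sqrtr_eq0 -ltNge lt_neqAle eq_sym n0.
Qed.

(** The constant section T of the chart j, carried to the other charts by g and cut off by a bump
    function supported in V j. *)
Lemma sec_bump j x T : V j x -> compact_op T -> exists2 s : SA, mem s & s j x = T.
Proof.
move=> jx cT; have [h [ch hx h01 [K [cK KV hKK]]]] := bX (V_open j) jx.
pose s : SA := fun i y => if `[< V i y /\ V j y >] then (h y)%:C *: g i j y T else 0.
have [_ gi gc gii gcoc] := hK.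
have hV y : h y != 0 -> V j y by move=> /hKK/KV.
have h0 y : ~ V j y -> h y = 0.
  by move=> nV; apply/eqP; apply: contraPT nV => /hV ? /(_ _); exact.
have bg i y : V i y -> V j y -> compact_op (g i j y T).
  by move=> iy jy; apply: (si_mem (gi i j y (conj iy jy))).
have gn i y : V i y -> V j y -> opnorm (g i j y T) = opnorm T.
  by move=> iy jy; exact: (Kiso_norm hH (gi i j y (conj iy jy))).
exists s; last first.
  by rewrite /s asboolT // hx rmorph1 scale1r gii.
have oV i := V_open i.
split.
- move=> i y iy; rewrite /s; case: asboolP => [[_ jy]|_]; last exact: cop0.
  exact/copZ/bg.
- by move=> i y iy; rewrite /s asboolF // => -[].
- move=> i; apply/ncP => // y iy.
  have [jy|jy] := pselect (V j y).
    have e : \forall z \near y, (h z)%:C *: g i j z T = s i z.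
      apply: filterS (filterI (open_nbhs_nbhs (conj (oV i) iy)) (open_nbhs_nbhs (conj (oV j) jy))).
      by move=> z [iz jz]; rewrite /s asboolT.
    apply: ncat_ext e _; apply: ncatZ.
    + exact: cont_real.
    + apply: filterS (filterI (open_nbhs_nbhs (conj (oV i) iy)) (open_nbhs_nbhs (conj (oV j) jy))).
      by move=> z [iz jz]; exact/compact_bop/bg.
    + have hgc := (ncP _ (openI (oV i) (oV j))).1 (gc i j T cT); exact: hgc.
  have oK : open (~` K) by apply: closed_openC; exact: compact_closed.
  have nKy : (~` K) y by move=> /KV.
  have e : \forall z \near y, 0 = s i z.
    apply: filterS (open_nbhs_nbhs (conj oK nKy)) => z nKz.
    rewrite /s; case: asboolP => // _.
    rewrite (_ : h z = 0) ?scale0r //; apply/eqP; apply: contraPT nKz => /hKK ? /(_ _).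
    exact.
  apply: ncat_ext e _ => e e0; apply: filterE => z.
  by rewrite subrr opnorm0.
- move=> i k y [iy ky]; rewrite /s; case: asboolP => [[_ jy]|nij].
    rewrite asboolT // (siZ _ KC (gi i k y (conj iy ky))); last exact: bg.
    by rewrite gcoc.
  rewrite asboolF; last by move=> [_ jy]; apply: nij.
  by rewrite (si0 KC (gi i k y (conj iy ky))).
- move=> e e0; rewrite (_ : [set y | _] = [set y | e <= h y * opnorm T]); last first.
    apply/seteqP; split=> y /=.
      move=> [i iy]; rewrite /s; case: asboolP => [[_ jy]|_]; last by rewrite opnorm0 leNgt e0.
      rewrite opnormZ ?gn //; last exact/compact_bop/bg.
      by rewrite cn_real //; have /andP[] := h01 y.
    move=> ey; have jy : V j y.
      by apply: hV; apply: contraTN ey => /eqP ->; rewrite mul0r -ltNge.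
    exists j => //; rewrite /s asboolT // opnormZ ?gn //; last exact/compact_bop/bg.
    by rewrite cn_real //; have /andP[] := h01 y.
  apply: (subclosed_compact _ cK).
    apply: (@preimage_closed _ _ (fun y => h y * opnorm T) [set t | e <= t]); last exact: closed_ge.
    by move=> y _; apply: cvgM; [exact: ch|exact: cvg_cst].
  by move=> y /= ey; apply: hKK; apply: contraTN ey => /eqP ->; rewrite mul0r -ltNge.
Qed.

End SectionAlg.

Section C0Kfacts.
Variable U : set X.
Hypothesis oU : open U.
Local Notation CK := (@C0K R H ip X U).
Implicit Types f : CK.

Lemma C0K_bop f x : mem f -> bop (f x).
Proof.
move=> [h1 h2 _ _]; have [Ux|Ux] := pselect (U x); first exact/compact_bop/h1.
by rewrite h2 //; exact: bop0.
Qed.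

Lemma C0K_opnorm f : mem f -> continuous (fun x => opnorm (f x)).
Proof.
move=> mf x; have bf y := C0K_bop y mf; have [h1 h2 h3 h4] := mf.
have [Ux|Ux] := pselect (U x).
  by apply: ncat_opnorm; [exact: filterE|exact: (ncP _ oU).1].
rewrite /continuous_at h2 // opnorm0; apply/cvgrPdist_lt => e e0.
have oK : open (~` (U `&` [set x | e <= opnorm (f x)])).
  by apply: closed_openC; apply: compact_closed => //; exact: h4.
have nx : (~` (U `&` [set x | e <= opnorm (f x)])) x by move=> [].
apply: filterS (open_nbhs_nbhs (conj oK nx)) => y hy.
rewrite sub0r normrN ger0_norm ?opnorm_ge0 // ltNge; apply/negP => ey.
apply: hy; split=> //; apply: contrapT => Uy; move: ey.
by rewrite h2 // opnorm0 leNgt e0.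
Qed.

(** The counterpart of [sec_factor] over a single open set, with h in C_0(U) so that the
    factorisation can be pulled back through a trivialisation of A|_U. *)
Lemma C0K_factor f x0 : mem f -> f x0 = 0 -> exists h f',
  [/\ C0 U h, h x0 = 0, mem (f' : CK) & f = cmul h f'].
Proof.
move=> mf f0; have bf y := C0K_bop y mf; have [h1 h2 h3 h4] := mf.
pose h x : R[i] := (Num.sqrt (opnorm (f x)))%:C.
pose f' : CK := fun x => (Num.sqrt (opnorm (f x)))^-1%:C *: f x.
exists h, f'.
have hh : C0 U h.
  apply: C0I => //.
  - apply: (@cont_real R X (fun x => Num.sqrt (opnorm (f x)))) => x.
    exact: (cvg_comp _ _ (@C0K_opnorm f mf x) (@sqrt_continuous R _)).
  - by move=> x Ux; rewrite /h h2 // opnorm0 sqrtr0.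
  - move=> e e0; exists (U `&` [set x | e ^+ 2 <= opnorm (f x)]).
      by apply: h4; rewrite exprn_gt0.
    move=> x; rewrite cn_sqrt le_sqrt_sqr ?(ltW e0) ?opnorm_ge0 // => ex; split=> //.
    apply: contrapT => Ux; move: ex; rewrite h2 // opnorm0 leNgt.
    by rewrite exprn_gt0.
have ns' x : opnorm (f' x) = Num.sqrt (opnorm (f x)).
  rewrite opnormZ // cn_real ?invr_ge0 ?sqrtr_ge0 //.
  have [->|n0] := eqVneq (opnorm (f x)) 0; first by rewrite sqrtr0 mulr0.
  have n_ge0 := opnorm_ge0 (f x).
  have sn : Num.sqrt (opnorm (f x)) != 0 by rewrite sqrtr_eq0 -ltNge lt_neqAle eq_sym n0.
  by rewrite -{2}(sqr_sqrtr n_ge0) expr2 mulKf.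
split=> //.
- by rewrite /h f0 opnorm0 sqrtr0.
- split.
  + by move=> x Ux; apply: copZ; exact: h1.
  + by move=> x Ux; rewrite /f' h2 // scaler0.
  + apply/(ncP _ oU) => x Ux; apply: (@ncat_sqrtV f (fun y => opnorm (f y))).
      by apply: filterE => y; split.
    exact: (ncP _ oU).1.
  + move=> e e0; rewrite (_ : U `&` _ = U `&` [set x | e ^+ 2 <= opnorm (f x)]).
      by apply: h4; rewrite exprn_gt0.
    by apply/seteqP; split=> x [Ux /=]; rewrite ns' le_sqrt_sqr ?(ltW e0) ?opnorm_ge0.
- apply/funext => x.
  rewrite -[RHS]/(h x *: ((Num.sqrt (opnorm (f x)))^-1%:C *: f x)) scalerA -rmorphM.
  have [n0|n0] := eqVneq (opnorm (f x)) 0.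
    by rewrite n0 sqrtr0 mul0r scale0r; exact: opnorm0_eq0.
  rewrite mulfV ?rmorph1 ?scale1r //.
  by rewrite sqrtr_eq0 -ltNge lt_neqAle eq_sym n0 opnorm_ge0.
Qed.

Lemma C0K_const h T : C0 U h -> compact_op T -> mem ((fun x => h x *: T) : CK).
Proof.
move=> ch cT; have bT := compact_bop cT; split.
- by move=> x _; exact: copZ.
- by move=> x Ux; rewrite (C0_off ch) // scale0r.
- apply/(ncP _ oU) => x Ux; apply: ncatZ.
  + exact: (C0_cont hX oU ch).
  + exact: filterE.
  + by move=> e e0; apply: filterE => y; rewrite subrr opnorm0.
- move=> e e0.
  rewrite (_ : U `&` _ = [set x | e <= cn (h x) * opnorm T]); last first.
    apply/seteqP; split=> x /=; first by rewrite opnormZ // => -[].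
    move=> ex; rewrite opnormZ //; split=> //; apply: contrapT => Ux.
    by move: ex; rewrite (C0_off ch) // /cn normr0 mul0r leNgt e0.
  have M0 : 0 < opnorm T + 1 by rewrite ltr_wpDl ?opnorm_ge0.
  apply: (subclosed_compact _ (C0_supp ch (divr_gt0 e0 M0))).
    apply: (@preimage_closed _ _ (fun x => cn (h x) * opnorm T) [set t | e <= t]); last exact: closed_ge.
    move=> x _; apply: cvgM; last exact: cvg_cst.
    by apply: cn_continuous; exact: (C0_cont hX oU ch).
  move=> x /= ex; rewrite ler_pdivrMr // (le_trans ex) // ler_wpM2l ?cn_ge0 //.
  by rewrite lerDl.
Qed.

End C0Kfacts.

End Algebra.

(* Vanishing at x, in terms of the module structure only: the same notion for
   every trivialisation. *)
Definition van (R : realType) (X : topologicalType) (A : xalg R X) (a : A) (x : X) : Prop :=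
  exists h a', [/\ Cb h, mem a', h x = 0 & a = cmul h a'].

(** * Evaluations of a continuous trace algebra *)

Section CTAlgebra.
Variables (R : realType) (H : completeNormedModType R[i]).
Variable ip : H -> H -> R[i].
Hypothesis hH : is_hilbert ip.
Variable X : topologicalType.
Hypothesis hX : hausdorff_space X.
Hypothesis bX : bump_space R X.
Local Notation adj := (adj ip).
Variables (J : Type) (V : J -> set X) (g : J -> J -> X -> (H -> H) -> H -> H).
Hypothesis hK : is_K_bundle ip V g.
Local Notation SA := (section_alg ip V g).
Variable A : xalg R X.
Hypothesis hA : is_cstar A.
Hypothesis hC : forall f (a : A), Cb f -> mem a -> mem (cmul f a).
Variable p0 : A -> SA.
Hypothesis hp : star_iso p0.
Hypothesis hl : linear_over (@Cb R X) p0.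
Implicit Types (a b : A) (f : X -> R[i]).

Let cA := cstar_closed hA.

Lemma p0E f a i x : Cb f -> mem a -> p0 (cmul f a) i x = f x *: p0 a i x.
Proof. by move=> hf ma; rewrite hl. Qed.

(** The record [xalg] contains no module axioms: each of them is checked fibrewise in the section
    algebra and pulled back to A by this lemma. *)
Lemma ainj a b : mem a -> mem b -> (forall i x, p0 a i x = p0 b i x) -> a = b.
Proof.
move=> ma mb h; apply: (si_inj hp) => //.
by apply/funext => i; apply/funext => x; exact: h.
Qed.

Lemma p0_mem a : mem a -> mem (p0 a). Proof. exact: si_mem. Qed.

Lemma cmulA f f' a : Cb f -> Cb f' -> mem a ->
  cmul f (cmul f' a) = cmul (fun x => f x * f' x) a.
Proof.
move=> hf hf' ma; have hff := CbM hf hf'; apply: ainj; [by do 2?apply: hC|exact: hC|].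
by move=> i x; rewrite !p0E ?scalerA //; exact: hC.
Qed.

Lemma cmulPl f t a b : Cb f -> mem a -> mem b ->
  cmul f (t *: a + b) = t *: cmul f a + cmul f b.
Proof.
move=> hf ma mb; have mab : mem (t *: a + b) by exact: acPl.
have mfa := hC hf ma; have mfb := hC hf mb.
apply: ainj; [exact: hC|exact: acPl|].
move=> i x; rewrite p0E // !(si_lin hp) //.
rewrite -[LHS]/(f x *: (t *: p0 a i x + p0 b i x)).
by rewrite -[RHS]/(t *: p0 (cmul f a) i x + p0 (cmul f b) i x) !p0E // scalerDr !scalerA mulrC.
Qed.

Lemma p0_aZ i x a c u : mem a -> p0 a i x (c *: u) = c *: p0 a i x u.
Proof.
by move=> ma; have [l _] := sec_bop i x (p0_mem ma); rewrite linZ.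
Qed.

Lemma cmul_mul f f' a b : Cb f -> Cb f' -> mem a -> mem b ->
  mul (cmul f a) (cmul f' b) = cmul (fun x => f x * f' x) (mul a b).
Proof.
move=> hf hf' ma mb; have hff := CbM hf hf'; have mab : mem (mul a b) by exact: acM.
have mfa := hC hf ma; have mfb := hC hf' mb.
apply: ainj; [exact: acM|exact: hC|].
move=> i x; rewrite p0E // !(si_mul hp) //.
rewrite -[LHS]/(p0 (cmul f a) i x \o p0 (cmul f' b) i x) !p0E //.
apply/funext => v; rewrite -[LHS]/(f x *: (p0 a i x (f' x *: p0 b i x v))).
by rewrite p0_aZ // scalerA.
Qed.

Lemma cmul_star f a : Cb f -> mem a -> star (cmul f a) = cmul (fun x => Num.conj (f x)) (star a).
Proof.
move=> hf ma; have hff := Cb_conj hf; have mfa := hC hf ma; have msa : mem (star a) by exact: acS.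
apply: ainj; [exact: acS|exact: hC|].
move=> i x; rewrite p0E // !(si_star hp) //.
rewrite -[LHS]/(adj (p0 (cmul f a) i x)) -[RHS]/(_ *: adj (p0 a i x)) p0E //.
rewrite -[in LHS](addr0 (f x *: _)) (adjPl hH) ?(adj0 hH) ?addr0 //; last exact: bop0.
exact: sec_bop (p0_mem ma).
Qed.

Lemma p_rep j x : V j x -> is_rep ip (fun a => p0 a j x).
Proof.
move=> jx; split.
- by move=> a /p0_mem[h _ _ _ _]; exact: h.
- by move=> t a b ma mb; rewrite (si_lin hp).
- by move=> a b ma mb; rewrite (si_mul hp).
- by move=> a ma; rewrite (si_star hp).
Qed.

Lemma p_surj j x T : V j x -> compact_op T -> exists2 a, mem a & p0 a j x = T.
Proof.
move=> jx cT; have [s ms <-] := sec_bump hH hX bX hK jx cT.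
by have [a ma <-] := si_surj hp ms; exists a.
Qed.

Lemma van_p a j x : mem a -> V j x -> van a x <-> p0 a j x = 0.
Proof.
move=> ma jx; split.
  by move=> [h [a' [hh ma' hx ->]]]; rewrite p0E // hx scale0r.
move=> a0; have ms := p0_mem ma.
have [|h [s [hh hx ms' e]]] := sec_factor hH hX hK (x0 := x) ms.
  by rewrite (snormE hH hK ms jx) a0 opnorm0.
have [a' ma' a's] := si_surj hp ms'.
exists h, a'; split=> //; apply: ainj => //; first exact: hC.
by move=> i y; rewrite e p0E // a's.
Qed.

Section InducedValue.
Variable U : set X.
Hypothesis oU : open U.
Variable Ph : A -> X -> H -> H.
Hypothesis hPh : @star_iso R (restr A U) (@C0K R H ip X U) Ph.
Hypothesis lPh : @linear_over R X (restr A U) (@C0K R H ip X U) (C0 U) Ph.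
Local Notation iv := (induced_value U Ph).

Lemma restrI f a : C0 U f -> mem a -> @mem R (restr A U) (cmul f a).
Proof. by move=> hf ma; exists f => //; exists a. Qed.

Lemma restr_mem a : @mem R (restr A U) a -> mem a.
Proof. by move=> [f hf [b mb <-]]; exact (hC (C0_Cb hX oU hf) mb). Qed.

Lemma unit_ex y : U y -> exists f, C0 U f /\ f y = 1.
Proof.
move=> Uy; have [h hh [hy _]] := C0_bump bX oU Uy.
by exists (fun x => (h x)%:C); rewrite hy.
Qed.

(** Independence of the cut-off: f . (f1 . a) and f1 . (f . a) are the same element, and linearity
    of [Ph] over C_0(U) evaluates both at y. *)
Lemma ivE f a y : C0 U f -> mem a -> U y -> Ph (cmul f a) y = f y *: iv a y.
Proof.
move=> hf ma Uy; rewrite /induced_value; case: xgetP => [f1 _ [hf1 f1y]|h]; last first.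
  by have [f1 h1] := unit_ex Uy; case: (h f1).
have cf := C0_Cb hX oU hf; have cf1 := C0_Cb hX oU hf1.
have e1 : Ph (cmul f1 (cmul f a)) y = f1 y *: Ph (cmul f a) y.
  by rewrite (lPh hf1 (restrI hf ma)).
have e2 : Ph (cmul f (cmul f1 a)) y = f y *: Ph (cmul f1 a) y.
  by rewrite (lPh hf (restrI hf1 ma)).
rewrite -e2 cmulA // -[LHS]scale1r -f1y -e1 cmulA //.
by congr (Ph (cmul _ a) y); apply/funext => x; rewrite mulrC.
Qed.

Lemma iv_restr a y : @mem R (restr A U) a -> U y -> iv a y = Ph a y.
Proof.
move=> [f hf [b mb <-]] Uy; have cf := C0_Cb hX oU hf.
have [f1 [hf1 f1y]] := unit_ex Uy; have cf1 := C0_Cb hX oU hf1.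
rewrite -[LHS]scale1r -f1y -ivE //; last exact: hC.
by rewrite (lPh hf1 (restrI hf mb)) -[LHS]/(f1 y *: Ph (cmul f b) y) f1y scale1r.
Qed.

Lemma iv_cmul f a y : Cb f -> mem a -> U y -> iv (cmul f a) y = f y *: iv a y.
Proof.
move=> cf ma Uy.
have [f1 [hf1 f1y]] := unit_ex Uy; have cf1 := C0_Cb hX oU hf1.
have hf := C0M hX oU cf hf1.
have <- : Ph (cmul f1 (cmul f a)) y = iv (cmul f a) y.
  by rewrite ivE ?f1y ?scale1r //; exact: hC.
rewrite cmulA //.
rewrite (_ : (fun x => _) = fun x => f x * f1 x); last by apply/funext => x; rewrite mulrC.
by rewrite ivE // f1y mulr1.
Qed.

Lemma iv_rep y : U y -> is_rep ip (fun a => iv a y).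
Proof.
move=> Uy; have [f [hf fy]] := unit_ex Uy; have cf := C0_Cb hX oU hf.
have e a : mem a -> iv a y = Ph (cmul f a) y by move=> ma; rewrite ivE // fy scale1r.
split.
- move=> a ma; rewrite e //; have [h _ _ _] := si_mem hPh (restrI hf ma); exact: h.
- move=> t a b ma mb; rewrite !e //; last exact: acPl.
  by rewrite cmulPl // (si_lin hPh t (restrI hf ma) (restrI hf mb)).
- move=> a b ma mb; have mab := acM cA ma mb.
  have := congr1 (fun s => s y) (si_mul hPh (restrI hf ma) (restrI hf mb)).
  rewrite -[RHS]/(Ph (cmul f a) y \o Ph (cmul f b) y) -!e // => <-.
  have hff := C0M hX oU cf hf.
  transitivity (Ph (cmul (fun x => f x * f x) (mul a b)) y); last by rewrite -cmul_mul.
  by rewrite ivE // fy mulr1 scale1r.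
- move=> a ma; have msa := acS cA ma.
  have := congr1 (fun s => s y) (si_star hPh (restrI hf ma)).
  rewrite -[RHS]/(adj (Ph (cmul f a) y)) -e // => <-.
  have hff := C0_conj hX oU hf.
  transitivity (Ph (cmul (fun x => Num.conj (f x)) (star a)) y); last by rewrite -cmul_star.
  by rewrite ivE // fy rmorph1 scale1r.
Qed.

Lemma iv_surj y T : U y -> compact_op T -> exists2 a, mem a & iv a y = T.
Proof.
move=> Uy cT; have [f [hf fy]] := unit_ex Uy.
have [a ma e] := si_surj hPh (C0K_const ip hX oU hf cT).
exists a; first exact: restr_mem.
by rewrite iv_restr // e fy scale1r.
Qed.

(** If the value is 0, the factorisation of Ph (f . a) comes back to A as f . a = h . a' with h y =
    0 and f y = 1; reading this equation through [p0] shows that [p0 a] vanishes at y. So every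
    trivialisation has the same kernel at y. *)
Lemma iv_van a y : mem a -> U y -> van a y <-> iv a y = 0.
Proof.
move=> ma Uy; have [f [hf fy]] := unit_ex Uy; have cf := C0_Cb hX oU hf.
split.
  by move=> [h [a' [hh ma' hx ->]]]; rewrite iv_cmul // hx scale0r.
move=> a0; have mfa := restrI hf ma.
have F0 : Ph (cmul f a) y = 0 by rewrite ivE // a0 scaler0.
have [h [f' [hh hy mf' e]]] := C0K_factor hX oU (si_mem hPh mfa) F0.
have [a' ma' a'f] := si_surj hPh mf'.
have ch := C0_Cb hX oU hh.
have ha' : @mem R (restr A U) (cmul h a') by apply: restrI => //; exact: restr_mem.
have e2 : cmul f a = cmul h a'.
  by apply: (si_inj hPh mfa ha'); rewrite (lPh hh ma') a'f e.
have [j jy] := V_cover hK y.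
apply/(van_p ma jy).
have := congr1 (fun s => p0 s j y) e2; rewrite /= !p0E ?fy ?hy ?scale1r ?scale0r //.
exact: restr_mem.
Qed.

Lemma iv_ncat a y : mem a -> U y -> ncat (iv a) y.
Proof.
move=> ma Uy; have [h hh [hy ch]] := C0_bump bX oU Uy.
have mfa := si_mem hPh (restrI hh ma).
have hp0 : \forall z \near y, U z /\ h z != 0.
  apply: filterI; first exact: open_nbhs_nbhs.
  have /cvgrPdist_lt/(_ 1 ltr01) := ch y; apply: filterS => z; rewrite hy => h1.
  by apply: contraTN h1 => /eqP ->; rewrite subr0 normr1 ltxx.
have e : \forall z \near y, (h z)^-1%:C *: Ph (cmul (fun x => (h x)%:C) a) z = iv a z.
  apply: filterS hp0 => z [Uz hz]; rewrite ivE // scalerA -rmorphM mulVf //.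
  by rewrite rmorph1 scale1r.
apply: ncat_ext e _; apply: (@ncatZ _ _ _ (fun z => (h z)^-1%:C)).
- apply/cvg_nrP => d d0; have : (fun z => (h z)^-1) @ y --> (h y)^-1.
    by apply: cvgV; [rewrite hy oner_neq0|exact: ch].
  move=> /cvgrPdist_lt/(_ _ d0); apply: filterS => z.
  by rewrite -rmorphB /nr normc_def /= expr0n addr0 sqrtr_sqr distrC.
- by apply: filterE => z; exact: C0K_bop mfa.
- by case: mfa => _ _ h3 _; exact: (ncP _ oU).1.
Qed.

End InducedValue.

End CTAlgebra.

(** * The induced algebra *)

Section Lattice.
Variables (R : realType) (n : nat).
Implicit Types m : 'rV[int]_n.

Lemma latticeD m m' : lattice R (m + m') = lattice R m + lattice R m'.
Proof. by apply/rowP => i; rewrite !mxE rmorphD. Qed.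
Lemma latticeN m : lattice R (- m) = - lattice R m.
Proof. by apply/rowP => i; rewrite !mxE rmorphN. Qed.
Lemma latticeE m : lattice R m = \sum_(k < n) (m 0 k)%:~R *: delta_mx 0 k.
Proof. by rewrite {1}[lattice R m]row_sum_delta; apply: eq_bigr => k _; rewrite mxE. Qed.

End Lattice.

(** * The torus bundle and its local sections *)

Section SetupFacts.
Variables (R : realType) (n : nat) (I : Type) (S : setup R n I).
Hypothesis hS : is_standard_setup S.
Local Notation X := (spX S).
Local Notation Z := (spZ S).
Local Notation pr := (@proj R n I S).
Local Notation ta := (@tact R n I S).
Local Notation cov := (@cov R n I S).
Local Notation sec := (@sec R n I S).
Local Notation s := (@scoch R n I S).
Local Notation pcov := (pcov S).

Let hM : is_manifold X. Proof. by case: hS => -[]. Qed.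
Let hP : is_principal_torus_bundle pr ta. Proof. by case: hS => -[]. Qed.

Lemma X_hausdorff : hausdorff_space X. Proof. by case: hM. Qed.
Lemma X_bump : bump_space R X. Proof. exact: manifold_bump. Qed.

Lemma ta0 x : ta 0 x = x. Proof. by case: hP => -[]. Qed.
Lemma taD t t' x : ta (t + t') x = ta t (ta t' x). Proof. by case: hP => -[]. Qed.
Lemma ta_eq t x : ta t x = x <-> exists m, t = lattice R m. Proof. by case: hP. Qed.
Lemma taK t x : ta (- t) (ta t x) = x. Proof. by rewrite -taD addNr ta0. Qed.
Lemma ta_lattice m x : ta (lattice R m) x = x. Proof. by apply/ta_eq; exists m. Qed.
Lemma pr_ta t x : pr (ta t x) = pr x. Proof. by case: hP => _ _ _ []. Qed.

Lemma pr_cont : continuous pr.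
Proof.
case: hP => _ _ _ [[h _] _] _ x; exact: within_open_cvg openT h _.
Qed.

Lemma ta_cont t : continuous (ta t).
Proof.
move=> x; case: hP => _ [h _] _ _ _.
have := within_open_cvg openT h (x := (t, x)) Logic.I => h'.
have : (fun y => ((t : euclid R n), y)) @ x --> ((t : euclid R n), x).
  move=> P [[Q1 Q2] /= [h1 h2] hQ]; apply: (filterS (P := Q2)) => // y Q2y.
  by apply: hQ; split => //=; exact: nbhs_singleton h1.
by move=> /cvg_comp/(_ h').
Qed.

Lemma cov_open i : open (cov i). Proof. by case: hS => _ [[h _ _] _]. Qed.
Lemma pcov_open i : open (pcov i). Proof. by case: hS => _ [_ [h _ _]]. Qed.
Lemma pcov_cover z : exists i, pcov i z.
Proof.
have [_ [_ [_ h _]] _ _ _] := hS.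
by have : [set: Z] z by []; rewrite -h => -[i _]; exists i.
Qed.
Lemma pcov_contractible i z : pcov i z -> contractible R (pcov i).
Proof.
move=> iz; have [_ [_ [_ _ h]] _ _ _] := hS.
have := h i [::]; rewrite /capl /= setIT; apply; by exists z.
Qed.

Lemma sec_cov i z : pcov i z -> cov i (sec i z).
Proof. by move=> iz; have [_ _ h _ _] := hS; have [_ /(_ z iz)[]] := h i. Qed.
Lemma sec_pr i z : pcov i z -> pr (sec i z) = z.
Proof. by move=> iz; have [_ _ h _ _] := hS; have [_ /(_ z iz)[]] := h i. Qed.
Lemma sec_cvg i z : pcov i z -> sec i @ z --> sec i z.
Proof.
move=> iz; have [_ _ h _ _] := hS; have [[c _] _] := h i.
exact: within_open_cvg (pcov_open i) c iz.
Qed.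
Lemma s_sec i j z : pcov i z -> pcov j z -> ta (s i j z) (sec j z) = sec i z.
Proof. by move=> iz jz; have [_ _ _ h _] := hS; have [_] := h i j; apply. Qed.
Lemma s_cvg i j z : pcov i z -> pcov j z -> s i j @ z --> s i j z.
Proof.
move=> iz jz; have [_ _ _ h _] := hS; have [c _] := h i j.
exact: within_open_cvg (openI (pcov_open i) (pcov_open j)) c (conj iz jz).
Qed.

Lemma ta_inj t t' x : ta t x = ta t' x -> exists m, t = t' + lattice R m.
Proof.
move=> h; have /ta_eq[m hm] : ta (t - t') x = x.
  by rewrite addrC taD h taK.
by exists m; rewrite -hm subrKC.
Qed.

(** With chi the section of a local trivialisation, y = theta(y) . chi and sigma_i = theta'(sigma_i)
    . chi over the same point, so the difference of the two lifts carries sigma_i to y. Two lifts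
    are needed because theta is given only near a chosen point of the fibre. *)
Lemma local_lift i x0 : pcov i (pr x0) -> exists th : X -> 'rV[R]_n,
  th @ x0 --> th x0 /\ \forall y \near x0, pcov i (pr y) /\ y = ta (th y) (sec i (pr y)).
Proof.
move=> iz; have [_ _ _ _ /(_ (pr x0))[Vz [chi [[oV Vz0] _ _ hV]]]] := hP.
have [N [th [[oN Nx0] NV [cth _] hth]]] := hV x0 Vz0.
have V' : Vz (pr (sec i (pr x0))) by rewrite sec_pr.
have [N' [th' [[oN' Nx0'] NV' [cth' _] hth']]] := hV _ V'.
pose tt y : 'rV[R]_n := (th y : 'rV[R]_n) - (th' (sec i (pr y)) : 'rV[R]_n).
have csec : (fun y => sec i (pr y)) @ x0 --> sec i (pr x0).
  by apply: (cvg_comp _ _ (@pr_cont x0)); exact: sec_cvg.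
exists tt; split.
  have c1 : (th : X -> 'rV[R]_n) @ x0 --> (th x0 : 'rV[R]_n).
    exact: within_open_cvg oN cth Nx0.
  have c2 : (fun y => th' (sec i (pr y)) : 'rV[R]_n) @ x0 --> (th' (sec i (pr x0)) : 'rV[R]_n).
    apply: (cvg_comp _ _ csec); exact: within_open_cvg oN' cth' Nx0'.
  exact: (@cvgB _ 'rV[R]_n).
have n1 : \forall y \near x0, pcov i (pr y).
  by apply: (@pr_cont x0); apply: open_nbhs_nbhs; split; [exact: pcov_open|].
have n2 : \forall y \near x0, N' (sec i (pr y)).
  by apply: csec; exact: open_nbhs_nbhs.
apply: filterS (filterI n1 (filterI n2 (open_nbhs_nbhs (conj oN Nx0)))) => y [iy [N'y Ny]].
split=> //; have e1 := hth y Ny; have e2 := hth' _ N'y; rewrite sec_pr // in e2.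
have ec : ta (- th' (sec i (pr y))) (sec i (pr y)) = chi (pr y) by rewrite {2}e2 taK.
by rewrite /tt taD ec -e1.
Qed.

Lemma fiber_ex i x : pcov i (pr x) -> exists t, x = ta t (sec i (pr x)).
Proof. by move=> /local_lift[th [_ /nbhs_singleton[_ h]]]; exists (th x). Qed.

Lemma local_lift_at i x0 t0 : pcov i (pr x0) -> x0 = ta t0 (sec i (pr x0)) ->
  exists th : X -> 'rV[R]_n, [/\ th @ x0 --> th x0, th x0 = t0 &
    \forall y \near x0, pcov i (pr y) /\ y = ta (th y) (sec i (pr y))].
Proof.
move=> iz x0E; have [th [cth hth]] := local_lift iz.
have [_ h0] := nbhs_singleton hth.
have [m hm] : exists m, th x0 = t0 + lattice R m.
  by apply: (@ta_inj _ _ (sec i (pr x0))); rewrite -h0.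
exists (fun y => th y - lattice R m); split.
- by apply: (@cvgB _ 'rV[R]_n) => //; exact: cvg_cst.
- by rewrite hm addrK.
- apply: filterS hth => y [iy yE]; split=> //.
  by rewrite -latticeN taD ta_lattice.
Qed.

End SetupFacts.

Lemma compact_eq (T : topologicalType) (A B : set T) : A = B -> compact A -> compact B.
Proof. by move=> ->. Qed.

Lemma nbhs_oppr (R : realType) n (t : 'rV[R]_n) (P : set 'rV[R]_n) :
  nbhs (- t) P -> nbhs t [set t' | P (- t')].
Proof.
move=> /nbhs_ballP[e /= e0 h]; apply/nbhs_ballP; exists e => //= t' [_ tt'].
apply: h; apply/rV_ballP => // i; rewrite !mxE -opprD normrN.
exact: (tt' ord0 i).
Qed.

Section Induced.
Variables (R : realType) (H : completeNormedModType R[i]).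
Variable ip : H -> H -> R[i].
Hypothesis hH : is_hilbert ip.
Variables (n : nat) (I : Type) (S : setup R n I).
Hypothesis hS : is_standard_setup S.
Local Notation X := (spX S).
Local Notation Z := (spZ S).
Local Notation pr := (@proj R n I S).
Local Notation ta := (@tact R n I S).
Local Notation cov := (@cov R n I S).
Local Notation sec := (@sec R n I S).
Local Notation s := (@scoch R n I S).
Local Notation pcov := (pcov S).
Local Notation adj := (adj ip).

Variable A : xsys R X n.
Hypothesis hAct : is_cstar A.
Hypothesis hC : forall f (a : A), Cb f -> mem a -> mem (cmul f a).
Variables (J : Type) (V : J -> set X) (g : J -> J -> X -> (H -> H) -> H -> H).
Hypothesis hK : is_K_bundle ip V g.
Variable p0 : A -> section_alg ip V g.
Hypothesis hp : star_iso p0.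
Hypothesis hl : linear_over (@Cb R X) p0.
Hypothesis hBr : in_Br ip ta A.
Variable D : choices H A.
Hypothesis hD : are_choices ip D.

Let cA := cstar_closed hAct.
Let hX := X_hausdorff hS.
Let bX := X_bump hS.

Implicit Types (a b : A) (m : 'rV[int]_n) (t : 'rV[R]_n) (i : I) (z : Z).

Lemma act_mem t a : mem a -> mem (act t a).
Proof. by case: hBr => _ h _ _ _; exact: (si_mem (h t)). Qed.
Lemma act0 a : mem a -> act 0 a = a.
Proof. by case: hBr => _ _ h _ _ /h[]. Qed.
Lemma actD t t' a : mem a -> act (t + t') a = act t (act t' a).
Proof. by case: hBr => _ _ h _ _ /h[]. Qed.
Lemma actK t a : mem a -> act (- t) (act t a) = a.
Proof. by move=> ma; rewrite -actD // addNr act0. Qed.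
Lemma actKV t a : mem a -> act t (act (- t) a) = a.
Proof. by move=> ma; rewrite -actD // subrr act0. Qed.
Lemma act_cmul t f a : Cb f -> mem a -> act t (cmul f a) = cmul (fun x => f (ta (- t) x)) (act t a).
Proof. by case: hBr => _ _ _ _ h; exact: h. Qed.
Lemma Cb_ta t (f : X -> R[i]) : Cb f -> Cb (fun x => f (ta t x)).
Proof. by move=> hf; apply: (Cb_comp _ hf); exact: ta_cont. Qed.

Lemma van_act_aux t a x : mem a -> van a (ta t x) -> van (act (- t) a) x.
Proof.
move=> ma [h [a' [hh ma' hx ->]]].
exists (fun y => h (ta (- - t) y)), (act (- t) a'); split.
- exact: Cb_ta.
- exact: act_mem.
- by rewrite opprK.
- by rewrite act_cmul.
Qed.

Lemma van_act t a x : mem a -> van a (ta t x) <-> van (act (- t) a) x.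
Proof.
move=> ma; split; first exact: van_act_aux.
move=> h; rewrite -(actKV t ma) -{1}(opprK t); apply: van_act_aux; first exact: act_mem.
by rewrite taK.
Qed.

Definition iv i a y := induced_value (cov i) (Phi D i) a y.
(* The value at t . sigma_i(z), moved to sigma_i(z) by the action. *)
Definition fib i t z a := iv i (act (- t) a) (sec i z).

Let hPh i : @star_iso R (restr A (cov i)) (@C0K R H ip X (cov i)) (Phi D i).
Proof. by case: hD => h _ _ _ _; case: (h i). Qed.
Let lPh i : @linear_over R X (restr A (cov i)) (@C0K R H ip X (cov i)) (C0 (cov i)) (Phi D i).
Proof. by case: hD => h _ _ _ _; case: (h i). Qed.
Let oU i := cov_open hS i.

Lemma iv_rep' i y : cov i y -> is_rep ip (fun a => iv i a y).
Proof. exact: (iv_rep hH hX bX hAct hC hp hl (@oU i) (@hPh i) (@lPh i)). Qed.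

Lemma iv_cmul' i f a y : Cb f -> mem a -> cov i y -> iv i (cmul f a) y = f y *: iv i a y.
Proof. exact: (iv_cmul hX bX hC hp hl (@oU i) (@lPh i)). Qed.

Lemma fib_rep i t z : pcov i z -> is_rep ip (fib i t z).
Proof.
move=> iz; have [h1 h2 h3 h4] := iv_rep' (sec_cov hS iz).
have [_ hs _ _ _] := hBr; have st := hs (- t).
split.
- by move=> a ma; apply: h1; exact: act_mem.
- by move=> c a b ma mb; rewrite /fib (si_lin st) // h2 //; exact: act_mem.
- by move=> a b ma mb; rewrite /fib (si_mul st) // h3 //; exact: act_mem.
- by move=> a ma; rewrite /fib (si_star st) // h4 //; exact: act_mem.
Qed.

Lemma fib_surj i t z T : pcov i z -> compact_op T -> exists2 a, mem a & fib i t z a = T.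
Proof.
move=> iz cT.
have [a ma <-] := iv_surj hX bX hC hp hl (@oU i) (@hPh i) (@lPh i) (sec_cov hS iz) cT.
by exists (act t a); [exact: act_mem|rewrite /fib actK].
Qed.

Lemma fib_van i t z a : pcov i z -> mem a -> van a (ta t (sec i z)) <-> fib i t z a = 0.
Proof.
move=> iz ma; rewrite van_act //.
apply: (iv_van hH hX bX hK hC hp hl (@oU i) (@hPh i) (@lPh i)); last exact: sec_cov.
exact: act_mem.
Qed.

(** Both evaluations map A onto the compacts and have the kernel [van] at t . sigma_i(z), so
    [rep_link] and [Kiso_norm] apply. *)
Lemma fib_p0 i t z (j : J) a : pcov i z -> mem a -> V j (ta t (sec i z)) ->
  opnorm (fib i t z a) = opnorm (p0 a j (ta t (sec i z))).
Proof.
move=> iz ma jx; have pr_ := p_rep hp jx.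
have [th hth e] := rep_link cA pr_ (fib_rep t iz)
  (fun T => @p_surj _ _ _ hH _ hX bX _ _ _ hK _ _ hp j _ T jx) (fun T => @fib_surj i t z T iz)
  (fun b mb => iff_trans (iff_sym (van_p hH hX hK hC hp hl mb jx)) (fib_van t iz mb)).
by rewrite e // (Kiso_norm hH hth) //; exact: (rp_compact pr_).
Qed.

Lemma fib_snorm i t z a : pcov i z -> mem a ->
  opnorm (fib i t z a) = snorm (p0 a) (ta t (sec i z)).
Proof.
move=> iz ma; have [j jx] := V_cover hK (ta t (sec i z)).
by rewrite (fib_p0 iz ma jx) (snormE hH hK (p0_mem hp ma) jx).
Qed.

Lemma fib_ker i t z (j : J) a : pcov i z -> mem a -> V j (ta t (sec i z)) ->
  fib i t z a = 0 <-> p0 a j (ta t (sec i z)) = 0.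
Proof.
move=> iz ma jx; have h := fib_p0 iz ma jx; have bp := sec_bop j (ta t (sec i z)) (p0_mem hp ma).
have bf := compact_bop (rp_compact (fib_rep t iz) ma).
split=> e; apply: opnorm0_eq0 => //; first by rewrite -h e opnorm0.
by rewrite h e opnorm0.
Qed.

Lemma fib_le i t z a : pcov i z -> mem a -> opnorm (fib i t z a) <= nrm a.
Proof. by move=> iz ma; exact: (rep_contractive hH hAct (fib_rep t iz) ma). Qed.

Lemma fib_cmul i t z f a : Cb f -> pcov i z -> mem a ->
  fib i t z (cmul f a) = f (ta t (sec i z)) *: fib i t z a.
Proof.
move=> hf iz ma; rewrite /fib act_cmul // iv_cmul' ?opprK //; last exact: sec_cov.
  exact: Cb_ta.
exact: act_mem.
Qed.

Lemma vgen_unitary i k y : cov i y -> unitary ip (vgen D i k y).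
Proof. by case: hD => _ h _ _ _; have [+ _] := h i k; exact. Qed.

Lemma vtrans_unitary i j z : pcov i z -> pcov j z -> unitary ip (vtrans D i j z).
Proof. by case: hD => _ _ _ h _; have [+ _] := h i j => h' iz jz; exact: h'. Qed.

(** The choices relate alpha at e_k to v^k on A|_U only. A cut-off function reduces b to that case,
    and it commutes with this automorphism because lattice vectors act trivially on X. *)
Lemma iv_gen i k b y : mem b -> cov i y ->
  iv i (act (delta_mx 0 k) b) y = Ad ip (vgen D i k y) (iv i b y).
Proof.
move=> mb Uy; have [_ _ h _ _] := hD.
have [f [hf fy]] := unit_ex bX (@oU i) Uy.
have cf := C0_Cb hX (@oU i) hf.
have IE c : mem c -> Phi D i (cmul f c) y = f y *: iv i c y.
  by move=> mc; exact: (ivE hX bX hC hp hl (@oU i) (@lPh i)).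
have := h i k (cmul f b) y (restrI hf mb) Uy.
rewrite act_cmul // (_ : (fun x => _) = f); last first.
  apply/funext => x; congr f.
  have -> : - delta_mx 0 k = lattice R (- delta_mx 0 k) :> 'rV[R]_n.
    by apply/rowP => l; rewrite !mxE rmorphN rmorph_nat.
  exact: ta_lattice.
by rewrite !IE // ?fy ?scale1r //; exact: act_mem.
Qed.

Lemma iv_opexp i k (c : int) b y : mem b -> cov i y ->
  iv i (act (c%:~R *: delta_mx 0 k) b) y = Ad ip (opexp ip (vgen D i k y) c) (iv i b y).
Proof.
move=> mb Uy; have uv := vgen_unitary k Uy.
have step (d : int) a : mem a -> iv i (act ((d + 1)%:~R *: delta_mx 0 k) a) y =
    Ad ip (vgen D i k y) (iv i (act (d%:~R *: delta_mx 0 k) a) y).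
  move=> ma; rewrite intrD addrC scalerDl scale1r actD // iv_gen //; exact: act_mem.
elim/int_step: c b mb => [|c ih|c ih] b mb; first by rewrite scale0r act0 // (Ad_id hH).
- by rewrite step // ih // opexpD1 // (Ad_comp hH) //; exact: (opexp_unitary hH).
- have := ih b mb; rewrite step // opexpD1 // (Ad_comp hH) //; last exact: (opexp_unitary hH).
  by move=> /(congr1 (Ad ip (adj (vgen D i k y)))); rewrite !(AdK hH).
Qed.

Lemma vpow_unitary i m z : pcov i z -> unitary ip (vpow ip D i m z).
Proof.
move=> iz; rewrite /vpow; elim/big_ind: _ => //; first exact: unitary_id.
  by move=> x y; exact: unitary_comp.
by move=> k _; apply/(opexp_unitary hH)/vgen_unitary; exact: sec_cov.
Qed.

Lemma iv_lattice i m b z : mem b -> pcov i z ->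
  iv i (act (lattice R m) b) (sec i z) = Ad ip (vpow ip D i m z) (iv i b (sec i z)).
Proof.
move=> mb iz; rewrite latticeE /vpow.
elim: (index_enum _) b mb => [|k r ih] b mb; first by rewrite !big_nil act0 // (Ad_id hH).
rewrite !big_cons actD // iv_opexp ?ih //; last exact: sec_cov.
  rewrite -(Ad_comp hH) //; first exact/(opexp_unitary hH)/vgen_unitary/sec_cov.
  elim/big_ind: _ => //; first exact: unitary_id.
    by move=> x y; exact: unitary_comp.
  by move=> l _; apply/(opexp_unitary hH)/vgen_unitary; exact: sec_cov.
exact: act_mem.
Qed.

Lemma fib_lattice i t m z a : pcov i z -> mem a ->
  fib i (t + lattice R m) z a = Ad ip (vpow ip D i (- m) z) (fib i t z a).
Proof.
move=> iz ma; rewrite /fib opprD addrC actD // -latticeN iv_lattice //.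
exact: act_mem.
Qed.

Lemma fib_glue i j t z a : pcov i z -> pcov j z -> mem a ->
  Ad ip (vtrans D i j z) (fib i t z a) = fib j (t + s i j z) z a.
Proof.
move=> iz jz ma; have [_ _ _ _ h] := hD.
have := h i j z (conj iz jz) (act (- t) a) (act_mem _ ma).
rewrite opprK s_sec // -actD // => e; rewrite /fib opprD addrC.
exact: esym e.
Qed.

Definition ind a : I -> 'rV[R]_n -> Z -> H -> H :=
  fun i t z => if `[< pcov i z >] then fib i t z a else 0.

Lemma indE i t z a : pcov i z -> ind a i t z = fib i t z a.
Proof. by move=> iz; rewrite /ind asboolT. Qed.

Lemma ind_off i t z a : ~ pcov i z -> ind a i t z = 0.
Proof. by move=> iz; rewrite /ind asboolF. Qed.

Lemma cover_ex x : exists i t, pcov i (pr x) /\ x = ta t (sec i (pr x)).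
Proof.
have [i iz] := pcov_cover hS (pr x); have [t e] := fiber_ex hS iz.
by exists i, t.
Qed.

(** Both sets are where [snorm (p0 a)] is at least e, so vanishing at infinity means the same in the
    section algebra and in [Aphi]. *)
Lemma ind_set a e : mem a ->
  [set x | exists2 j, V j x & e <= opnorm (p0 a j x)] =
  [set x | exists i t z, [/\ pcov i z, x = ta t (sec i z) & e <= opnorm (ind a i t z)]].
Proof.
move=> ma; rewrite (snorm_set hH hK e (p0_mem hp ma)); apply/seteqP; split=> x /=.
  have [i [t [iz xE]]] := cover_ex x => ex; exists i, t, (pr x); split=> //.
  by rewrite indE // fib_snorm // -xE.
by move=> [i [t [z [iz -> h]]]]; rewrite -fib_snorm // -indE.
Qed.

Lemma ind_mem a : mem a -> in_Aphi ip D (ind a).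
Proof.
move=> ma; split.
- move=> i t; split.
  + by move=> z iz; rewrite indE //; exact: (rp_compact (fib_rep t iz)).
  + by move=> z; exact: ind_off.
  + apply/(ncP _ (pcov_open hS i)) => z iz e e0.
    have mta : mem (act (- t) a) by exact: act_mem.
    have h := iv_ncat hX bX hC hp hl (@oU i) (@hPh i) (@lPh i) mta (sec_cov hS iz) e0.
    have h' : \forall y \near z, opnorm (iv i (act (- t) a) (sec i y) - iv i (act (- t) a) (sec i z)) < e.
      exact: (sec_cvg hS iz h).
    apply: filterS (filterI h' (open_nbhs_nbhs (conj (pcov_open hS i) iz))) => y [hy iy].
    by rewrite !indE.
  + by exists (nrm a) => z iz; rewrite indE // fib_le.
- move=> i t e e0; have [_ _ _ h _] := hBr.
  have h1 := h a ma (- t) e e0.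
  apply: filterS (nbhs_oppr h1) => t' /= lt z iz; rewrite !indE //.
  have rp := iv_rep' (sec_cov hS iz).
  have m1 : mem (act (- t') a) by exact: act_mem.
  have m2 : mem (act (- t) a) by exact: act_mem.
  rewrite /fib -(repB rp) //; apply: le_lt_trans lt.
  by apply: (rep_contractive hH hAct rp); exact: acB.
- by move=> i t m z iz; rewrite !indE // fib_lattice.
- by move=> i j t z [iz jz]; rewrite !indE // fib_glue.
- move=> e e0; apply: compact_eq (ind_set e ma) _.
  by have [_ _ _ _ h] := p0_mem hp ma; exact: h.
Qed.

(** [in_Aphi] gives continuity in t uniformly in z, and continuity in z for fixed t. Combined, they
    give continuity along any continuous local lift th. *)
Lemma aphi_ncat xi i (th : X -> 'rV[R]_n) x0 : in_Aphi ip D xi -> pcov i (pr x0) ->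
  th @ x0 --> th x0 -> ncat (fun y => xi i (th y) (pr y)) x0.
Proof.
move=> [h1 h2 _ _ _] iz cth e e0; have e2 : 0 < e / 2 by rewrite divr_gt0.
have n1 : \forall y \near x0, forall z, pcov i z -> opnorm (xi i (th y) z - xi i (th x0) z) < e / 2.
  exact: (cth _ (h2 i (th x0) (e / 2) e2)).
have [hc _ hz _] := h1 i (th x0).
have n2 : \forall y \near x0, opnorm (xi i (th x0) (pr y) - xi i (th x0) (pr x0)) < e / 2.
  exact: (@pr_cont _ _ _ _ hS x0 _ ((ncP _ (pcov_open hS i)).1 hz _ iz _ e2)).
have n3 : \forall y \near x0, pcov i (pr y).
  by apply: (@pr_cont _ _ _ _ hS x0); apply: open_nbhs_nbhs; split; [exact: pcov_open|].
apply: filterS (filterI n1 (filterI n2 n3)) => y /= [a1 [a2 a3]].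
have c z t : pcov i z -> bop (xi i t z).
  by move=> iz'; have [hc' _ _ _] := h1 i t; exact/compact_bop/hc'.
rewrite (le_lt_trans (opnorm_tri (c _ _ a3) (c _ (th x0) a3) (c _ _ iz))) //.
by rewrite [ltRHS]splitr ltrD // a1.
Qed.

(** Two descriptions t . sigma_i(z) of one point differ by a change of index and a lattice vector,
    and both families obey the same two gluing conditions. Hence agreement in one description gives
    agreement in all. *)
Lemma match_all xi a i t z i' t' z' : in_Aphi ip D xi -> mem a -> pcov i z ->
  fib i t z a = xi i t z -> pcov i' z' -> ta t (sec i z) = ta t' (sec i' z') ->
  fib i' t' z' a = xi i' t' z'.
Proof.
move=> [_ _ h3 h4 _] ma iz e iz' xE.
have zz : z' = z by have := congr1 pr xE; rewrite !pr_ta // !sec_pr.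
rewrite zz in iz' xE *.
rewrite -(s_sec hS iz iz') -taD // in xE; have [m hm] := ta_inj hS (esym xE).
rewrite hm h3 // -h4 // fib_lattice // -fib_glue //.
by rewrite e.
Qed.

(* At each x choose a_x in A with the prescribed value there; the values of the
   a_x form a continuous section because x = t . sigma_i(z) with t depending
   continuously on x, locally. *)
Lemma ind_surj xi : in_Aphi ip D xi -> exists2 a, mem a & ind a = xi.
Proof.
move=> mxi; have [q1 q2 q3 q4 q5] := mxi.
have /choice[a_ ha_] : forall x, exists a, mem a /\ forall i t z, pcov i z ->
    x = ta t (sec i z) -> fib i t z a = xi i t z.
  move=> x; have [i [t [iz xE]]] := cover_ex x.
  have [hc _ _ _] := q1 i t; have [a ma aE] := fib_surj t iz (hc _ iz).
  exists a; split=> // i' t' z' iz' xE'.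
  by apply: (match_all mxi ma iz aE iz'); rewrite -xE -xE'.
have ma x : mem (a_ x) by case: (ha_ x).
have aE x i t z := (ha_ x).2 i t z.
pose f : section_alg ip V g := fun (j : J) (x : X) => if `[< V j x >] then p0 (a_ x) j x else 0.
have fE j x : V j x -> f j x = p0 (a_ x) j x by move=> jx; rewrite /f asboolT.
(* The automorphism relating [p0] to [fib] stays unnamed: [fib_p0], applied to a difference of
   elements of A, transfers distances, which is all that continuity of f requires. *)
have fn j b i t z : mem b -> pcov i z -> V j (ta t (sec i z)) ->
    opnorm (f j (ta t (sec i z)) - p0 b j (ta t (sec i z))) = opnorm (xi i t z - fib i t z b).
  move=> mb iz jx; rewrite fE // -(aE (ta t (sec i z)) i t z iz) //.
  rewrite -(repB (p_rep hp jx)) // -(repB (fib_rep t iz)) //.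
  by rewrite -fib_p0 //; exact: acB.
have f0 j i t z : pcov i z -> V j (ta t (sec i z)) ->
    opnorm (f j (ta t (sec i z))) = opnorm (xi i t z).
  move=> iz jx; have := fn j 0 i t z (ac0 cA) iz jx.
  by rewrite (rep0 cA (p_rep hp jx)) (rep0 cA (fib_rep t iz)) !subr0.
have mf : mem f.
  split.
  - by move=> j x jx; rewrite fE //; exact: (rp_compact (p_rep hp jx)).
  - by move=> j x jx; rewrite /f asboolF.
  - move=> j; apply/(ncP _ (V_open hK j)) => x0 jx0.
    have [i [t0 [iz x0E]]] := cover_ex x0.
    have [th [cth tht0 hth]] := local_lift_at hS iz x0E.
    set b := a_ x0.
    have mb := ind_mem (ma x0).
    have nx := aphi_ncat mxi iz cth; have nb := aphi_ncat mb iz cth.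
    have np := sec_ncat hK (p0_mem hp (ma x0)) jx0.
    move=> e e0; have e3 : 0 < e / 3 by rewrite divr_gt0.
    have oj := open_nbhs_nbhs (conj (V_open hK j) jx0).
    apply: filterS (filterI hth (filterI oj (filterI (nx _ e3) (filterI (nb _ e3) (np _ e3))))).
    move=> y [[iy yE] [jy [n1 [n2 n3]]]].
    have bf j' y' : V j' y' -> bop (f j' y').
      by move=> h; rewrite fE //; exact: sec_bop (p0_mem hp (ma y')).
    have bp y' : bop (p0 b j y') by exact: sec_bop (p0_mem hp (ma x0)).
    have h0 : xi i (th x0) (pr x0) = ind b i (th x0) (pr x0).
      by rewrite indE // -(aE x0) // tht0.
    have bxi t z : pcov i z -> bop (xi i t z).
      by move=> iz'; have [hc' _ _ _] := q1 i t; exact/compact_bop/hc'.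
    have bin t z : pcov i z -> bop (ind b i t z).
      by move=> iz'; have [h' _ _ _ _] := mb; have [hc' _ _ _] := h' i t; exact/compact_bop/hc'.
    rewrite (le_lt_trans (opnorm_tri (bf _ _ jy) (bp y) (bf _ _ jx0))) //.
    have -> : f j x0 = p0 b j x0 by rewrite fE.
    have -> : opnorm (f j y - p0 b j y) = opnorm (xi i (th y) (pr y) - ind b i (th y) (pr y)).
      rewrite {1 2}yE fn ?indE //; first exact: ma.
      by rewrite -yE.
    rewrite (@lt_le_trans _ _ (e / 3 + e / 3 + e / 3)) //; last by lra.
    rewrite ltrD //.
    rewrite (le_lt_trans (opnorm_tri (bxi _ _ iy) (bxi (th x0) _ iz) (bin _ _ iy))) //.
    rewrite ltrD // h0 opnormB //.
  - move=> i j x [ix jx]; rewrite !fE //.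
    by have [_ _ _ h _] := p0_mem hp (ma x); exact: h.
  - move=> e e0; apply: compact_eq (q5 e e0); apply/seteqP; split=> x /=.
      move=> [i [t [z [iz xE h]]]]; have [j jx] := V_cover hK x.
      by exists j => //; rewrite xE f0 // -xE.
    move=> [j jx h]; have [i [t [iz xE]]] := cover_ex x.
    by exists i, t, (pr x); split=> //; rewrite -(f0 j) // -xE.
have [a ma' ae] := si_surj hp mf.
exists a => //; apply/funext => i; apply/funext => t; apply/funext => z.
have [iz|iz] := pselect (pcov i z); last first.
  by rewrite ind_off //; have [_ h _ _] := q1 i t; rewrite h.
rewrite indE //; have [j jx] := V_cover hK (ta t (sec i z)).
rewrite -(aE (ta t (sec i z)) i t z iz) //; apply/subr0_eq.
rewrite -(repB (fib_rep t iz)) //; apply/(fib_ker iz _ jx); first exact: acB.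
by rewrite (repB (p_rep hp jx)) // ae fE // subrr.
Qed.

Lemma ind_star_iso : @star_iso R A (Aphi ip D) ind.
Proof.
have fx (F G : I -> 'rV[R]_n -> Z -> H -> H) :
    (forall i t z, pcov i z -> F i t z = G i t z) ->
    (forall i t z, ~ pcov i z -> F i t z = G i t z) -> F = G.
  move=> h1 h2; apply/funext => i; apply/funext => t; apply/funext => z.
  by have [iz|iz] := pselect (pcov i z); [exact: h1|exact: h2].
apply: star_isoI.
- exact: ind_mem.
- move=> a b ma mb e; apply: (ainj hp) => // j x.
  have [jx|jx] := pselect (V j x); last first.
    have [_ h1 _ _ _] := p0_mem hp ma; have [_ h2 _ _ _] := p0_mem hp mb.
    by rewrite h1 // h2.
  have [i [t [iz xE]]] := cover_ex x.
  apply/subr0_eq; rewrite -(repB (p_rep hp jx)) // xE.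
  rewrite xE in jx; apply/(fib_ker iz _ jx); first exact: acB.
  by rewrite (repB (fib_rep t iz)) // -!indE // e subrr.
- exact: ind_surj.
- move=> c a b ma mb; apply: fx => i t z iz.
    by rewrite -[RHS]/(c *: ind a i t z + ind b i t z) !indE // (rp_lin (fib_rep t iz)).
  by rewrite -[RHS]/(c *: ind a i t z + ind b i t z) !ind_off // scaler0 addr0.
- move=> a b ma mb; apply: fx => i t z iz.
    by rewrite -[RHS]/(ind a i t z \o ind b i t z) !indE // (rp_mul (fib_rep t iz)).
  by rewrite -[RHS]/(ind a i t z \o ind b i t z) !ind_off.
- move=> a ma; apply: fx => i t z iz.
    by rewrite -[RHS]/(adj (ind a i t z)) !indE // (rp_star (fib_rep t iz)).
  by rewrite -[RHS]/(adj (ind a i t z)) !ind_off // (adj0 hH).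
Qed.

Lemma ind_linear : @linear_over R X A (Aphi ip D) (@Cb R X) ind.
Proof.
move=> f a hf ma; apply/funext => i; apply/funext => t; apply/funext => z.
rewrite -[RHS]/(f (ta t (sec i z)) *: ind a i t z).
have [iz|iz] := pselect (pcov i z); last by rewrite !ind_off // scaler0.
by rewrite !indE // fib_cmul.
Qed.

Lemma ind_act r a : mem a -> ind (act r a) = @act _ _ _ (Aphi ip D) r (ind a).
Proof.
move=> ma; apply/funext => i; apply/funext => t; apply/funext => z.
rewrite -[RHS]/(ind a i (t - r) z).
have [iz|iz] := pselect (pcov i z); last by rewrite !ind_off.
by rewrite !indE // /fib -actD // opprB addrC.
Qed.

End Induced.

(** * The C*-algebra structure of the glued algebra *)

Section Transport.
Variable R : realType.
Implicit Types A B : calg R.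

(** The algebraic axioms travel along psi. Those involving the norm remain as hypotheses, since
    [star_iso] says nothing about norms and the target carries its own. *)
Lemma cstar_transport A B (psi : A -> B) : is_cstar A -> star_iso psi ->
  (forall b : B, mem b -> nrm b = 0 -> b = 0) ->
  (forall a b : B, mem a -> mem b -> nrm (a + b) <= nrm a + nrm b) ->
  (forall (t : R[i]) (a : B), mem a -> nrm (t *: a) = complex.Re `|t| * nrm a) ->
  (forall a b : B, mem a -> mem b -> nrm (mul a b) <= nrm a * nrm b) ->
  (forall a : B, mem a -> nrm (mul (star a) a) = nrm a ^+ 2) ->
  (forall u : nat -> B, (forall k, mem (u k)) ->
    (forall e : R, 0 < e -> exists N, forall p q, (N <= p)%N -> (N <= q)%N ->
       nrm (u p - u q) < e) ->
    exists2 a : B, mem a &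
      forall e : R, 0 < e -> exists N, forall p, (N <= p)%N -> nrm (u p - a) < e) ->
  is_cstar B.
Proof.
move=> hA h n1 n2 n3 n4 n5 n6; have cA := cstar_closed hA.
have m (a : A) : mem a -> mem (psi a) by exact: si_mem.
split=> //.
- by rewrite -(si0 cA h); apply: m; exact: ac0.
- move=> c _ _ /(si_surj h)[a ma <-] /(si_surj h)[b mb <-].
  by rewrite -(si_lin h) //; apply: m; exact: acPl.
- move=> _ _ /(si_surj h)[a ma <-] /(si_surj h)[b mb <-].
  by rewrite -(si_mul h) //; apply: m; exact: acM.
- move=> _ /(si_surj h)[a ma <-].
  by rewrite -(si_star h) //; apply: m; exact: acS.
- move=> _ _ _ /(si_surj h)[a ma <-] /(si_surj h)[b mb <-] /(si_surj h)[c mc <-].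
  by rewrite -!(si_mul h) // ?(cs_mulA hA) //; exact: acM.
- move=> t _ _ _ /(si_surj h)[a ma <-] /(si_surj h)[b mb <-] /(si_surj h)[c mc <-].
  rewrite -(si_lin h) // -!(si_mul h) // -?(si_lin h) ?(cs_mull hA) //; try exact: acM.
  exact: acPl.
- move=> t _ _ _ /(si_surj h)[a ma <-] /(si_surj h)[b mb <-] /(si_surj h)[c mc <-].
  rewrite -(si_lin h) // -!(si_mul h) // -?(si_lin h) ?(cs_mulr hA) //; try exact: acM.
  exact: acPl.
- by move=> _ /(si_surj h)[a ma <-]; rewrite -!(si_star h) ?(cs_starK hA) //; exact: acS.
- move=> t _ _ /(si_surj h)[a ma <-] /(si_surj h)[b mb <-].
  rewrite -(si_lin h) // -!(si_star h) // ?(cs_starD hA) // ?(si_lin h) //; try exact: acS.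
  exact: acPl.
- move=> _ _ /(si_surj h)[a ma <-] /(si_surj h)[b mb <-].
  rewrite -(si_mul h) // -!(si_star h) // ?(cs_starM hA) // ?(si_mul h) //; try exact: acS.
  exact: acM.
Qed.

Lemma star_iso_ext A B (f g : A -> B) : alg_closed A -> (forall a, mem a -> f a = g a) ->
  star_iso f -> star_iso g.
Proof.
move=> cA fg h; apply: star_isoI.
- by move=> a ma; rewrite -fg //; exact: (si_mem h).
- by move=> a b ma mb; rewrite -!fg //; exact: (si_inj h).
- by move=> b /(si_surj h)[a ma <-]; exists a; rewrite ?fg.
- by move=> t a b ma mb; rewrite -!fg ?(si_lin h) //; exact: acPl.
- by move=> a b ma mb; rewrite -!fg ?(si_mul h) //; exact: acM.
- by move=> a ma; rewrite -!fg ?(si_star h) //; exact: acS.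
Qed.

End Transport.

Lemma AdB (R : realType) (H : completeNormedModType R[i]) (ip : H -> H -> R[i])
  (v S T : H -> H) : linear v -> Ad ip v (S - T) = Ad ip v S - Ad ip v T.
Proof.
move=> lv; apply/funext => x.
rewrite -[LHS]/(v (S (adj ip v x) - T (adj ip v x))) linB //.
Qed.

Section AphiAlgebra.
Variables (R : realType) (H : completeNormedModType R[i]).
Variable ip : H -> H -> R[i].
Hypothesis hH : is_hilbert ip.
Variables (n : nat) (I : Type) (S : setup R n I).
Hypothesis hS : is_standard_setup S.
Local Notation X := (spX S).
Local Notation pr := (@proj R n I S).
Local Notation ta := (@tact R n I S).
Local Notation cov := (@cov R n I S).
Local Notation sec := (@sec R n I S).
Local Notation s := (@scoch R n I S).
Local Notation pcov := (pcov S).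

Variable A : xsys R X n.
Hypothesis hAct : is_cstar A.
Hypothesis hC : forall f (a : A), Cb f -> mem a -> mem (cmul f a).
Variables (J : Type) (V : J -> set X) (g : J -> J -> X -> (H -> H) -> H -> H).
Hypothesis hK : is_K_bundle ip V g.
Variable p0 : A -> section_alg ip V g.
Hypothesis hp : star_iso p0.
Hypothesis hl : linear_over (@Cb R X) p0.
Hypothesis hBr : in_Br ip ta A.
Variable D : choices H A.
Hypothesis hD : are_choices ip D.
Local Notation AP := (Aphi ip D).

Let cA := cstar_closed hAct.
Let hX := X_hausdorff hS.
Let psi : A -> AP := @ind R H n I S A D.

Let hpsi : @star_iso R A AP psi := ind_star_iso hH hS hAct hC hK hp hl hBr hD.
Let hlin : @linear_over R X A AP (@Cb R X) psi := ind_linear hS hC hp hl hBr hD.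
Let hact r (a : A) : mem a -> psi (act r a) = @act _ _ _ AP r (psi a) :=
  @ind_act _ _ _ _ _ _ _ hBr D r a.

Implicit Types (xi eta : AP) (i : I).

Lemma xi_comp xi i t z : mem xi -> pcov i z -> compact_op (xi i t z).
Proof. by move=> [h _ _ _ _] iz; have [h1 _ _ _] := h i t; exact: h1. Qed.
Lemma xi_off xi i t z : mem xi -> ~ pcov i z -> xi i t z = 0.
Proof. by move=> [h _ _ _ _] iz; have [_ h1 _ _] := h i t; exact: h1. Qed.
Lemma xi_bop xi i t z : mem xi -> bop (xi i t z).
Proof.
move=> mx; have [iz|iz] := pselect (pcov i z); first exact/compact_bop/xi_comp.
by rewrite xi_off //; exact: bop0.
Qed.

Lemma aphi_le xi (M : R) : 0 <= M -> (forall i t z, pcov i z -> opnorm (xi i t z) <= M) -> nrm xi <= M.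
Proof.
move=> M0 h; rewrite /nrm /=; set E := (X in sup X).
have [->|/set0P E0] := eqVneq E set0; first by rewrite sup0.
by apply: ge_sup => // _ [i [t [z iz ->]]]; exact: h.
Qed.

Lemma aphi_nrm_ge0 xi : 0 <= nrm xi.
Proof.
rewrite /nrm /=; set E := (X in sup X).
have [[[r Er] ub]|hs] := pselect (has_sup E); last by rewrite sup_out.
apply: (@le_trans _ _ r); last by apply: ub_le_sup.
by case: Er => i [t [z _ ->]]; exact: opnorm_ge0.
Qed.

(** [in_Aphi] bounds each xi i t separately. The bound uniform in i and t, which makes the supremum
    meaningful, comes from writing xi as the image of some a in A ([fib_le]). *)
Lemma aphi_ub xi i t z : mem xi -> pcov i z -> opnorm (xi i t z) <= nrm xi.
Proof.
move=> /(si_surj hpsi)[a ma <-] iz; apply: ub_le_sup; last by exists i, t; exists z.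
exists (nrm a) => _ [i' [t' [z' iz' ->]]]; rewrite /psi indE //.
exact: (fib_le hH hS hAct hC hp hl hBr hD).
Qed.

Lemma psi_le (a : A) : mem a -> nrm (psi a) <= nrm a.
Proof.
move=> ma; apply: aphi_le; first exact: (nrm_ge0 hAct).
by move=> i t z iz; rewrite /psi indE //; exact: (fib_le hH hS hAct hC hp hl hBr hD).
Qed.

Lemma xi_indep xi i t z i' t' z' : mem xi -> pcov i z -> pcov i' z' ->
  ta t (sec i z) = ta t' (sec i' z') -> opnorm (xi i t z) = opnorm (xi i' t' z').
Proof.
move=> /(si_surj hpsi)[a ma <-] iz iz' e; rewrite /psi !indE //.
by rewrite !(fib_snorm hH hS hAct hC hK hp hl hBr hD) // e.
Qed.

(** Of [psi] only contractivity has been established, so a Cauchy sequence is not pulled back to A.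
    Limits are taken fibrewise in the compacts; convergence is uniform in i, t, z, so the conditions
    of [in_Aphi] hold for the limit up to arbitrarily small errors. *)
Lemma aphi_complete (u : nat -> AP) : (forall k, mem (u k)) ->
  (forall e : R, 0 < e -> exists N, forall p q, (N <= p)%N -> (N <= q)%N -> nrm (u p - u q) < e) ->
  exists2 xi, mem xi & forall e : R, 0 < e -> exists N, forall p, (N <= p)%N -> nrm (u p - xi) < e.
Proof.
move=> mu hu.
have cmem (a b : AP) : mem a -> mem b -> mem (a - b).
  move=> /(si_surj hpsi)[a' ma <-] /(si_surj hpsi)[b' mb <-].
  by rewrite -(siB cA hpsi) //; apply: (si_mem hpsi); exact: acB.
have hpt i t z : pcov i z -> exists T, compact_op T /\
    forall e : R, 0 < e -> exists N, forall p, (N <= p)%N -> opnorm (u p i t z - T) < e.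
  move=> iz; have [||T cT hT] := @compact_limit R H (fun k => u k i t z); last by exists T.
    by move=> k; exact: xi_comp.
  move=> e e0; have [N hN] := hu e e0; exists N => p q Np Nq.
  by apply: le_lt_trans (hN p q Np Nq); exact: (aphi_ub _ (cmem _ _ (mu p) (mu q)) iz).
pose xi : AP := fun i t z => if pselect (pcov i z) is left iz then sval (cid (hpt i t z iz)) else 0.
have xiP i t z : pcov i z -> compact_op (xi i t z) /\
    forall e : R, 0 < e -> exists N, forall p, (N <= p)%N -> opnorm (u p i t z - xi i t z) < e.
  by move=> iz; rewrite /xi; case: pselect => // iz'; case: cid.
have xi0 i t z : ~ pcov i z -> xi i t z = 0.
  by move=> iz; rewrite /xi; case: pselect.
have bxi i t z : pcov i z -> bop (xi i t z) by move=> iz; exact: compact_bop (xiP i t z iz).1.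
have bu k i t z : bop (u k i t z) by exact: xi_bop.
have unif (e : R) : 0 < e -> exists N, forall p i t z, (N <= p)%N -> pcov i z ->
    opnorm (u p i t z - xi i t z) <= e.
  move=> e0; have [N hN] := hu e e0; exists N => p i t z Np iz.
  apply/ler_addgt0Pr => d d0; have [N' hN'] := (xiP i t z iz).2 d d0.
  pose q := maxn N N'.
  rewrite (le_trans (opnorm_tri (bu p i t z) (bu q i t z) (bxi _ _ _ iz))) //.
  rewrite lerD ?(ltW (hN' _ (leq_maxr _ _))) // ltW //.
  apply: le_lt_trans (hN p q Np (leq_maxl _ _)).
  exact: (aphi_ub _ (cmem _ _ (mu p) (mu q)) iz).
have third (e : R) : 0 < e -> exists N, forall i t z, pcov i z -> opnorm (u N i t z - xi i t z) <= e.
  by move=> /unif[N hN]; exists N => i t z; exact: hN.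
have small T : bop T -> (forall e : R, 0 < e -> opnorm T <= e + e) -> T = 0.
  move=> bT h; apply: opnorm0_eq0 => //; apply/eqP; rewrite eq_le opnorm_ge0 andbT.
  apply/ler_addgt0Pr => e e0; rewrite add0r [leRHS]splitr; apply: h.
  by rewrite divr_gt0.
have mxi : mem xi.
  split.
  - move=> i t; split.
    + by move=> z iz; have [] := xiP i t z iz.
    + exact: xi0.
    + apply/(ncP _ (pcov_open hS i)) => z iz e e0.
      have [N hN] := third (e / 4) (divr_gt0 e0 (ltr0n _ 4)).
      have [h1 _ _ _ _] := mu N; have [_ _ h2 _] := h1 i t.
      have := (ncP _ (pcov_open hS i)).1 h2 z iz (e / 4) (divr_gt0 e0 (ltr0n _ 4)) => h3.
      apply: filterS (filterI h3 (open_nbhs_nbhs (conj (pcov_open hS i) iz))) => y [h4 iy].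
      have a1 := hN i t y iy; have a2 := hN i t z iz.
      have b1 := opnorm_tri (bxi i t y iy) (bu N i t y) (bxi i t z iz).
      have b2 := opnorm_tri (bu N i t y) (bu N i t z) (bxi i t z iz).
      rewrite opnormB in a1; lra.
    + have [N hN] := third 1 ltr01; exists (nrm (u N) + 1) => z iz.
      have := opnormD (bopB (bxi i t z iz) (bu N i t z)) (bu N i t z); rewrite subrK opnormB => h.
      by rewrite (le_trans h) // addrC lerD ?hN // aphi_ub.
  - move=> i t e e0.
    have [N hN] := third (e / 4) (divr_gt0 e0 (ltr0n _ 4)).
    have [_ h1 _ _ _] := mu N.
    apply: filterS (h1 i t (e / 4) (divr_gt0 e0 (ltr0n _ 4))) => t' h2 z iz.
    have a1 := hN i t' z iz; have a2 := hN i t z iz; have a3 := h2 z iz.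
    have b1 := opnorm_tri (bxi i t' z iz) (bu N i t' z) (bxi i t z iz).
    have b2 := opnorm_tri (bu N i t' z) (bu N i t z) (bxi i t z iz).
    rewrite opnormB in a1; lra.
  - move=> i t m z iz; apply/subr0_eq.
    have uv := vpow_unitary hH hS hD (- m) iz.
    have bA := Ad_bop hH uv (bxi i t z iz); have b1 := bxi i (t + lattice R m) z iz.
    apply: small; first exact: bopB.
    move=> e e0; have [N hN] := third e e0.
    have [_ _ h1 _ _] := mu N; have h2 := h1 i t m z iz.
    have bu1 := bu N i (t + lattice R m) z.
    rewrite (le_trans (opnorm_tri b1 bu1 bA)) // lerD //.
      by rewrite opnormB hN.
    rewrite h2 -AdB; last by case: uv.
    by rewrite (opnorm_Ad hH uv) ?hN //; apply: bopB => //; exact: bxi.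
  - move=> i j t z [iz jz]; apply/subr0_eq.
    have uv := vtrans_unitary hD iz jz.
    have bA := Ad_bop hH uv (bxi i t z iz); have b1 := bxi j (t + s i j z) z jz.
    apply: small; first exact: bopB.
    move=> e e0; have [N hN] := third e e0.
    have [_ _ _ h1 _] := mu N; have h2 := h1 i j t z (conj iz jz).
    have bu1 := bu N j (t + s i j z) z.
    rewrite (le_trans (opnorm_tri bA bu1 b1)) // lerD ?hN //.
    rewrite -h2 opnormB.
    rewrite -AdB; last by case: uv.
    by rewrite (opnorm_Ad hH uv) ?hN //; apply: bopB => //; exact: bxi.
  - move=> e e0; set E := [set x | _].
    pose F (w : AP) (d : R) := [set x | exists i t z,
       [/\ pcov i z, x = ta t (sec i z) & d <= opnorm (w i t z)]].
    have cF k (d : R) : 0 < d -> compact (F (u k) d).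
      by move=> d0; have [_ _ _ _ h] := mu k; exact: h.
    (* If u_k is within d of xi everywhere, then |xi| >= e forces |u_k| >= e - d, and letting d tend
       to 0 gives the converse. Each level set of u_k is compact, d < e keeping the level positive,
       so E is a closed subset of a compact set. *)
    have EE : E = \bigcap_(kd in [set kd : nat * R | [/\ 0 < kd.2, kd.2 < e &
        forall i t z, pcov i z -> opnorm (u kd.1 i t z - xi i t z) <= kd.2]])
        F (u kd.1) (e - kd.2).
      apply/seteqP; split=> x.
        move=> [i [t [z [iz xE h]]]] [k d] /= [d0 de hk]; exists i, t, z; split=> //.
        have := opnormD (bopB (bxi i t z iz) (bu k i t z)) (bu k i t z); rewrite subrK opnormB.
        have := hk i t z iz; lra.
      move=> h; have [i [t [iz xE]]] := cover_ex hS x; exists i, t, (pr x); split=> //.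
      apply/ler_addgt0Pr => d d0; pose d' := Num.min (d / 2) (e / 2).
      have d'0 : 0 < d' by rewrite lt_min !divr_gt0.
      have d'd : d' <= d / 2 by rewrite ge_min lexx.
      have d'e : d' <= e / 2 by rewrite ge_min lexx orbT.
      have [N hN] := third d' d'0.
      have [|i' [t' [z' [iz' xE' h']]]] := h (N, d').
        by split=> //=; rewrite (le_lt_trans d'e) // ltr_pdivrMr // ltr_pMr // ltr1n.
      have eN : opnorm (u N i t (pr x)) = opnorm (u N i' t' z').
        by apply: xi_indep => //; rewrite -xE.
      have {}h' : e - d' <= opnorm (u N i t (pr x)) by rewrite eN.
      have := opnormD (bopB (bu N i t (pr x)) (bxi i t (pr x) iz)) (bxi i t (pr x) iz); rewrite subrK.
      have := hN i t (pr x) iz; lra.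
    have [N hN] := third (e / 2) (divr_gt0 e0 (ltr0n _ 2)).
    have e2 : e / 2 < e by rewrite ltr_pdivrMr // ltr_pMr // ltr1n.
    apply: (subclosed_compact _ (cF N (e - e / 2) _)); last first.
    + rewrite EE => x /(_ (N, e / 2)); apply; split=> //=; first by rewrite divr_gt0.
    + by rewrite subr_gt0.
    + rewrite EE; apply: closed_bigI => -[k d] /= [d0 de _].
      by apply: compact_closed => //; apply: cF; rewrite subr_gt0.
exists xi => // e e0; have [N hN] := unif (e / 2) (divr_gt0 e0 (ltr0n _ 2)).
exists N => p Np; rewrite (@le_lt_trans _ _ (e / 2)) //.
  by apply: aphi_le => [|i t z iz]; [rewrite divr_ge0 // ltW|exact: hN].
by rewrite ltr_pdivrMr // ltr_pMr // ltr1n.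
Qed.

Lemma aphi_cstar : is_cstar AP.
Proof.
apply: (cstar_transport hAct hpsi).
- move=> xi mx n0; apply/funext => i; apply/funext => t; apply/funext => z.
  have [iz|iz] := pselect (pcov i z); last exact: xi_off.
  apply: opnorm0_eq0; first exact: xi_bop.
  by apply/eqP; rewrite eq_le opnorm_ge0 andbT -n0 aphi_ub.
- move=> a b ma mb; apply: aphi_le; first by rewrite addr_ge0 ?aphi_nrm_ge0.
  move=> i t z iz; have := opnormD (xi_bop i t z ma) (xi_bop i t z mb) => h.
  by rewrite (le_trans h) // lerD // aphi_ub.
- have le (c : R[i]) (a : AP) : mem a -> nrm (c *: a) <= cn c * nrm a.
    move=> ma; apply: aphi_le; first by rewrite mulr_ge0 ?cn_ge0 ?aphi_nrm_ge0.
    move=> i t z iz; rewrite (opnormZ c (xi_bop i t z ma)) ler_wpM2l ?cn_ge0 //.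
    exact: aphi_ub.
  move=> c a ma; apply/eqP; rewrite eq_le; apply/andP; split; first exact: le.
  have [->|c0] := eqVneq c 0; first by rewrite normr0 mul0r aphi_nrm_ge0.
  have cc : 0 < cn c.
    by rewrite lt_neqAle cn_ge0 eq_sym andbT; apply: contra c0 => /eqP/cn0_eq0 ->.
  have mca : mem (c *: a).
    move: ma => /(si_surj hpsi)[a' ma' <-]; rewrite -(siZ _ cA hpsi) //.
    by apply: (si_mem hpsi); exact: acZ.
  rewrite -/(cn c) mulrC -ler_pdivlMr //; apply: aphi_le.
    by rewrite divr_ge0 ?aphi_nrm_ge0 // ltW.
  move=> i t z iz; rewrite ler_pdivlMr // mulrC -(opnormZ c (xi_bop i t z ma)).
  exact: (aphi_ub t mca iz).
- move=> a b ma mb; apply: aphi_le; first by rewrite mulr_ge0 ?aphi_nrm_ge0.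
  move=> i t z iz; have := opnorm_comp (xi_bop i t z ma) (xi_bop i t z mb) => h.
  by rewrite (le_trans h) // ler_pM ?opnorm_ge0 // aphi_ub.
- move=> a ma; apply/eqP; rewrite eq_le; apply/andP; split.
    apply: aphi_le; first by rewrite exprn_ge0 // aphi_nrm_ge0.
    move=> i t z iz; have := opnorm_cstar hH (xi_bop i t z ma) => h.
    rewrite [X in X <= _]h ler_sqr ?nnegrE ?opnorm_ge0 ?aphi_nrm_ge0 //.
    exact: aphi_ub.
  have maa : mem (mul (star a) a).
    move: ma => /(si_surj hpsi)[a' ma' <-]; rewrite -(si_star hpsi) // -(si_mul hpsi) //.
      by apply: (si_mem hpsi); apply: acM => //; exact: acS.
    exact: acS.
  have h : nrm a <= Num.sqrt (nrm (mul (star a) a)).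
    apply: aphi_le => [|i t z iz]; first exact: sqrtr_ge0.
    rewrite -(ger0_norm (opnorm_ge0 (a i t z))) -sqrtr_sqr ler_sqrt ?aphi_nrm_ge0 //.
    rewrite -(opnorm_cstar hH (xi_bop i t z ma)).
    exact: (aphi_ub t maa iz).
  rewrite -ler_sqr ?nnegrE ?sqrtr_ge0 ?aphi_nrm_ge0 // sqr_sqrtr // in h.
  exact: aphi_nrm_ge0.
- exact: aphi_complete.
Qed.

Lemma inv_ex : exists phi : AP -> A, [/\ @star_iso R AP A phi,
    forall a : A, mem a -> phi (psi a) = a & forall xi, mem xi -> psi (phi xi) = xi].
Proof. exact: (star_iso_inv cA hpsi). Qed.

Lemma aphi_in_Br : in_Br ip ta AP.
Proof.
have [phi [hphi phiK psiK]] := inv_ex.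
have mphi xi : mem xi -> mem (phi xi) by exact: si_mem.
have plin f xi : Cb f -> mem xi -> phi (cmul f xi) = cmul f (phi xi).
  by move=> hf mx; rewrite -{1}(psiK _ mx) -hlin ?phiK //; [exact/hC/mphi|exact: mphi].
have cmem f xi : Cb f -> mem xi -> mem (cmul f xi).
  move=> hf mx; have e := hlin hf (mphi _ mx); rewrite -(psiK _ mx) -e.
  by apply: (si_mem hpsi); exact/hC/mphi.
have [_ hst _ hcont _] := hBr.
split.
- split; [exact: aphi_cstar|exact: cmem|].
  exists J, V, g, (p0 \o phi); split=> //; first exact: star_iso_comp hphi hp.
  by move=> f xi hf mx; rewrite /= plin // hl //; exact: mphi.
- move=> t; apply: (@star_iso_ext _ AP AP (psi \o (@act _ _ _ A t \o phi))).
  + exact: cstar_closed aphi_cstar.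
  + by move=> xi mx; rewrite /= hact ?psiK //; exact: mphi.
  + by apply: star_iso_comp hpsi; exact: star_iso_comp hphi (hst t).
- move=> xi mx; split=> [|t t'].
    apply/funext => i; apply/funext => t; apply/funext => z.
    by rewrite -[LHS]/(xi i (t - 0) z) subr0.
  apply/funext => i; apply/funext => r; apply/funext => z.
  by rewrite -[LHS]/(xi i (r - (t + t')) z) -[RHS]/(xi i (r - t - t') z) opprD addrA.
- move=> xi mx t e e0; have := hcont _ (mphi _ mx) t e e0; apply: filterS => t'.
  have m1 r : mem (act r (phi xi)) by apply: (si_mem (hst _)); exact: mphi.
  apply: le_lt_trans; rewrite -{1 2}(psiK _ mx) -!(hact _ (mphi _ mx)) -(siB cA hpsi) //.
  by apply: psi_le; exact: acB.
- move=> t f xi hf mx; apply/funext => i; apply/funext => r; apply/funext => z.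
  rewrite -[LHS]/(f (ta (r - t) (sec i z)) *: xi i (r - t) z).
  by rewrite -[RHS]/(f (ta (- t) (ta r (sec i z))) *: xi i (r - t) z) -(taD hS) addrC.
Qed.

Lemma aphi_outer : outer_conjugate A AP.
Proof.
have [_ hst h0 _ _] := hBr.
exists psi, (fun=> (id, id)); split.
- split=> // f a hf ma; apply: hlin => //.
  exact: (C0_Cb hX openT hf).
- move=> t; split; first by split=> //=.
  by move=> a ma; split=> //=; exact: (cs_starK hAct).
- by move=> a ma; split=> t e e0; apply: filterE => t'; rewrite subrr (nrm0 hAct).
- move=> t a ma; rewrite /= (cs_starK hAct) ?hact //.
  exact: (si_mem (hst t)).
- move=> t t' a ma; have e r : act r (act (- r) a) = a.
    by have [e0 eD] := h0 a ma; rewrite -eD subrr e0.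
  by split=> /=; rewrite e.
Qed.

Lemma aphi_choices : exists D' : choices H AP, are_choices ip D' /\ cocycle_of ip D' = cocycle_of ip D.
Proof.
have [phi [hphi phiK psiK]] := inv_ex.
have mphi xi : mem xi -> mem (phi xi) by exact: si_mem.
have plin f xi : Cb f -> mem xi -> phi (cmul f xi) = cmul f (phi xi).
  by move=> hf mx; rewrite -{1}(psiK _ mx) -hlin ?phiK //; [exact/hC/mphi|exact: mphi].
have pact t xi : mem xi -> phi (act t xi) = act t (phi xi).
  have [_ hst _ _ _] := hBr.
  move=> mx; have e := hact t (mphi _ mx); rewrite -{1}(psiK _ mx) -e phiK //.
  by apply: (si_mem (hst _)); exact: mphi.
have oU i := cov_open hS i.
have hCAP f xi : Cb f -> mem xi -> mem (cmul f xi).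
  move=> hf mx; have e := hlin hf (mphi _ mx); rewrite -(psiK _ mx) -e.
  by apply: (si_mem hpsi); exact/hC/mphi.
have rm i xi : @mem R (restr AP (cov i)) xi -> mem xi.
  by move=> [f hf [b mb <-]]; exact (hCAP _ _ (C0_Cb hX (oU i) hf) mb).
have rphi i xi : @mem R (restr AP (cov i)) xi -> @mem R (restr A (cov i)) (phi xi).
  move=> [f hf [b mb <-]]; exists f => //; exists (phi b); first exact: mphi.
  by rewrite plin //; exact: (C0_Cb hX (oU i) hf).
have [d1 d2 d3 d4 d5] := hD.
have siphi i : @star_iso R (restr AP (cov i)) (restr A (cov i)) phi.
  apply: star_isoI.
  - exact: rphi.
  - by move=> a b /rm ma /rm mb; exact: (si_inj hphi).
  - move=> _ [f hf [a ma <-]]; have cf := C0_Cb hX (oU i) hf.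
    exists (cmul f (psi a)); first by exists f => //; exists (psi a) => //; exact: (si_mem hpsi).
    by rewrite plin ?phiK //; exact: (si_mem hpsi).
  - by move=> t a b /rm ma /rm mb; exact: (si_lin hphi).
  - by move=> a b /rm ma /rm mb; exact: (si_mul hphi).
  - by move=> a /rm ma; exact: (si_star hphi).
exists (Choices (fun i (xi : AP) => Phi D i (phi xi)) (vgen D) (vtrans D)); split; last reflexivity.
have ivE' i xi y : mem xi -> induced_value (cov i) (fun xi : AP => Phi D i (phi xi)) xi y =
    induced_value (cov i) (Phi D i) (phi xi) y.
  move=> mx; rewrite /induced_value plin //.
  (* The point y need not lie in the cover set, so the cut-off may be the default 0; this too is
     bounded and continuous. *)
  case: xgetP => [f _ [hf _]|_]; first exact: (C0_Cb hX (oU i) hf).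
  by split; [move=> x; exact: cvg_cst|exists 0 => x; rewrite normr0].
split=> /=.
- move=> i; have [e1 e2] := d1 i; split; first exact: star_iso_comp (siphi i) e1.
  move=> f xi hf mx; have cf := C0_Cb hX (oU i) hf.
  by rewrite plin ?e2 //; [exact: rphi|exact: rm mx].
- exact: d2.
- move=> i k xi y mx Uy; rewrite pact; last exact: rm mx.
  by apply: d3 => //; exact: rphi.
- exact: d4.
- move=> i j z ijz xi mx; rewrite /= ivE'; last first.
    by have [_ h _ _ _] := aphi_in_Br; exact: (si_mem (h _)).
  by rewrite pact // ivE' //; apply: d5 => //; exact: mphi.
Qed.

End AphiAlgebra.

Lemma Aphi_outer_conjugate (R : realType) (H : completeNormedModType R[i])
    (ip : H -> H -> R[i]) (n : nat) (I : Type) (S : setup R n I)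
    (A : xsys R (spX S) n) (D : choices H A) :
  is_hilbert ip -> is_standard_setup S -> in_Br ip (@tact R n I S) A -> are_choices ip D ->
  [/\ in_Br ip (@tact R n I S) (Aphi ip D), outer_conjugate A (Aphi ip D) &
    exists D' : choices H (Aphi ip D), are_choices ip D' /\ cocycle_of ip D' = cocycle_of ip D].
Proof.
move=> hH hS hBr hD; have [[hAct hC [J [V [g [p0 [hK hp hl]]]]]] _ _ _ _] := hBr.
split.
- exact: (aphi_in_Br hH hS hAct hC hK hp hl hBr hD).
- exact: (aphi_outer hH hS hAct hC hK hp hl hBr hD).
- exact: (aphi_choices hH hS hAct hC hK hp hl hBr hD).
Qed.

(** The function max(0, 1 - 2 a) is 2-Lipschitz; this gives the continuity of the step size in
    [lift_vector]. *)
Lemma max_lip (R : realType) (a b d : R) : - (d / 2) <= a - b <= d / 2 ->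
  `|Num.max 0 (1 - 2 * a) - Num.max 0 (1 - 2 * b)| <= d.
Proof.
move=> /andP[h1 h2]; rewrite /Order.max ler_norml.
by case: (ltP 0 (1 - 2 * a)) => ?; case: (ltP 0 (1 - 2 * b)) => ?; apply/andP; split; lra.
Qed.

(** * Lifting automorphisms of K to unitaries *)

Section Lifting.
Variables (R : realType) (H : completeNormedModType R[i]).
Variable ip : H -> H -> R[i].
Hypothesis hH : is_hilbert ip.
Local Notation Kalg := (@Kalg R H ip).

Lemma app_cvg (Y : topologicalType) (F : Y -> H -> H) (x : Y -> H) y :
  (\forall z \near y, bop (F z)) -> ncat F y -> x @ y --> x y ->
  (fun z => F z (x z)) @ y --> F y (x y).
Proof.
move=> bF cF /cvg_nrP cx; apply/cvg_nrP => e e0.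
have bFy := nbhs_singleton bF.
pose K := nr (x y) + 1 + opnorm (F y) + 1.
have K0 : 0 < K by rewrite /K; have := nr_ge0 (x y); have := opnorm_ge0 (F y); lra.
have d0 : 0 < Num.min 1 (e / K) by rewrite lt_min ltr01 divr_gt0.
set d := Num.min _ _ in d0.
have d1 : d <= 1 by rewrite /d ge_min lexx.
have dK : d * K <= e by rewrite -ler_pdivlMr // /d ge_min lexx orbT.
apply: filterS (filterI bF (filterI (cF d d0) (cx d d0))) => z [bz [h1 h2]].
have -> : F z (x z) - F y (x y) = (F z - F y) (x z) + F y (x z - x y).
  rewrite linB; last by case: bFy.
  by rewrite -[(F z - F y) (x z)]/(F z (x z) - F y (x z)) addrA subrK.
rewrite (le_lt_trans (nrD _ _)) //.
have a1 := opnorm_ub (x z) (bopB bz bFy); have a2 := opnorm_ub (x z - x y) bFy.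
have a3 : nr (x z) <= nr (x y) + 1.
  have := nrD (x z - x y) (x y); rewrite subrK; lra.
have a4 := nr_ge0 (x z); have a5 := opnorm_ge0 (F y); have a6 := opnorm_ge0 (F z - F y).
have a7 : opnorm (F z - F y) * nr (x z) <= d * (nr (x y) + 1).
  by apply: ler_pM => //; exact: ltW.
have a8 : opnorm (F y) * nr (x z - x y) <= opnorm (F y) * d.
  by rewrite ler_wpM2l // ltW.
have : d * K = d * (nr (x y) + 1) + opnorm (F y) * d + d by rewrite /K; ring.
lra.
Qed.

Lemma real_cvg (T : Type) (F : set_system T) (FF : Filter F) (h : T -> R) (a : R) :
  h @ F --> a -> (fun x => (h x)%:C : R[i]^o) @ F --> (a%:C : R[i]^o).
Proof.
move=> ch; apply/cvg_nrP => e e0; have /cvgrPdist_lt/(_ _ e0) := ch.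
apply: filterS => y.
by rewrite -rmorphB /= /nr normc_def /= expr0n addr0 sqrtr_sqr distrC.
Qed.

Lemma nr_cvg (T : Type) (F : set_system T) (FF : Filter F) (x : T -> H) a :
  x @ F --> a -> (fun t => nr (x t)) @ F --> nr a.
Proof.
move=> /cvg_nrP cx; apply/cvgrPdist_lt => e e0; apply: filterS (cx e e0) => t h.
by rewrite distrC (le_lt_trans (nr_dist _ _)).
Qed.

Definition unitize (v : H) : H := (nr v)^-1%:C *: v.

Lemma nr_unitize v : v != 0 -> nr (unitize v) = 1.
Proof.
by move=> v0; rewrite nrZ_pos ?invr_ge0 ?nr_ge0 // mulVf // gt_eqF // nr_gt0.
Qed.

Lemma unitize_id v : nr v = 1 -> unitize v = v.
Proof. by move=> v1; rewrite /unitize v1 invr1 rmorph1 scale1r. Qed.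

Lemma unitize_cvg (T : Type) (F : set_system T) (FF : Filter F) (x : T -> H) a :
  a != 0 -> x @ F --> a -> (fun t => unitize (x t)) @ F --> unitize a.
Proof.
move=> a0 cx; apply: cvgZ => //; apply: real_cvg; apply: cvgV.
  by rewrite gt_eqF // nr_gt0.
exact: nr_cvg.
Qed.

Variable e : H.
Hypothesis e1 : nr e = 1.
Variable Z : topologicalType.
Variable W : set Z.
Hypothesis oW : open W.
Hypothesis cW : contractible R W.
Variable th : Z -> Kalg -> Kalg.
Hypothesis hth : forall z, W z -> star_iso (th z).
Hypothesis cth : forall T, compact_op T -> norm_continuous W (fun z => th z T).

Let P z : H -> H := th z (ketbra ip e e).

Let Pfacts z : W z -> [/\ bop (P z), P z \o P z = P z & exists2 xi, nr xi = 1 & P z xi = xi].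
Proof. by move=> Wz; have [h1 h2 _ h3] := Kiso_proj hH e1 (hth Wz). Qed.

Let Pncat z : W z -> ncat P z.
Proof. by move=> Wz; apply: ((ncP _ oW).1 (cth (compact_ketbra hH e e))). Qed.

(** Extends the homotopy to all real parameters, constant outside [0, 1], so that the steps of the
    transport may overshoot 0. *)
Definition clamp (t : R) : R := Num.max 0 (Num.min 1 t).

Lemma clamp01 t : 0 <= clamp t <= 1.
Proof. by rewrite /clamp le_max lexx /= ge_max ler01 ge_min lexx. Qed.

Lemma clamp_id t : 0 <= t <= 1 -> clamp t = t.
Proof. by move=> /andP[t0 t1]; rewrite /clamp min_r // max_r. Qed.

Lemma clamp_le0 t : t <= 0 -> clamp t = 0.
Proof. by move=> t0; rewrite /clamp min_r ?max_l // (le_trans t0 ler01). Qed.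

Lemma clamp_lip t u : `|clamp t - clamp u| <= `|t - u|.
Proof.
have mx (a b : R) : `|Num.max 0 a - Num.max 0 b| <= `|a - b|.
  have := ler_norm (a - b); have := ler_norm (b - a); rewrite (distrC b a) /Order.max.
  move: `|a - b| => w; rewrite ler_norml.
  by case: (ltP 0 a) => ?; case: (ltP 0 b) => ? ? ?; apply/andP; split; lra.
have mn (a b : R) : `|Num.min 1 a - Num.min 1 b| <= `|a - b|.
  have := ler_norm (a - b); have := ler_norm (b - a); rewrite (distrC b a) /Order.min.
  move: `|a - b| => w; rewrite ler_norml.
  by case: (ltP 1 a) => ?; case: (ltP 1 b) => ? ? ?; apply/andP; split; lra.
exact: le_trans (mx _ _) (mn _ _).
Qed.

(* P (h (t, z)) is a path of rank one projections from P z to a projection that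
   does not depend on z.  [G z] is a positive step, continuous in z, such that
   projections at parameters closer than [G z] are at distance < 1/2.  A range
   vector at t = 1 is transported to t = 0 in steps of G z / 2 by projecting
   and normalising; after the parameter has become negative it is stationary,
   whence continuity although the number of steps depends on z. *)
Lemma lift_vector : exists xi : Z -> H, forall z, W z ->
  [/\ nr (xi z) = 1, P z (xi z) = xi z & xi @ z --> xi z].
Proof.
have [x0 Wx0 [h hc hW]] := cW.
pose hh t z := h (clamp t, z).
have hhW t z : W z -> W (hh t z).
  by move=> Wz; have [h1 _ _] := hW z Wz; apply: h1; exact: clamp01.
pose Q t z := P (hh t z).
have bQ t z : W z -> bop (Q t z) by move=> Wz; have [] := Pfacts (hhW t z Wz).
have Qjoint t0 z0 (d : R) : W z0 -> 0 < d -> exists2 r : R, 0 < r & exists2 B, nbhs z0 B &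
    forall t z, `|t - t0| < r -> B z -> opnorm (Q t z - Q t0 z0) < d.
  move=> Wz0 d0; have Wh := hhW t0 z0 Wz0.
  have /subspace_continuousP hc' := hc.
  have A0 : (`[0, 1]%classic `*` W) (clamp t0, z0).
    by split => //=; rewrite in_itv /=; exact: clamp01.
  have := hc' _ A0 _ (Pncat Wh d0).
  rewrite /= /nbhs /= => -[[B1 B2] /= [n1 n2] hB].
  have /nbhs_ballP[r /= r0 hr] := n1.
  exists r => //; exists (B2 `&` W); first by apply: filterI => //; exact: open_nbhs_nbhs.
  move=> t z tt [B2z Wz]; apply: (hB (clamp t, z)).
    split => //=; apply: hr; rewrite -ball_normE /= distrC.
    exact: le_lt_trans (clamp_lip _ _) tt.
  by split => //=; rewrite in_itv /=; exact: clamp01.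
pose Df t t' z := opnorm (Q t z - Q t' z).
(* When |t - t'| is below the infimum G z of f z, the second summand must be positive at (t, t'),
   i.e. the projections are at distance below 1/2. An infimum of functions that vary uniformly with
   z is continuous in z. *)
pose f z (tt : R * R) := `|tt.1 - tt.2| + Num.max 0 (1 - 2 * Df tt.1 tt.2 z).
pose E := [set tt : R * R | 0 <= tt.1 <= 1 /\ 0 <= tt.2 <= 1].
pose G z := inf (f z @` E).
have E0 z : (f z @` E) !=set0.
  by exists (f z (0, 0)); exists (0, 0) => //; rewrite /E /= lexx ler01.
have f0 z tt : 0 <= f z tt by rewrite /f addr_ge0 // le_max lexx.
have Gle z tt : E tt -> G z <= f z tt.
  by move=> Ett; apply: ge_inf; [exists 0 => _ [x _ <-]|exists tt].
have Gge z m : (forall tt, E tt -> m <= f z tt) -> m <= G z.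
  by move=> hm; apply: lb_le_inf => // _ [tt Ett <-]; exact: hm.
have c01 : compact `[(0 : R), 1]%classic by exact: segment_compact.
(* Compactness of [0, 1] makes Q t z close to Q t z0 uniformly in t. The error doubles three times:
   d / 8 from joint continuity, d / 4 for one projection, d / 2 for a distance of two, d after
   [max_lip]. *)
have Gcont z0 : W z0 -> G @ z0 --> G z0.
  move=> Wz0; apply/cvgrPdist_le => d d0.
  have d4 : 0 < d / 4 by rewrite divr_gt0.
  have d8 : 0 < d / 8 by rewrite divr_gt0.
  have nc : \forall z \near z0, `[(0 : R), 1]%classic `<=` [set t | opnorm (Q t z - Q t z0) < d / 4].
    move/compact_near_coveringP : c01; apply => t0 _.
    have [r r0 [B nB hB]] := Qjoint t0 z0 (d / 8) Wz0 d8.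
    exists ([set t | `|t - t0| < r], B `&` W).
      split; last by apply: filterI => //; exact: open_nbhs_nbhs.
      by apply/nbhs_ballP; exists r => // t; rewrite -ball_normE /= distrC.
    move=> [t z] [/= tt [Bz Wz]].
    have a1 := hB t z tt Bz; have a2 := hB t z0 tt (nbhs_singleton nB).
    have := opnorm_tri (bQ t z Wz) (bQ t0 z0 Wz0) (bQ t z0 Wz0).
    rewrite [opnorm (Q t0 z0 - _)]opnormB; lra.
  apply: filterS (filterI nc (open_nbhs_nbhs (conj oW Wz0))) => z [hz Wz].
  have hf tt : E tt -> `|f z tt - f z0 tt| <= d.
    move=> [t1 t2]; have a1 : opnorm (Q tt.1 z - Q tt.1 z0) < d / 4 by apply: hz; rewrite /= in_itv.
    have a2 : opnorm (Q tt.2 z - Q tt.2 z0) < d / 4 by apply: hz; rewrite /= in_itv.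
    have b (t : R) : bop (Q t z) by exact: bQ.
    have b' (t : R) : bop (Q t z0) by exact: bQ.
    have a3 := opnorm_dist (bopB (b tt.1) (b tt.2)) (bopB (b' tt.1) (b' tt.2)).
    have a4 : Q tt.1 z - Q tt.2 z - (Q tt.1 z0 - Q tt.2 z0) =
        (Q tt.1 z - Q tt.1 z0) + (Q tt.2 z0 - Q tt.2 z).
      by rewrite opprB addrACA [RHS]addrACA; congr (_ + _); rewrite addrC.
    rewrite a4 in a3; have a5 := opnormD (bopB (b tt.1) (b' tt.1)) (bopB (b' tt.2) (b tt.2)).
    rewrite [opnorm (Q tt.2 z0 - _)]opnormB in a5.
    have a6 : `|Df tt.1 tt.2 z - Df tt.1 tt.2 z0| <= d / 2 by rewrite /Df; lra.
    rewrite /f; move: (Df _ _ z) (Df _ _ z0) a6 => D1 D2; rewrite ler_norml => /andP[c1 c2].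
    by rewrite opprD addrACA subrr add0r max_lip // c1.
  rewrite ler_norml; apply/andP; split.
    suff : G z - d <= G z0 by lra.
    apply: Gge => tt Ett; have := Gle z tt Ett; have := hf tt Ett; rewrite ler_norml => /andP[]; lra.
  suff : G z0 - d <= G z by lra.
  apply: Gge => tt Ett; have := Gle z0 tt Ett; have := hf tt Ett; rewrite ler_norml => /andP[]; lra.
(* By uniform continuity in t, either |t - t'| is at least 1 / (N + 1), or the distance is below 1/4
   and the second summand of f exceeds 1/2. *)
have Gpos z : W z -> 0 < G z.
  move=> Wz.
  have nc : \forall k \near \oo, `[(0 : R), 1]%classic `<=`
      [set t | forall t', `|t - t'| < k.+1%:R^-1 -> opnorm (Q t z - Q t' z) < 1 / 4].
    move/compact_near_coveringP : c01; apply => t0 _.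
    have [r r0 [B nB hB]] := Qjoint t0 z (1 / 8) Wz (divr_gt0 ltr01 (ltr0n _ 8)).
    have Bz := nbhs_singleton nB.
    have r20 : 0 < r / 2 by rewrite divr_gt0.
    have [N hN] := ltr_add_invr r20; rewrite add0r in hN.
    exists ([set t | `|t - t0| < r / 2], [set k | (N <= k)%N]).
      split; last by exists N.
      by apply/nbhs_ballP; exists (r / 2) => // t; rewrite -ball_normE /= distrC.
    move=> [t k] [/= tt Nk] t' tt'.
    have k1 : k.+1%:R^-1 <= N.+1%:R^-1 :> R by rewrite lef_pV2 ?posrE ?ltr0Sn // ler_nat.
    have a1 : opnorm (Q t z - Q t0 z) < 1 / 8 by apply: hB => //; lra.
    have a2 : opnorm (Q t' z - Q t0 z) < 1 / 8.
      apply: hB => //; apply: le_lt_trans (ler_distD t t' t0) _.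
      rewrite [ltRHS]splitr ltrD // distrC (lt_trans tt') //.
      exact: le_lt_trans k1 hN.
    have := opnorm_tri (bQ t z Wz) (bQ t0 z Wz) (bQ t' z Wz).
    rewrite [opnorm (Q t0 z - _)]opnormB; lra.
  have [N _ hN] := nc.
  have N0 : 0 < N.+1%:R^-1 :> R by rewrite invr_gt0.
  apply: (@lt_le_trans _ _ (Num.min N.+1%:R^-1 (1 / 2))).
    by rewrite lt_min N0 divr_gt0.
  apply: Gge => tt [t1 t2]; rewrite /f ge_min.
  have [l|l] := ltP `|tt.1 - tt.2| N.+1%:R^-1; last first.
    by apply/orP; left; rewrite (le_trans l) // lerDl le_max lexx.
  have : Df tt.1 tt.2 z < 1 / 4 by apply: (hN N (leqnn _) tt.1) => //=; rewrite in_itv.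
  move=> hD; apply/orP; right; have := normr_ge0 (tt.1 - tt.2).
  rewrite /Order.max; case: ltP; lra.
have Gclose z t t' : W z -> `|t - t'| < G z -> opnorm (Q t z - Q t' z) < 1 / 2.
  move=> Wz tt.
  have -> : Q t z = Q (clamp t) z by rewrite /Q /hh (clamp_id (clamp01 t)).
  have -> : Q t' z = Q (clamp t') z by rewrite /Q /hh (clamp_id (clamp01 t')).
  have := Gle z (clamp t, clamp t') (conj (clamp01 t) (clamp01 t')).
  rewrite /f /= => h1; have h2 := clamp_lip t t'.
  move: h1; rewrite /Order.max -/(Df _ _ _); case: ltP; lra.
have [xi0 xi01 Pxi0] : exists2 xi, nr xi = 1 & P x0 xi = xi by have [] := Pfacts Wx0.
pose tau k z : R := 1 - k%:R * (G z / 2).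
pose xs := fix xs k z : H := if k is k'.+1 then unitize (Q (tau k'.+1 z) z (xs k' z)) else xi0.
have Q1 z : W z -> Q (tau 0 z) z = P x0.
  move=> Wz; rewrite /Q /hh /tau mul0r subr0 clamp_id ?ler01 ?lexx //.
  by have [_ _ ->] := hW z Wz.
have step k z : W z -> nr (xs k z) = 1 -> Q (tau k z) z (xs k z) = xs k z ->
    Q (tau k.+1 z) z (xs k z) != 0.
  move=> Wz n1 q1; have Gz := Gpos z Wz.
  have lt : `|tau k.+1 z - tau k z| < G z.
    have -> : tau k.+1 z - tau k z = - (G z / 2).
      by rewrite /tau -natr1; ring.
    by rewrite normrN ger0_norm; lra.
  have h1 := Gclose z _ _ Wz lt.
  have h2 := opnorm_ub (xs k z) (bopB (bQ (tau k.+1 z) z Wz) (bQ (tau k z) z Wz)).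
  rewrite -[(_ - _) (xs k z)]/(Q (tau k.+1 z) z (xs k z) - Q (tau k z) z (xs k z)) q1 n1 mulr1 in h2.
  apply/eqP => q0; move: h2; rewrite q0 sub0r nrN n1; lra.
have xsP k z : W z -> nr (xs k z) = 1 /\ Q (tau k z) z (xs k z) = xs k z.
  move=> Wz; elim: k => [|k [n1 q1]]; first by rewrite Q1.
  have q0 := step k z Wz n1 q1; rewrite /=; split; first exact: nr_unitize.
  have bq := bQ (tau k.+1 z) z Wz; rewrite /unitize linZ; last by case: bq.
  have [_ pp _] := Pfacts (hhW (tau k.+1 z) z Wz).
  by rewrite -[Q _ _ (Q _ _ _)]/((P (hh (tau k.+1 z) z) \o P (hh (tau k.+1 z) z)) _) pp.
have tauc k z : W z -> tau k @ z --> tau k z.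
  move=> Wz; apply: cvgB; first exact: cvg_cst.
  apply: cvgM; first exact: cvg_cst.
  by apply: cvgM; [exact: Gcont|exact: cvg_cst].
have xsc k z : W z -> xs k @ z --> xs k z.
  move=> Wz; elim: k => [|k ih]; first exact: cvg_cst.
  have [n1 q1] := xsP k z Wz; have q0 := step k z Wz n1 q1.
  apply: unitize_cvg => //.
  apply: (@app_cvg _ (fun z => Q (tau k.+1 z) z) (xs k)) => //.
    apply: filterS (open_nbhs_nbhs (conj oW Wz)) => y Wy; exact: bQ.
  move=> d d0; have [r r0 [B nB hB]] := Qjoint (tau k.+1 z) z d Wz d0.
  have /cvgrPdist_lt/(_ _ r0) := tauc k.+1 z Wz.
  move=> nt; apply: filterS (filterI nt nB) => y [ty By].
  by apply: hB => //; rewrite distrC.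
have stab k l z : W z -> 1 <= k%:R * (G z / 2) -> (k <= l)%N -> xs l z = xs k z /\ P z (xs l z) = xs l z.
  move=> Wz k1 kl; have Gz := Gpos z Wz.
  have tl m : (k <= m)%N -> Q (tau m z) z = P z.
    move=> km; rewrite /Q /hh clamp_le0; first by have [_ -> _] := hW z Wz.
    rewrite /tau subr_le0 (le_trans k1) // ler_wpM2r ?ler_nat //; lra.
  have st m : (k <= m)%N -> xs m.+1 z = xs m z.
    move=> km; have [n1 q1] := xsP m z Wz; rewrite (tl m km) in q1.
    by rewrite /= tl ?q1 ?unitize_id // (leq_trans km).
  split; last by have [_ q1] := xsP l z Wz; rewrite tl // in q1.
  by elim: l kl => [|l ih]; [rewrite leqn0 => /eqP ->|rewrite leq_eqVlt => /orP[/eqP <-//|]; rewrite ltnS => kl; rewrite st // ih].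
pose Kz z := Num.bound (2 / G z).
have KzP z : W z -> 1 <= (Kz z)%:R * (G z / 2).
  move=> Wz; have Gz := Gpos z Wz.
  have := archi_boundP (_ : 0 <= 2 / G z) => /(_ (ltW (divr_gt0 (ltr0n _ 2) Gz))) => h2.
  rewrite mulrA ler_pdivlMr // mul1r -ler_pdivrMr //; exact: ltW.
exists (fun z => xs (Kz z) z) => z Wz; have Gz := Gpos z Wz.
have [n1 _] := xsP (Kz z) z Wz; have [_ p1] := stab _ _ z Wz (KzP z Wz) (leqnn _).
split=> //.
(* With 4 in place of 2 this number of steps serves every y with G y > G z / 2, hence a whole
   neighbourhood of z, where the lift is the single continuous function [xs K0]. *)
pose K0 := Num.bound (4 / G z).
have K0P y : W y -> G z / 2 < G y -> 1 <= K0%:R * (G y / 2).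
  move=> Wy l; have := archi_boundP (_ : 0 <= 4 / G z) => /(_ (ltW (divr_gt0 (ltr0n _ 4) Gz))) => h2.
  have h3 : 4 < K0%:R * G z by rewrite -ltr_pdivrMr.
  have K00 : 0 <= K0%:R :> R by exact: ler0n.
  have : K0%:R * (G z / 2) <= K0%:R * G y by rewrite ler_wpM2l // ltW.
  lra.
have near_eq : \forall y \near z, xs K0 y = xs (Kz y) y.
  have /cvgrPdist_lt/(_ (G z / 2)) := Gcont z Wz.
  have G2 : 0 < G z / 2 by lra.
  move=> /(_ G2) ng; apply: filterS (filterI ng (open_nbhs_nbhs (conj oW Wz))) => y [gy Wy].
  have l : G z / 2 < G y by move: gy; rewrite ltr_norml => /andP[]; lra.
  have [e2 _] := stab _ _ y Wy (K0P y Wy l) (leq_maxl K0 (Kz y)).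
  by have [e3 _] := stab _ _ y Wy (KzP y Wy) (leq_maxr K0 (Kz y)); rewrite -e2 e3.
apply: cvg_trans (near_eq_cvg near_eq) _; rewrite -(nbhs_singleton near_eq).
exact: xsc.
Qed.

Lemma lift_unitary : exists u : Z -> H -> H,
  [/\ forall z, W z -> unitary ip (u z), strong_continuous W u &
    forall z T, W z -> compact_op T -> th z T = Ad ip (u z) T].
Proof.
have [xi hxi] := lift_vector.
exists (fun z x => th z (ketbra ip x e) (xi z)); split.
- move=> z Wz; have [n1 p1 _] := hxi z Wz.
  by have [] := Kiso_inner hH (hth Wz) n1 p1.
- move=> x; apply: within_openI => // z Wz; have [_ _ cx] := hxi z Wz.
  apply: (@app_cvg _ (fun z => th z (ketbra ip x e)) xi) => //.
    apply: filterS (open_nbhs_nbhs (conj oW Wz)) => y Wy.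
    by apply: compact_bop; apply: (si_mem (hth Wy)); exact: compact_ketbra.
  by apply: ((ncP _ oW).1 (cth (compact_ketbra hH x e))).
- move=> z T Wz cT; have [n1 p1 _] := hxi z Wz.
  by have [_ h] := Kiso_inner hH (hth Wz) n1 p1; exact: h.
Qed.

End Lifting.

(** * The class of the cocycle *)

Section Implementers.
Variables (R : realType) (H : completeNormedModType R[i]).
Variable ip : H -> H -> R[i].
Hypothesis hH : is_hilbert ip.
Variable e : H.
Hypothesis e1 : nr e = 1.
Variable A : calg R.
Implicit Types (p q r : A -> H -> H) (U V : H -> H).

Definition impl p q U : Prop := unitary ip U /\ forall x, mem x -> q x = Ad ip U (p x).

Lemma impl_comp p q r U V : impl q r V -> impl p q U -> impl p r (V \o U).
Proof.
move=> [uV hV] [uU hU]; split; first exact: unitary_comp.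
by move=> x mx; rewrite hV // hU // (Ad_comp hH).
Qed.

Lemma impl_uniq p q U V : (forall T, compact_op T -> exists2 x, mem x & p x = T) ->
  impl p q U -> impl p q V -> U = sc (scalar_of (U \o adj ip V)) V.
Proof.
move=> sp [uU hU] [uV hV]; apply: (scalar_ofE hH e1) => // T /sp[x mx <-].
by rewrite -hU // hV.
Qed.

(** A square of implementing unitaries commutes up to a scalar. The scalar is written with four
    factors exactly as in [cocycle_of], so every component of the cocycle is read off from one such
    square. *)
Lemma impl_comm p q q' r U V U' V' : (forall T, compact_op T -> exists2 x, mem x & p x = T) ->
  impl p q U -> impl q r V -> impl p q' U' -> impl q' r V' ->
  V \o U = sc (scalar_of (V \o U \o adj ip U' \o adj ip V')) (V' \o U').
Proof.
move=> sp hU hV hU' hV'.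
have b1 := unitary_bop hH hU'.1; have b2 := unitary_bop hH hV'.1.
rewrite -[V \o U \o _ \o _]/(V \o U \o (adj ip U' \o adj ip V')) -(adj_comp hH b2 b1).
exact: impl_uniq sp (impl_comp hV hU) (impl_comp hV' hU').
Qed.

End Implementers.

Section Integrality.
Variables (R : realType) (n : nat) (I : Type) (S : setup R n I).
Hypothesis hS : is_standard_setup S.
Local Notation s := (@scoch R n I S).
Local Notation pcov := (pcov S).
Local Notation F := (@cechs R I n S).
Implicit Types (a b c d : I) (z : spZ S).

Lemma lattice_inj (m m' : 'rV[int]_n) : lattice R m = lattice R m' -> m = m'.
Proof. by move/matrixP => h; apply/matrixP => i j; have := h i j; rewrite !mxE => /intr_inj. Qed.

(** Both s_ab + s_bc and s_ac carry sigma_c to sigma_a, so they differ by a lattice vector, on which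
    the floor in [cechs] is exact. *)
Lemma lattice_cechs a b c z : pcov a z -> pcov b z -> pcov c z ->
  lattice R (F [:: a; b; c] z) = s b c z - s a c z + s a b z.
Proof.
move=> az bz cz.
have [m hm] : exists m, s a b z + s b c z = s a c z + lattice R m.
  by apply: (ta_inj hS (x := sec c z)); rewrite (taD hS) !(s_sec hS).
have E : s b c z - s a c z + s a b z = lattice R m.
  by rewrite addrAC addrC -[lattice R m](addKr (s a c z)) -hm; congr (_ + _); rewrite addrC.
rewrite /cechs cech3 /coch2 E; congr lattice.
by apply/matrixP => i j; rewrite !mxE intrKfloor.
Qed.

Lemma cechs_cocycle a b c d z : pcov a z -> pcov b z -> pcov c z -> pcov d z ->
  F [:: a; c; d] z + F [:: a; b; c] z = F [:: a; b; d] z + F [:: b; c; d] z.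
Proof.
move=> az bz cz dz; apply: lattice_inj; rewrite !latticeD !lattice_cechs //.
by apply/matrixP => i j; rewrite !mxE; ring.
Qed.

(** A continuous function with integral values is locally constant: nearby values differ by less
    than 1. *)
Lemma cechs_near a b c z : pcov a z -> pcov b z -> pcov c z ->
  \forall z' \near z, F [:: a; b; c] z' = F [:: a; b; c] z.
Proof.
move=> az bz cz.
have c1 : (fun z' => s b c z' - s a c z' + s a b z') @ z --> s b c z - s a c z + s a b z.
  apply: (@cvgD _ 'rV[R]_n); last exact: s_cvg.
  by apply: (@cvgB _ 'rV[R]_n); exact: s_cvg.
have o i y : pcov i y -> \forall z' \near y, pcov i z'.
  by move=> iy; apply: open_nbhs_nbhs; split; [exact: pcov_open|].
have h : \forall z' \near z, ball (s b c z - s a c z + s a b z) 1 (s b c z' - s a c z' + s a b z').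
  exact: c1 (nbhsx_ballx _ _ ltr01).
apply: filterS (filterI h (filterI (o a z az) (filterI (o b z bz) (o c z cz)))) => z' [hz [az' [bz' cz']]].
apply/rowP => k; move: hz => /(rV_ballP _ _ ltr01)/(_ k).
rewrite -!lattice_cechs // !mxE -rmorphB /= -intr_norm ltrz1 -abszE -[1]/(1%:Z) ltz_nat.
by rewrite ltnS leqn0 absz_eq0 subr_eq0 => /eqP ->.
Qed.

End Integrality.

Section Cocycle.
Variables (R : realType) (H : completeNormedModType R[i]).
Variable ip : H -> H -> R[i].
Hypothesis hH : is_hilbert ip.
Variable e : H.
Hypothesis e1 : nr e = 1.
Variables (n : nat) (I : Type) (S : setup R n I).
Hypothesis hS : is_standard_setup S.
Local Notation X := (spX S).
Local Notation Z := (spZ S).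
Local Notation sec := (@sec R n I S).
Local Notation s := (@scoch R n I S).
Local Notation pcov := (pcov S).
Local Notation F := (@cechs R I n S).

Variable A : xsys R X n.
Hypothesis hC : forall f (a : A), Cb f -> mem a -> mem (cmul f a).
Variables (J : Type) (V : J -> set X) (g : J -> J -> X -> (H -> H) -> H -> H).
Variable p0 : A -> section_alg ip V g.
Hypothesis hp : star_iso p0.
Hypothesis hl : linear_over (@Cb R X) p0.
Hypothesis hBr : in_Br ip (@tact R n I S) A.
Variable D : choices H A.
Hypothesis hD : are_choices ip D.
Implicit Types (a b c d : I) (z : Z) (m : 'rV[int]_n).

Definition vg a z (k : 'I_n) := vgen D a k (sec a z).
Local Notation q a t z := (fib D a t z).
Local Notation W a m z := (vpow ip D a m z).
Local Notation T a b z := (vtrans D a b z).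
Local Notation phi := (cocycle_of ip D).
Local Notation om a z := (fun i j => phi.2 [:: a] z i j).

Lemma vg_unitary a z k : pcov a z -> unitary ip (vg a z k).
Proof. by move=> az; apply: (vgen_unitary hD); exact: sec_cov. Qed.

Lemma vpowE a m z : W a m z = cprod ip (vg a z) (index_enum _) m. Proof. by []. Qed.

(** The unitaries act as arrows between the representations [fib] at varying parameters: v^m shifts
    t by - m, and [vtrans] from a to b shifts t by s_ab. Two composites agree up to a scalar as soon
    as their total shifts agree. *)
Lemma vpow_impl a t m z : pcov a z -> impl ip (q a t z) (q a (t - lattice R m) z) (W a m z).
Proof.
move=> az; split; first exact: vpow_unitary.
by move=> x mx; rewrite -latticeN (fib_lattice hH hS hC hp hl hBr hD) // opprK.
Qed.

Lemma vtrans_impl a b t z : pcov a z -> pcov b z ->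
  impl ip (q a t z) (q b (t + s a b z) z) (T a b z).
Proof.
move=> az bz; split; first exact: vtrans_unitary.
by move=> x mx; rewrite (fib_glue hS hBr hD).
Qed.

Let qs a t z : pcov a z -> forall K, compact_op K -> exists2 x, mem x & q a t z x = K.
Proof. by move=> az K cK; exact: (fib_surj hS hC hp hl hBr hD). Qed.

Lemma twist_phi a z : pcov a z -> twisted (om a z) (vg a z).
Proof.
move=> az i j ij; rewrite /cocycle_of /= mxE ij /=.
have h k t : impl ip (q a t z) (q a (t - lattice R (delta_mx 0 k)) z) (vg a z k).
  by have := vpow_impl t (delta_mx 0 k) az; rewrite vpowE pow_delta // => k'; exact: vg_unitary.
rewrite !vpowE !pow_delta; try by move=> k; exact: vg_unitary.
apply: (impl_comm hH e1 (@qs a 0 z az)); [exact: h|exact: h|exact: h|].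
by rewrite addrAC; exact: h.
Qed.

Lemma chi_phi a b z m : pcov a z -> pcov b z ->
  W b m z \o T a b z = sc (phi.1.2 [:: a; b] z m) (T a b z \o W a m z).
Proof.
move=> az bz.
apply: (impl_comm hH e1 (@qs a 0 z az)); [exact: vtrans_impl|exact: vpow_impl|exact: vpow_impl|].
by rewrite addrAC; exact: vtrans_impl.
Qed.

(** The shifts agree because s_ab + s_bc = F_abc + s_ac, whence the exponent - F_abc. *)
Lemma kappa_phi a b c z : pcov a z -> pcov b z -> pcov c z ->
  T b c z \o T a b z = sc (phi.1.1 [:: a; b; c] z) (T a c z \o W a (- F [:: a; b; c] z) z).
Proof.
move=> az bz cz.
apply: (impl_comm hH e1 (@qs a 0 z az)); [exact: vtrans_impl|exact: vtrans_impl|exact: vpow_impl|].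
have -> : 0 + s a b z + s b c z = 0 - lattice R (- F [:: a; b; c] z) + s a c z.
  by rewrite latticeN opprK !add0r lattice_cechs // addrAC subrK addrC.
exact: vtrans_impl.
Qed.

Lemma twist_phi_eq a b z : pcov a z -> pcov b z -> forall i j : 'I_n, (i < j)%N -> om b z i j = om a z i j.
Proof.
move=> az bz; have ua k := vg_unitary k az; have ub k := vg_unitary k bz.
apply: (twist_eq hH e1 ua ub (vtrans_unitary hD az bz) (twist_phi az) (twist_phi bz)
  (chi := fun k => phi.1.2 [:: a; b] z (delta_mx 0 k))).
by move=> k; have := chi_phi (delta_mx 0 k) az bz; rewrite !vpowE !pow_delta.
Qed.

Lemma phi2_lower l z (i j : 'I_n) : (j <= i)%N -> phi.2 l z i j = 0.
Proof.
move=> ji; rewrite /= mxE; case: l => [|a [|//]] //.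
by rewrite ltnNge ji.
Qed.

Lemma twist_phi' a b z : pcov a z -> pcov b z -> twisted (om a z) (vg b z).
Proof. by move=> az bz i j ij; rewrite -(twist_phi_eq az bz ij); exact: twist_phi. Qed.

Lemma scont_vtrans a b z : pcov a z -> pcov b z -> scont (vtrans D a b) z.
Proof.
move=> az bz x; have [_ _ _ h _] := hD; have [_ /(_ x) c] := h a b.
exact: within_open_cvg (openI (pcov_open hS a) (pcov_open hS b)) c (conj az bz).
Qed.

Lemma near_pcov a z : pcov a z -> \forall z' \near z, pcov a z'.
Proof. by move=> az; apply: open_nbhs_nbhs; split; [exact: pcov_open|]. Qed.

Lemma near_pcov2 a b z : pcov a z -> pcov b z -> \forall z' \near z, pcov a z' /\ pcov b z'.
Proof. by move=> az bz; apply: filterI; exact: near_pcov. Qed.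

Lemma near_pcov3 a b c z : pcov a z -> pcov b z -> pcov c z ->
  \forall z' \near z, [/\ pcov a z', pcov b z', pcov c z' & F [:: a; b; c] z' = F [:: a; b; c] z].
Proof.
move=> az bz cz.
apply: filterS (filterI (near_pcov2 az bz) (filterI (near_pcov cz) (cechs_near hS az bz cz))) => z'.
by case=> [[? ?] [? ?]].
Qed.

Lemma scont_vg a z k : pcov a z -> scont (fun z' => vg a z' k) z.
Proof.
move=> az x; have [_ h _ _ _] := hD; have [_ /(_ x) c] := h a k.
have c1 := within_open_cvg (cov_open hS a) c (sec_cov hS az).
exact: (cvg_comp _ _ (sec_cvg hS az) c1).
Qed.

Lemma scont_vpow a m z : pcov a z -> scont (fun z' => W a m z') z.
Proof.
move=> az; apply: (scont_cprod hH); last by move=> k; exact: scont_vg.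
by apply: filterS (near_pcov az) => z' az' k; exact: vg_unitary.
Qed.

Lemma capl_open l : open (capl pcov l).
Proof.
elim: l => [|a l ih] /=; [exact: openT|apply: openI => //; exact: pcov_open].
Qed.

Lemma continuousTI l (f : Z -> circle R) :
  (forall z, capl pcov l z -> (fun z => cval (f z) : R[i]^o) @ z --> (cval (f z) : R[i]^o)) ->
  continuousT (capl pcov l) f.
Proof. by move=> h; apply: within_openI h; exact: capl_open. Qed.

Lemma cocycle_cochain : in_cochains pcov 2 phi.
Proof.
split.
- move=> [|a [|b [|c [|//]]]] // _; apply: continuousTI => z [az [bz [cz _]]].
  have nr_ := near_pcov3 az bz cz.
  (* F is locally constant, so the exponent of W can be frozen at its value at z. *)
  apply: (scont_scalar hH e1 (U := fun z => T b c z \o T a b z)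
     (V := fun z' => T a c z' \o W a (- F [:: a; b; c] z) z')).
  + apply: filterS nr_ => z' [az' bz' cz' <-]; split; last exact: kappa_phi.
    by apply: (unitary_comp hH); [exact: vtrans_unitary|exact: vpow_unitary].
  + apply: (scont_comp hH) => //; try exact: scont_vtrans.
    by apply: filterS nr_ => z' [_ bz' cz' _]; exact: vtrans_unitary.
  + apply: (scont_comp hH) => //; [|exact: scont_vtrans|exact: scont_vpow].
    by apply: filterS nr_ => z' [az' _ cz' _]; exact: vtrans_unitary.
- move=> [|a [|b [|//]]] // _; split; last first.
    move=> z [az [bz _]]; have ua k := vg_unitary k az; have ub k := vg_unitary k bz.
    exact: (chi_add hH e1 ua ub (vtrans_unitary hD az bz) (twist_phi az) (twist_phi' az bz)
      (fun m => chi_phi m az bz)).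
  move=> m; apply: continuousTI => z [az [bz _]].
  have nr_ := near_pcov2 az bz.
  apply: (scont_scalar hH e1 (U := fun z => W b m z \o T a b z) (V := fun z => T a b z \o W a m z)).
  + apply: filterS nr_ => z' [az' bz']; split; last exact: chi_phi.
    by apply: (unitary_comp hH); [exact: vtrans_unitary|exact: vpow_unitary].
  + apply: (scont_comp hH) => //; [|exact: scont_vpow|exact: scont_vtrans].
    by apply: filterS nr_ => z' [az' bz']; exact: vpow_unitary.
  + apply: (scont_comp hH) => //; [|exact: scont_vtrans|exact: scont_vpow].
    by apply: filterS nr_ => z' [az' bz']; exact: vtrans_unitary.
- move=> [|a [|//]] // _; split; last by move=> z _ i j; exact: phi2_lower.
  move=> i j; have [ij|ji] := ltnP i j; last first.
    apply: continuousTI => z _; have -> : (fun z => cval (phi.2 [:: a] z i j) : R[i]^o) = fun=> cval (0 : circle R).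
      by apply/funext => z'; rewrite phi2_lower.
    by rewrite phi2_lower //; exact: cvg_cst.
  apply: continuousTI => z [az _].
  apply: (scont_scalar hH e1 (U := fun z => vg a z j \o vg a z i) (V := fun z => vg a z i \o vg a z j)).
  + apply: filterS (near_pcov az) => z' az'; split; last exact: twist_phi.
    by apply: (unitary_comp hH); exact: vg_unitary.
  + apply: (scont_comp hH) => //; try exact: scont_vg.
    by apply: filterS (near_pcov az) => z' az'; exact: vg_unitary.
  + apply: (scont_comp hH) => //; try exact: scont_vg.
    by apply: filterS (near_pcov az) => z' az'; exact: vg_unitary.
Qed.

Lemma chiN a b z m : pcov a z -> pcov b z -> phi.1.2 [:: a; b] z (- m) = - phi.1.2 [:: a; b] z m.
Proof.
move=> az bz; have [_ h _] := cocycle_cochain.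
have [_ /(_ z) hz] := h [:: a; b] erefl; have {}hz := hz (conj az (conj bz Logic.I)).
apply/eqP; rewrite -subr_eq0 opprK -hz addNr.
by have := hz 0 0; rewrite addr0 => /eqP; rewrite -subr_eq0 opprD addrA subrr sub0r oppr_eq0.
Qed.

(** The two ways of reordering products leave differences of two values of the multiplier [mu];
    expanded, these are the cup products of phi^02 with F and with C(F). The cup product of phi^11
    with F arises from moving v^(- F_bcd) past T_ab. *)
Lemma cocycle_closed : eq_cochains pcov 3 (DF F 2 phi) 0.
Proof.
split.
- move=> [|a [|b [|c [|d [|//]]]]] // z _ [az [bz [cz [dz _]]]].
  rewrite /DF -[LHS]/(_ + _ *~ _ + _ *~ _) -[RHS]/(0 : circle R).
  rewrite (_ : (-1) ^+ 3 = -1 :> int) // !mulrN1z.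
  have ua k := vg_unitary k az; have ub k := vg_unitary k bz.
  have := kappa_cocycle hH e1 ua ub (vtrans_unitary hD az bz) (vtrans_unitary hD az dz)
    (vtrans_unitary hD bz dz) (vtrans_unitary hD cz dz) (twist_phi az)
    (chi_phi _ az bz) (kappa_phi az bz cz) (kappa_phi az bz dz) (kappa_phi az cz dz)
    (kappa_phi bz cz dz) (cechs_cocycle hS az bz cz dz).
  rewrite chiN // opprK cech4 => ->.
  have -> : cup22 F 2 phi.2 [:: a; b; c; d] z =
      mu (om a z) (F [:: a; c; d] z) (F [:: a; b; c] z)
      - mu (om a z) (F [:: a; b; d] z) (F [:: b; c; d] z).
    rewrite /cup22 /mu -sumrB; apply: eq_bigr => i _; rewrite -sumrB; apply: eq_bigr => j _.
    by rewrite -mulrzBr.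
  rewrite -[cup11 _ _ _ _ _]/(phi.1.2 [:: a; b] z (F [:: b; c; d] z)).
  by rewrite -[X in X - _ - _]addrA [X in X - _]addrAC subrr add0r subrr.
- move=> [|a [|b [|c [|//]]]] // z _ [az [bz [cz _]]]; apply/funext => m.
  rewrite /DF -[LHS]/(_ + _ *~ _) -[RHS]/(0 : circle R) (_ : (-1) ^+ 2 = 1 :> int) // mulr1z.
  rewrite cech3 -[X in X + _]/(phi.1.2 [:: b; c] z m - phi.1.2 [:: a; c] z m + phi.1.2 [:: a; b] z m).
  have ua k := vg_unitary k az; have ub k := vg_unitary k bz; have uc k := vg_unitary k cz.
  rewrite (chi_cocycle hH e1 ua ub uc (vtrans_unitary hD az bz) (vtrans_unitary hD bz cz)
    (vtrans_unitary hD az cz) (twist_phi az) (chi_phi m az bz) (chi_phi m bz cz) (chi_phi m az cz)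
    (kappa_phi az bz cz)).
  rewrite muNr muNl opprK.
  have -> : cup21 F 2 phi.2 [:: a; b; c] z m =
      mu (om a z) m (F [:: a; b; c] z) - mu (om a z) (F [:: a; b; c] z) m.
    rewrite /cup21 /mu -sumrB; apply: eq_bigr => i _; rewrite -sumrB; apply: eq_bigr => j _.
    by rewrite -mulrzBr.
  by rewrite addrACA addNr subrr addr0.
- move=> [|a [|b [|//]]] // z _ [az [bz _]].
  rewrite /DF -[LHS]/(cech phi.2 [:: a; b] z) -[RHS]/(0 : 'M[circle R]_n) cech2.
  apply/eqP; rewrite subr_eq0; apply/eqP/matrixP => i j.
  have [ij|ji] := ltnP i j; last by rewrite !phi2_lower.
  exact: twist_phi_eq.
Qed.

End Cocycle.

(** * Comparison of two sets of choices *)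

Section Comparison.
Variables (R : realType) (H : completeNormedModType R[i]).
Variable ip : H -> H -> R[i].
Hypothesis hH : is_hilbert ip.
Variable e : H.
Hypothesis e1 : nr e = 1.
Variables (n : nat) (I : Type) (S : setup R n I).
Hypothesis hS : is_standard_setup S.
Local Notation X := (spX S).
Local Notation Z := (spZ S).
Local Notation sec := (@sec R n I S).
Local Notation pcov := (pcov S).
Local Notation F := (@cechs R I n S).

Variable A : xsys R X n.
Hypothesis hAct : is_cstar A.
Hypothesis hC : forall f (a : A), Cb f -> mem a -> mem (cmul f a).
Variables (J : Type) (V : J -> set X) (g : J -> J -> X -> (H -> H) -> H -> H).
Hypothesis hK : is_K_bundle ip V g.
Variable p0 : A -> section_alg ip V g.
Hypothesis hp : star_iso p0.
Hypothesis hl : linear_over (@Cb R X) p0.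
Hypothesis hBr : in_Br ip (@tact R n I S) A.
Variables D D' : choices H A.
Hypothesis (hD : are_choices ip D) (hD' : are_choices ip D').
Implicit Types (a b c d : I) (z : Z) (m : 'rV[int]_n).

Let fib_link a z : pcov a z -> exists2 th : Kalg ip -> Kalg ip, star_iso th &
  forall x, mem x -> fib D' a 0 z x = th (fib D a 0 z x).
Proof.
move=> az; apply: (rep_link (ip := ip) (cstar_closed hAct)
  (fib_rep hH hS hAct hC hp hl hBr hD 0 az) (fib_rep hH hS hAct hC hp hl hBr hD' 0 az)).
- by move=> T cT; exact: (fib_surj hS hC hp hl hBr hD).
- by move=> T cT; exact: (fib_surj hS hC hp hl hBr hD').
- move=> x mx; rewrite -(fib_van hH hS hC hK hp hl hBr hD 0 az mx).
  exact: (fib_van hH hS hC hK hp hl hBr hD' 0 az mx).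
Qed.

Lemma fib_act (E : choices H A) a t z x : mem x -> fib E a t z x = fib E a 0 z (act (- t) x).
Proof. by move=> mx; rewrite /fib oppr0 (act0 hBr) //; exact: (act_mem hBr). Qed.

Let fib_ncat (E : choices H A) a (x : A) z : are_choices ip E -> mem x -> pcov a z -> ncat (fun z' => fib E a 0 z' x) z.
Proof.
move=> hE mx az; have [h _ _ _ _] := hE; have [h1 h2] := h a.
have := iv_ncat (X_hausdorff hS) (X_bump hS) hC hp hl (cov_open hS a) h1 h2 mx (sec_cov hS az).
move=> c d d0; have c' : \forall z' \near z, opnorm (iv E a x (sec a z') - iv E a x (sec a z)) < d.
  exact: (sec_cvg hS az (c d d0)).
by apply: filterS c' => z' hz; rewrite /fib oppr0 (act0 hBr).
Qed.

(** At t = 0 the two choices give representations with equal kernels, hence automorphisms th z,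
    which [lift_unitary] implements continuously. Other t follow, the value at t being the value at
    0 of the translated element. *)
Lemma comparison_unitary a : exists u : Z -> H -> H,
  [/\ forall z, pcov a z -> unitary ip (u z),
      forall z, pcov a z -> scont u z &
      forall t z, pcov a z -> impl ip (fib D a t z) (fib D' a t z) (u z)].
Proof.
(* A good cover makes only nonempty members contractible; over an empty one any u will do. *)
have [[z0 az0]|no] := pselect (exists z, pcov a z); last first.
  by exists (fun=> id); split=> [z az|z az|t z az]; case: no; exists z.
have /choice[th hth] : forall z, exists th : Kalg ip -> Kalg ip, pcov a z -> star_iso th /\
    forall x, mem x -> fib D' a 0 z x = th (fib D a 0 z x).
  move=> z; have [az|na] := pselect (pcov a z); last by exists id.
  by have [th h1 h2] := fib_link az; exists th.
have [u [u1 u2 u3]] : exists u : Z -> H -> H, [/\ forall z, pcov a z -> unitary ip (u z),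
    strong_continuous (pcov a) u &
    forall z T, pcov a z -> compact_op T -> th z T = Ad ip (u z) T].
  apply: (lift_unitary hH e1 (pcov_open hS a) (pcov_contractible hS az0)).
    by move=> z /hth[].
  move=> T cT; apply/(ncP _ (pcov_open hS a)) => z az d d0.
  have [x mx xT] := fib_surj hS hC hp hl hBr hD 0 az cT.
  have d2 : 0 < d / 2 by rewrite divr_gt0.
  have n1 := fib_ncat hD mx az d2; have n2 := fib_ncat hD' mx az d2.
  have az_ : \forall z' \near z, pcov a z'.
    by apply: open_nbhs_nbhs; split; [exact: pcov_open|].
  apply: filterS (filterI az_ (filterI n1 n2)) => z' [az' [h1 h2]].
  have [i1 e1'] := hth z az; have [i2 e2] := hth z' az'.
  have bf E z1 (hE : are_choices ip E) (az1 : pcov a z1) : compact_op (fib E a 0 z1 x).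
    exact: (rp_compact (fib_rep hH hS hAct hC hp hl hBr hE 0 az1) mx).
  have cd : compact_op (T - fib D a 0 z' x) by apply: (copB cT); exact: bf.
  (* Continuity of th is known only on values of elements of A. With x chosen so that its value at z
     is T, the first term is small because th z' is isometric, the second because values of x vary
     continuously. *)
  have -> : th z' T - th z T = th z' (T - fib D a 0 z' x) + (fib D' a 0 z' x - fib D' a 0 z x).
    rewrite (siB (cstar_closed (Kalg_cstar hH)) i2) //; last exact: bf.
    by rewrite -e2 // -[in th z T]xT -e1' // addrA subrK.
  have b1 : bop (th z' (T - fib D a 0 z' x)) by exact: compact_bop (si_mem i2 cd).
  have b2 : bop (fib D' a 0 z' x - fib D' a 0 z x) by apply: compact_bop; apply: copB; exact: bf.
  apply: (le_lt_trans (opnormD b1 b2)); rewrite [ltRHS]splitr; apply: ltrD => //.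
  by rewrite (Kiso_norm hH i2 cd) opnormB; rewrite xT in h1.
exists u; split=> //.
- by move=> z az x; exact: within_open_cvg (pcov_open hS a) (u2 x) az.
- move=> t z az; split; first exact: u1.
  move=> x mx; have mx' := act_mem hBr (- t) mx.
  rewrite !(fib_act _ _ t) // -u3 //; last exact: (rp_compact (fib_rep hH hS hAct hC hp hl hBr hD 0 az) mx').
  by have [_] := hth z az; exact.
Qed.

Variable u : I -> Z -> H -> H.
Hypothesis uu : forall a z, pcov a z -> unitary ip (u a z).
Hypothesis su : forall a z, pcov a z -> scont (u a) z.
Hypothesis iu : forall a t z, pcov a z -> impl ip (fib D a t z) (fib D' a t z) (u a z).

Definition cmp_gen a z k : circle R :=
  scalar_of (vg D' a z k \o u a z \o adj ip (vg D a z k) \o adj ip (u a z)).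
(** The scalar for v^m obtained by moving u through the ordered product of generators
    ([cprod_scale]); in this form additivity in m is immediate. *)
Definition cmp_pow a z m : circle R := \sum_(k <- index_enum _) cmp_gen a z k *~ m 0 k.
Definition cmp_trans a b z : circle R :=
  scalar_of (vtrans D' a b z \o u a z \o adj ip (vtrans D a b z) \o adj ip (u b z)).
Definition cmp : triple R I n Z :=
  (fun l z => if l is [:: a; b] then cmp_trans a b z else 0,
   fun l z m => if l is [:: a] then cmp_pow a z m else 0, 0).

Lemma cmp_genE a z k : pcov a z ->
  vg D' a z k \o u a z = sc (cmp_gen a z k) (u a z \o vg D a z k).
Proof.
move=> az.
have h (E : choices H A) (hE : are_choices ip E) t : impl ip (fib E a t z) (fib E a (t - lattice R (delta_mx 0 k)) z) (vg E a z k).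
  have := vpow_impl hH hS hC hp hl hBr hE t (delta_mx 0 k) az; rewrite vpowE pow_delta // => k'.
apply: (impl_comm hH e1 (fun T cT => fib_surj hS hC hp hl hBr hD 0 az cT)).
- exact: iu.
- exact: h.
- exact: h.
- exact: iu.
Qed.

Lemma cmp_powE a z m : pcov a z ->
  vpow ip D' a m z \o u a z = sc (cmp_pow a z m) (u a z \o vpow ip D a m z).
Proof.
move=> az; apply: (cprod_scale hH).
- exact: uu.
- by move=> k; exact: vg_unitary.
- by move=> k; exact: vg_unitary.
- by move=> k; exact: cmp_genE.
Qed.

Lemma cmp_transE a b z : pcov a z -> pcov b z ->
  vtrans D' a b z \o u a z = sc (cmp_trans a b z) (u b z \o vtrans D a b z).
Proof.
move=> az bz.
apply: (impl_comm hH e1 (fun T cT => fib_surj hS hC hp hl hBr hD 0 az cT)).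
- exact: iu.
- exact: vtrans_impl.
- exact: vtrans_impl.
- exact: iu.
Qed.

Lemma cmp_cochain : in_cochains pcov 1 cmp.
Proof.
split.
- move=> [|a [|b [|//]]] // _; apply: (continuousTI hS) => z [az [bz _]].
  apply: (scont_scalar hH e1 (U := fun z => vtrans D' a b z \o u a z)
    (V := fun z => u b z \o vtrans D a b z)).
  + apply: filterS (near_pcov2 hS az bz) => z' [az' bz']; split; last exact: cmp_transE.
    by apply: (unitary_comp hH); [exact: uu|exact: vtrans_unitary].
  + apply: (scont_comp hH) => //; [|exact: (scont_vtrans hS hD')|exact: su].
    by apply: filterS (near_pcov2 hS az bz) => z' [az' bz']; exact: vtrans_unitary.
  + apply: (scont_comp hH) => //; [|exact: su|exact: (scont_vtrans hS hD)].
    by apply: filterS (near_pcov2 hS az bz) => z' [az' bz']; exact: uu.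
- move=> [|a [|//]] // _; split.
    move=> m; apply: (continuousTI hS) => z [az _].
    apply: (scont_scalar hH e1 (U := fun z => vpow ip D' a m z \o u a z)
      (V := fun z => u a z \o vpow ip D a m z)).
    + apply: filterS (near_pcov hS az) => z' az'; split; last exact: cmp_powE.
      by apply: (unitary_comp hH); [exact: uu|exact: vpow_unitary].
    + apply: (scont_comp hH) => //; [|exact: (scont_vpow hH hS hD')|exact: su].
      by apply: filterS (near_pcov hS az) => z' az'; exact: vpow_unitary.
    + apply: (scont_comp hH) => //; [|exact: su|exact: (scont_vpow hH hS hD)].
      by apply: filterS (near_pcov hS az) => z' az'; exact: uu.
  move=> z _ m m'; rewrite /= /cmp_pow -big_split /=; apply: eq_bigr => k _.
  by rewrite mxE mulrzDr.
- by move=> [].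
Qed.

(** Each relation is conjugated by the u's. In the first component - P (- F) = P (F) is the cup
    product occurring in D psi; in the last, commutators ignore the scalars, matching the zero last
    component of psi. *)
Lemma cmp_cohomologous : eq_cochains pcov 2 (cocycle_of ip D') (cocycle_of ip D + DF F 1 cmp).
Proof.
split.
- move=> [|a [|b [|c [|//]]]] // z _ [az [bz [cz _]]].
  rewrite -[RHS]/((cocycle_of ip D).1.1 [:: a; b; c] z + ((cech cmp.1.1 [:: a; b; c] z +
     cmp_pow a z (F [:: a; b; c] z) *~ (-1) ^+ 2) + cup22 F 1 0 [:: a; b; c] z *~ (-1) ^+ 2)).
  have -> : cup22 F 1 0 [:: a; b; c] z = 0 :> circle R.
    by apply: big1 => i _; apply: big1 => j _; rewrite mxE mul0rz.
  rewrite (_ : (-1) ^+ 2 = 1 :> int) // !mulr1z addr0 cech3.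
  rewrite (kappa_cobound hH e1 (fun k => vg_unitary hS hD k az) (vtrans_unitary hD az cz)
    (vtrans_unitary hD' az cz) (vtrans_unitary hD' bz cz) (uu cz) (cmp_powE (- F [:: a; b; c] z) az)
    (cmp_transE az bz) (cmp_transE bz cz) (cmp_transE az cz)
    (kappa_phi hH e1 hS hC hp hl hBr hD az bz cz) (kappa_phi hH e1 hS hC hp hl hBr hD' az bz cz)).
  congr (_ + (_ + _)); rewrite /cmp_pow -sumrN; apply: eq_bigr => k _.
  by rewrite mxE mulrNz opprK.
- move=> [|a [|b [|//]]] // z _ [az [bz _]]; apply/funext => m.
  rewrite -[RHS]/((cocycle_of ip D).1.2 [:: a; b] z m + (cech cmp.1.2 [:: a; b] z m
     + cup21 F 1 0 [:: a; b] z m *~ (-1) ^+ 1)).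
  have -> : cup21 F 1 0 [:: a; b] z m = 0 :> circle R.
    by apply: big1 => i _; apply: big1 => j _; rewrite mxE mul0rz.
  rewrite mul0rz addr0 cech2.
  exact: (chi_cobound hH e1 (fun k => vg_unitary hS hD k az) (fun k => vg_unitary hS hD' k bz)
    (vtrans_unitary hD az bz) (vtrans_unitary hD' az bz) (uu az) (uu bz) (cmp_powE m az) (cmp_powE m bz)
    (cmp_transE az bz) (chi_phi hH e1 hS hC hp hl hBr hD m az bz)
    (chi_phi hH e1 hS hC hp hl hBr hD' m az bz)).
- move=> [|a [|//]] // z _ [az _].
  rewrite -[RHS]/((cocycle_of ip D).2 [:: a] z + cech 0 [:: a] z) cech1 addr0.
  apply/matrixP => i j; have [ij|ji] := ltnP i j; last by rewrite !phi2_lower.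
  exact: (twist_eq hH e1 (fun k => vg_unitary hS hD k az) (fun k => vg_unitary hS hD' k az) (uu az)
    (twist_phi hH e1 hS hC hp hl hBr hD az) (twist_phi hH e1 hS hC hp hl hBr hD' az)
    (fun k => cmp_genE k az)).
Qed.

End Comparison.

Section Classes.
Variables (R : realType) (n : nat) (I : Type) (Z : topologicalType).
Variables (W : I -> set Z) (F : seq I -> Z -> 'rV[int]_n).
Implicit Types (f g : triple R I n Z).

Lemma cechB (V : zmodType) (f g : seq I -> Z -> V) l z : cech (f - g) l z = cech f l z - cech g l z.
Proof. by rewrite /cech -sumrB; apply: eq_bigr => i _; rewrite -mulrzBl. Qed.

Lemma DFB k f g : DF F k (f - g) = DF F k f - DF F k g.
Proof.
have E21 l z m : cup21 F k (f - g).2 l z m = cup21 F k f.2 l z m - cup21 F k g.2 l z m.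
  rewrite /cup21 -sumrB; apply: eq_bigr => i _; rewrite -sumrB; apply: eq_bigr => j _.
  by rewrite -[(f - g).2 _ _]/(f.2 _ _ - g.2 _ _) !mxE mulrzBl.
have E22 l z : cup22 F k (f - g).2 l z = cup22 F k f.2 l z - cup22 F k g.2 l z.
  rewrite /cup22 -sumrB; apply: eq_bigr => i _; rewrite -sumrB; apply: eq_bigr => j _.
  by rewrite -[(f - g).2 _ _]/(f.2 _ _ - g.2 _ _) !mxE mulrzBl.
have E11 l z : cup11 F k (f - g).1.2 l z = cup11 F k f.1.2 l z - cup11 F k g.1.2 l z by [].
rewrite /DF; congr (_, _, _).
- apply/funext => l; apply/funext => z.
  rewrite -[RHS]/((cech f.1.1 l z + cup11 F k f.1.2 l z *~ (-1) ^+ k.+1 + cup22 F k f.2 l z *~ (-1) ^+ k.+1)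
    - (cech g.1.1 l z + cup11 F k g.1.2 l z *~ (-1) ^+ k.+1 + cup22 F k g.2 l z *~ (-1) ^+ k.+1)).
  by rewrite E11 E22 (cechB f.1.1 g.1.1) !mulrzBl !opprD [RHS]addrACA [X in _ = X + _]addrACA.
- apply/funext => l; apply/funext => z; apply/funext => m.
  rewrite -[RHS]/((cech f.1.2 l z m + cup21 F k f.2 l z m *~ (-1) ^+ k)
    - (cech g.1.2 l z m + cup21 F k g.2 l z m *~ (-1) ^+ k)).
  rewrite E21 (cechB f.1.2 g.1.2) mulrzBl opprD [RHS]addrACA.
  by [].
- by apply/funext => l; apply/funext => z; rewrite (cechB f.2 g.2).
Qed.

Lemma continuousT_sub (B : set Z) (f g : Z -> circle R) :
  continuousT B f -> continuousT B g -> continuousT B (f - g).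
Proof.
move=> cf cg x; apply: (@cvgM R[i]); first exact: cf.
apply: cvgV; last exact: cg.
by rewrite -normr_eq0 circle_norm oner_eq0.
Qed.

Lemma in_cochainsB f g : in_cochains W 1 f -> in_cochains W 1 g -> in_cochains W 1 (f - g).
Proof.
move=> [f1 f2 f3] [g1 g2 g3]; split.
- by move=> l h; apply: continuousT_sub; [exact: f1|exact: g1].
- move=> [//|a l] h; have [c1 m1] := f2 _ h; have [c2 m2] := g2 _ h; split.
    by move=> m; apply: continuousT_sub; [exact: c1|exact: c2].
  move=> z hz m m'; rewrite -[LHS]/(f.1.2 _ z (m + m') - g.1.2 _ z (m + m')).
  by rewrite m1 // m2 // opprD addrACA.
- move=> [|//] _; have /= f0 := f3 [::] erefl; have /= g0 := g3 [::] erefl.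
  by rewrite -[LHS]/(f.2 [::] - g.2 [::]) f0 g0 subrr.
Qed.

(** h = f + D chi and g = f + D psi give h = g + D (chi - psi). One inclusion is enough, since two
    sets of choices can be exchanged. *)
Lemma coh_class_sub f g psi : in_cochains W 1 psi -> eq_cochains W 2 g (f + DF F 1 psi) ->
  coh_class W F 1 f `<=` coh_class W F 1 g.
Proof.
move=> hpsi [e1 e2 e3] h [ch [chi hchi [h1 h2 h3]]]; split=> //.
exists (chi - psi); first exact: in_cochainsB.
rewrite DFB; split=> l z sl hz.
- rewrite h1 // -[RHS]/(g.1.1 l z + ((DF F 1 chi).1.1 l z - (DF F 1 psi).1.1 l z)) e1 //.
  by rewrite -[RHS]addrA (addrC _ (_ - _)) subrK.
- rewrite h2 // -[RHS]/(g.1.2 l z + ((DF F 1 chi).1.2 l z - (DF F 1 psi).1.2 l z)) e2 //.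
  by rewrite -[RHS]addrA (addrC _ (_ - _)) subrK.
- rewrite h3 // -[RHS]/(g.2 l z + ((DF F 1 chi).2 l z - (DF F 1 psi).2 l z)) e3 //.
  by rewrite -[RHS]addrA (addrC _ (_ - _)) subrK.
Qed.

End Classes.

Section Invariant.
Variables (R : realType) (H : completeNormedModType R[i]).
Variable ip : H -> H -> R[i].
Hypothesis hH : is_hilbert ip.
Variable e : H.
Hypothesis e1 : nr e = 1.
Variables (n : nat) (I : Type) (S : setup R n I).
Hypothesis hS : is_standard_setup S.
Variable A : xsys R (spX S) n.
Hypothesis hBr : in_Br ip (@tact R n I S) A.

Lemma H2class_sub (D D' : choices H A) : are_choices ip D -> are_choices ip D' ->
  H2class (cocycle_of ip D) `<=` H2class (cocycle_of ip D').
Proof.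
move=> hD hD'; have [[hAct hC [J [V [g [p0 [hK hp hl]]]]]] _ _ _ _] := hBr.
have /choice[u hu] := comparison_unitary hH e1 hS hAct hC hK hp hl hBr hD hD'.
have uu a z : pcov S a z -> unitary ip (u a z) by case: (hu a) => h _ _; exact: h.
have su a z : pcov S a z -> scont (u a) z by case: (hu a) => _ h _; exact: h.
have iu a t z : pcov S a z -> impl ip (fib D a t z) (fib D' a t z) (u a z).
  by case: (hu a) => _ _ h; exact: h.
apply: (coh_class_sub (psi := cmp ip D D' u)).
  exact: (cmp_cochain hH e1 hS hC hp hl hBr hD hD' uu su iu).
exact: (cmp_cohomologous hH e1 hS hC hp hl hBr hD hD' uu iu).
Qed.

Lemma Xi_isP (D : choices H A) : are_choices ip D -> Xi_is ip A (H2class (cocycle_of ip D)).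
Proof.
move=> hD; have [[hAct hC [J [V [g [p0 [hK hp hl]]]]]] _ _ _ _] := hBr; split.
  exists (cocycle_of ip D) => //; split.
    exact: (cocycle_cochain hH e1 hS hC hp hl hBr hD).
  exact: (cocycle_closed hH e1 hS hC hp hl hBr hD).
apply/seteqP; split=> [_ [D' hD' <-]|_ ->]; last by exists D.
by apply/seteqP; split; exact: H2class_sub.
Qed.

End Invariant.

Lemma unit_vector (R : realType) (H : completeNormedModType R[i]) : infinite_dim H ->
  exists e : H, nr e = 1.
Proof.
(* Against the empty family the hypothesis says that x differs from the empty sum, i.e. is
   nonzero. *)
move=> h; have [x hx] := h 0%N (fun=> 0); have x0 : x != 0.
  by apply/eqP => x0; apply: (hx (fun=> 0)); rewrite big_ord0.
have n0 := nr_gt0 x0.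
by exists ((nr x)^-1%:C *: x); rewrite nrZ_pos ?invr_ge0 ?ltW // mulVf ?gt_eqF //.
Qed.

Theorem proposition3 (R : realType) (H : completeNormedModType (complex R))
    (ip : H -> H -> complex R) (hH : is_hilbert ip)
    (hsep : separable_space H) (hinf : infinite_dim H)
    (n : nat) (I : Type) (S : setup R n I) (hS : is_standard_setup S)
    (A : xsys R (spX S) n) (hA : in_Br ip (@tact R n I S) A)
    (D : choices H A) (hD : are_choices ip D) :
  in_Br ip (@tact R n I S) (Aphi ip D) /\
  Xi_is ip (Aphi ip D) (H2class (cocycle_of ip D)) /\
  outer_conjugate A (Aphi ip D).
Proof.
have [e e1] := unit_vector hinf.
have [hBr' oc [D' [hD' <-]]] := Aphi_outer_conjugate hH hS hA hD.
by split=> //; split=> //; exact: (Xi_isP hH e1 hS hBr' hD').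
Qed.
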